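(* Fix $k,c>0$. For a generic planar Helmholtz wave $\Psi(x,y,t)$, the phase singularity at any point and moment where $\Psi=0$ is radially equivalent to the regular singularity $(x,y)\mapsto x+\mathrm{i}y$ or to the hyperbolic singularity $(x,y)\mapsto x^2-y^2+\mathrm{i}y$ at the origin.
   Context: $\mathbb{C}$ is identified with $\mathbb{R}^2$ via $u+\mathrm{i}w=(u,w)$. A planar Helmholtz wave is a smooth complex valued function $\Psi(x,y,t)$, defined on an open subset of $\mathbb{R}^2\times\mathbb{R}$, satisfying both the Helmholtz equation $\Psi_{xx}+\Psi_{yy}+k^2\Psi=0$ and the wave equation $\Psi_{tt}=c^2(\Psi_{xx}+\Psi_{yy})$. Genericity is local: a property holds for generic Helmholtz waves if, for every Helmholtz wave $\Psi$ defined on a neighbourhood of a point $(x_0,y_0,t_0)$, there is a smaller neighbourhood $V$ of this point such that $\Psi|_V$ can be approximated arbitrarily closely in the $C^\infty$ topology by Helmholtz waves $\widetilde\Psi$ on $V$ having the property (at all points of $V$). A radial transformation near $0\in\mathbb{C}$ is a local diffeomorphism $\tau:(\mathbb{C},0)\to(\mathbb{C},0)$, $\tau(u,w)=(U,W)$, sending each radial line (ray) $\{\theta=\mathrm{const.}\}$ to a radial line, where $u+\mathrm{i}w=re^{\mathrm{i}\theta}$; equivalently $U=\rho(u,w)(au+bw)$, $W=\rho(u,w)(cu+dw)$ with $\rho$ a positive function and $a,b,c,d\in\mathbb{R}$, $ad-bc\neq0$. The phase singularity of $\Psi$ at $(x_1,y_1,t_1)$ with $\Psi(x_1,y_1,t_1)=0$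 is radially equivalent to $\varphi$ at the origin if there are a local diffeomorphism $\sigma$ of the plane with $\sigma(0,0)=(x_1,y_1)$ and a local radial transformation $\tau$ such that $\Psi(\sigma(x,y),t_1)=\tau(\varphi(x,y))$ near the origin. *)

(* Defs.v *)
From mathcomp Require Import all_boot all_order all_algebra.
From mathcomp Require Import all_classical all_reals all_analysis.

Set Implicit Arguments.
Unset Strict Implicit.
Unset Printing Implicit Defensive.

Import Order.TTheory GRing.Theory Num.Theory.
Import numFieldNormedType.Exports.

Local Open Scope classical_set_scope.
Local Open Scope ring_scope.

Section Smooth.
Context {R : realType} {V W : normedModType R}.

(* Maps are total; only their values on the open set [U] matter.  In finite
   dimension this is the usual inductive definition of the class C^n. *)
Fixpoint Ck (n : nat) (U : set V) (f : V -> W) : Prop :=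
  if n is m.+1 then
    (forall p, U p -> differentiable f p) /\ (forall v, Ck m U ('D_v f))
  else forall p, U p -> {for p, continuous f}.

Definition smooth_on (U : set V) (f : V -> W) : Prop := forall n, Ck n U f.

Definition iter_derive (vs : seq V) (f : V -> W) : V -> W :=
  foldr (fun v g => 'D_v g) f vs.

End Smooth.

Definition local_diffeo {R : realType} {V W : normedModType R} (f : V -> W) (p : V) : Prop :=
  exists (U : set V) (U' : set W) (g : W -> V),
    [/\ open U, U p & open U'] /\
    [/\ smooth_on U f, smooth_on U' g,
        (forall q, U q -> U' (f q) /\ g (f q) = q) &
        (forall q, U' q -> U (g q) /\ f (g q) = q)].

Section Waves.
Context {R : realType}.

(* [(u, w) : R * R] stands for the complex number u + i w, and the point
   (x, y, t) of space-time is [((x, y), t)]. *)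
Local Notation plane := (R * R)%type.
Local Notation spacetime := (R * R * R)%type.

Definition ex : spacetime := (1, 0, 0).
Definition ey : spacetime := (0, 1, 0).
Definition et : spacetime := (0, 0, 1).

Definition laplacian (Psi : spacetime -> plane) (p : spacetime) : plane :=
  'D_ex ('D_ex Psi) p + 'D_ey ('D_ey Psi) p.

Definition helmholtz_wave (k c : R) (U : set spacetime)
    (Psi : spacetime -> plane) : Prop :=
  [/\ smooth_on U Psi,
      (forall p, U p -> laplacian Psi p + k ^+ 2 *: Psi p = 0) &
      (forall p, U p -> 'D_et ('D_et Psi) p = c ^+ 2 *: laplacian Psi p)].

(* [Phi] lies in the basic C^oo-neighbourhood of [Psi] given by the compact
   set [K], the order [N] and the radius [e]. *)
Definition Cinfty_close (K : set spacetime) (N : nat) (e : R)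
    (Psi Phi : spacetime -> plane) : Prop :=
  forall vs : seq spacetime, (size vs <= N)%N ->
    (forall v, v \in vs -> v \in [:: ex; ey; et]) ->
    forall p, K p -> `|iter_derive vs Phi p - iter_derive vs Psi p| < e.

(* [P Psi q] must depend only on the germ of [Psi] at [q]. *)
Definition generic_helmholtz (k c : R)
    (P : (spacetime -> plane) -> spacetime -> Prop) : Prop :=
  forall (U : set spacetime) (Psi : spacetime -> plane) (p0 : spacetime),
    open U -> U p0 -> helmholtz_wave k c U Psi ->
    exists V : set spacetime,
      [/\ open V, V p0, V `<=` U &
       forall (K : set spacetime) (N : nat) (e : R),
         compact K -> K `<=` V -> 0 < e ->
         exists Phi : spacetime -> plane,
           [/\ helmholtz_wave k c V Phi, Cinfty_close K N e Psi Phi &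
               forall q, V q -> P Phi q]].

Definition polar (r theta : R) : plane := (r * cos theta, r * sin theta).

(* Rays are mapped to rays in the sense of germs at 0, with one radius [e] of
   validity for all rays. *)
Definition radial_transformation (tau : plane -> plane) : Prop :=
  [/\ local_diffeo tau (0 : plane), tau 0 = 0 &
   exists2 e : R, 0 < e &
     forall theta, exists theta', forall r, 0 < r < e ->
       exists2 r', 0 < r' & tau (polar r theta) = polar r' theta'].

Definition radially_equivalent (Psi : spacetime -> plane) (p : spacetime)
    (phi : plane -> plane) : Prop :=
  exists sigma tau : plane -> plane,
    [/\ local_diffeo sigma (0 : plane), sigma 0 = p.1,
        radial_transformation tau &
        \forall q \near (0 : plane), Psi (sigma q, p.2) = tau (phi q)].

Definition regular_singularity (q : plane) : plane := (q.1, q.2).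

Definition hyperbolic_singularity (q : plane) : plane :=
  (q.1 ^+ 2 - q.2 ^+ 2, q.2).

End Waves.

(* Main.v *)
Require Import Defs.
From HB Require Import structures.
From mathcomp Require Import all_boot all_order all_algebra.
From mathcomp Require Import all_classical all_reals all_analysis.
From mathcomp Require Import ring lra.
Set Implicit Arguments.
Unset Strict Implicit.
Unset Printing Implicit Defensive.
Import Order.TTheory GRing.Theory Num.Theory.
Import numFieldNormedType.Exports.
Local Open Scope classical_set_scope.
Local Open Scope ring_scope.

(** Let [Psi] vanish at [q], and write [h1], [h2] for its two real components. The
    Helmholtz equation at a zero says that the spatial Hessians of [h1] and [h2]
    are traceless. If the spatial derivative of [Psi] at [q] is invertible, the
    inverse function theorem gives the regular singularity. Suppose that its rank
    is one, and that the second derivative along the kernel is not in the image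
    line. After orthogonal changes of source and target, [Psi] becomes [(F, G)] with
    [dF = 0], [d1 G = 0], [d2 G = b != 0] and [d1 d1 F = A = - d2 d2 F > 0]. The
    Jacobian determinant and [G] are then local coordinates [(s, y)] of the source
    ([fold_chart]), and in them [F = s^2 E(s, y) - y^2 N(y)] with [E] and [N]
    positive ([fold_coordinates]); the sign of the last term comes from the
    vanishing trace. The target map [(u, w) |-> N(w) (u, w)] preserves every ray,
    and takes this form to [(X^2 - Y^2, Y)] with the source coordinates
    [X = s sqrt (E N)] and [Y = y N] ([fold_standard]). This is the hyperbolic
    singularity, so only the remaining zeros, the degenerate ones, have to be
    avoided.

    The spatial 2-jets of solutions form a space of dimension ten, five for each
    component. The 2-jets of degenerate zeros are described by six parameters
    ([fold_jet]): the angles of the kernel and of the image, the derivative across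
    the kernel, the second derivative along the kernel, and two mixed second
    derivatives. Together with the three coordinates of the point this makes nine
    parameters. Ten standing waves, each a product of cosines solving both
    equations, span the 2-jets at the base point ([jet_basis_wave]), hence at all
    nearby points. So a combination of these waves whose addition creates a
    degenerate zero is determined by the nine parameters, in a Lipschitz way.
    Images of Lipschitz maps from dimension nine to dimension ten leave gaps in
    every cube: this is a pigeonhole count on a fine grid ([pigeonhole_avoid]). It
    yields arbitrarily small combinations that create no degenerate zero in a
    fixed ball ([avoid_degenerate_zero]). Derivatives of standing waves are
    standing waves, so small combinations are small in the C^oo topology
    ([perturbed_close]). *)

(** * Finite differentiability classes *)

Section CkCalculus.
Context {R : realType}.
Implicit Types V W Z : normedModType R.

Lemma open_near V (U : set V) (P : V -> Prop) p :
  open U -> U p -> (forall q, U q -> P q) -> \near p, P p.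
Proof. by move=> oU Up UP; apply: filterS UP _; exact: open_nbhs_nbhs. Qed.

Lemma derive_eq_on V W (U : set V) (f g : V -> W) p v :
  open U -> U p -> (forall q, U q -> f q = g q) -> 'D_v f p = 'D_v g p.
Proof. by move=> oU Up fg; apply: near_eq_derive; exact: open_near fg. Qed.

(** The estimate says that the error is a little-o of [h], so that [L] is the
    differential by uniqueness of first-order expansions. *)
Lemma differential_intro V W (f L : V -> W) p : linear L -> continuous L ->
  (forall e, 0 < e -> \forall h \near (0 : V), `|f (h + p) - f p - L h| <= e * `|h|) ->
  differentiable f p /\ forall v, 'D_v f p = L v.
Proof.
move=> linL cL fL.
pose LM := GRing.isLinear.Build _ _ _ _ _ linL.
pose LL : {linear V -> W} := HB.pack L LM.
have e : f \o shift p = cst (f p) + LL +o_ 0 id.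
  apply/eqaddoP => eps e0; near=> h.
  have -> : (f \o shift p - (cst (f p) + LL)) h = f (h + p) - f p - L h.
    by rewrite /= /GRing.add/= /GRing.opp/= opprD addrA.
  by near: h; exact: fL.
have dE : 'd f p = LL :> (V -> W) by exact: diff_unique.
have df : differentiable f p by apply/diff_locallyP; rewrite dE.
by split => // v; rewrite deriveE// dE.
Unshelve. all: by end_near. Qed.

Lemma differential_elim V W (f : V -> W) p : differentiable f p ->
  forall e, 0 < e ->
  \forall h \near (0 : V), `|f (h + p) - f p - 'd f p h| <= e * `|h|.
Proof.
move=> /diff_locallyP[_ /eqaddoP fL] e e0; near=> h.
have -> : f (h + p) - f p - 'd f p h = (f \o shift p - (cst (f p) + 'd f p)) h.
  by rewrite /= /GRing.add/= /GRing.opp/= opprD addrA.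
by near: h; exact: fL.
Unshelve. all: by end_near. Qed.

Lemma differentiable_near_eq V W (f g : V -> W) p :
  (\near p, f p = g p) -> differentiable f p -> differentiable g p.
Proof.
move=> fg df; have fgp := nbhs_singleton fg.
apply: (proj1 (@differential_intro _ _ g ('d f p) p _ _ _)).
- exact: linearP.
- exact: diff_continuous.
move=> e e0; near=> h.
have <- : f (h + p) = g (h + p).
  near: h; move: fg; rewrite (near_shift 0 p) /= => fg.
  by under eq_near => x do rewrite -[x + p](subr0 (x + p)) -addrA subr0 -[in X in _ + X](subr0 p).
by rewrite -fgp; near: h; exact: differential_elim.
Unshelve. all: by end_near. Qed.

Lemma Ck_sub V W n (U U' : set V) (f : V -> W) :
  U' `<=` U -> Ck n U f -> Ck n U' f.
Proof.
move=> UU; elim: n f => [|n IH] f /=; first by move=> h p /UU /h.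
by move=> [df Df]; split=> [p /UU /df//|v]; exact: IH.
Qed.

Lemma CkS V W n (U : set V) (f : V -> W) : Ck n.+1 U f -> Ck n U f.
Proof.
elim: n f => [|n IH] f [df Df]; first by move=> p /df /differentiable_continuous.
by split=> // v; exact/IH/Df.
Qed.

Lemma Ck_eq V W n (U : set V) (f g : V -> W) : open U ->
  (forall q, U q -> f q = g q) -> Ck n U f -> Ck n U g.
Proof.
move=> oU; elim: n f g => [|n IH] f g fg.
  move=> cf p Up; rewrite /prop_for /continuous_at -(fg p Up).
  apply: cvg_trans (cf p Up).
  by apply: near_eq_cvg; apply: open_near Up _ => // q Uq; rewrite fg.
move=> [df Df]; split=> [p Up|v].
  by apply: differentiable_near_eq (df p Up); exact: open_near Up fg.
by apply: IH (Df v) => p Up; exact: derive_eq_on Up fg.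
Qed.

Lemma Ck_cst V W n (U : set V) (a : W) : Ck n U (fun=> a).
Proof.
elim: n a => [|n IH] a; first by move=> p _; exact: cvg_cst.
split=> [p _|v]; first exact: differentiable_cst.
have -> : 'D_v (fun=> a) = (fun=> 0) :> (V -> W).
  by apply/funext => p; exact: derive_cst.
exact: IH.
Qed.

Lemma CkD V W n (U : set V) (f g : V -> W) : open U ->
  Ck n U f -> Ck n U g -> Ck n U (fun p => f p + g p).
Proof.
move=> oU; elim: n f g => [|n IH] f g.
  by move=> cf cg p Up; apply: cvgD; [exact: cf|exact: cg].
move=> [df Df] [dg Dg]; split=> [p Up|v].
  by apply: differentiableD; [exact: df|exact: dg].
apply: (Ck_eq oU _ (IH _ _ (Df v) (Dg v))) => p Up.
by rewrite -deriveD//; apply: diff_derivable; [exact: df|exact: dg].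
Qed.

Lemma derive_comp V W Z (f : V -> W) (g : W -> Z) p v :
  differentiable f p -> differentiable g (f p) ->
  'D_v (g \o f) p = 'D_('D_v f p) g (f p).
Proof.
move=> df dg; rewrite deriveE; last exact: differentiable_comp.
by rewrite diff_comp//= !deriveE.
Qed.

Lemma derive_linear W Z (L : W -> Z) q : linear L -> continuous L ->
  differentiable L q /\ forall v, 'D_v L q = L v.
Proof.
move=> linL cL; apply: differential_intro => // e e0; near=> h.
have -> : L (h + q) = L h + L q by rewrite -[h in LHS]scale1r linL scale1r.
by rewrite addrK subrr normr0 mulr_ge0// ltW.
Unshelve. all: by end_near. Qed.

Lemma derive_linear_comp V W Z (L : W -> Z) (f : V -> W) p v :
  linear L -> continuous L -> differentiable f p ->
  'D_v (L \o f) p = L ('D_v f p).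
Proof.
move=> lL cL df; have [dL DL] := derive_linear (f p) lL cL.
rewrite [LHS]deriveE; last exact: differentiable_comp.
by rewrite diff_comp//= -deriveE// DL deriveE.
Qed.

Lemma Ck_linear_comp V W Z n (U : set V) (L : W -> Z) (f : V -> W) : open U ->
  linear L -> continuous L -> Ck n U f -> Ck n U (L \o f).
Proof.
move=> oU linL cL; elim: n f => [|n IH] f.
  by move=> cf p Up; apply: continuous_comp; [exact: cf|exact: cL].
move=> [df Df]; split=> [p Up|v].
  by apply: differentiable_comp; [exact: df|exact: (derive_linear _ _ _).1].
apply: (Ck_eq oU _ (IH _ (Df v))) => p Up /=.
by rewrite derive_linear_comp//; exact: df.
Qed.

Lemma linear_bound_continuous V W (L : V -> W) M : linear L ->
  (forall v, `|L v| <= M * `|v|) -> continuous L.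
Proof.
move=> linL LM.
pose Mx := GRing.isLinear.Build _ _ _ _ _ linL.
pose LL : {linear V -> W} := HB.pack L Mx.
apply: (@bounded_linear_continuous _ _ _ LL); apply/linear_boundedP.
near=> r => x; apply: le_trans (LM x) _; rewrite ler_wpM2r//.
Unshelve. all: by end_near. Qed.

Lemma CkM V n (U : set V) (f g : V -> R) : open U ->
  Ck n U f -> Ck n U g -> Ck n U (fun p => f p * g p).
Proof.
move=> oU; elim: n f g => [|n IH] f g.
  by move=> cf cg p Up; apply: cvgM; [exact: cf|exact: cg].
move=> cf cg; have [df Df] := cf; have [dg Dg] := cg.
split=> [p Up|v].
  by apply: differentiableM; [exact: df|exact: dg].
have e1 := IH _ _ (CkS cf) (Dg v); have e2 := IH _ _ (CkS cg) (Df v).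
apply: (Ck_eq oU _ (CkD oU e1 e2)) => p Up.
by rewrite [RHS]deriveM//; apply: diff_derivable; [exact: df|exact: dg].
Qed.

Lemma Ck_pair V W Z n (U : set V) (f : V -> W) (g : V -> Z) : open U ->
  Ck n U f -> Ck n U g -> Ck n U (fun p => (f p, g p)).
Proof.
move=> oU; elim: n f g => [|n IH] f g.
  by move=> cf cg p Up; apply: cvg_pair; [exact: cf|exact: cg].
move=> [df Df] [dg Dg]; split=> [p Up|v].
  by apply: differentiable_pair; [exact: df|exact: dg].
apply: (Ck_eq oU _ (IH _ _ (Df v) (Dg v))) => p Up.
have dfp := df p Up; have dgp := dg p Up.
rewrite [RHS]deriveE; last exact: differentiable_pair.
by rewrite diff_pair// !deriveE.
Qed.

Lemma Ck_sum V W (I : Type) (r : seq I) n (U : set V) (F : I -> V -> W) : open U ->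
  (forall i, Ck n U (F i)) -> Ck n U (fun p => \sum_(i <- r) F i p).
Proof.
move=> oU cF; elim: r => [|i r IH].
  by apply: (Ck_eq oU _ (Ck_cst n U 0)) => p _; rewrite big_nil.
apply: (Ck_eq oU _ (CkD oU (cF i) IH)) => p _.
by rewrite big_cons.
Qed.

(** Stands for finite dimension: the derivative of [g] in a moving direction
    ['D_v f p] is then a combination of finitely many fixed partial derivatives
    of [g], which is what makes [Ck] stable under composition. *)
Definition framed W := exists (I : finType) (l : I -> W -> R) (b : I -> W),
  (forall i, linear (l i) /\ continuous (l i)) /\
  forall w, w = \sum_i l i w *: b i.

Lemma framed_real : framed R.
Proof.
exists unit, (fun=> id), (fun=> 1); split=> [i|w]; first by split=> [a x y|x]; [|exact: cvg_id].
by rewrite big_const card_unit /= addr0 /GRing.scale/= mulr1.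
Qed.

Lemma framed_pair V W : framed V -> framed W -> framed (V * W)%type.
Proof.
move=> [I [l [b [lin e]]]] [J [l' [b' [lin' e']]]].
exists (I + J)%type, (fun k (w : V * W) => match k with inl i => l i w.1 | inr j => l' j w.2 end).
exists (fun k => match k with inl i => (b i, 0) | inr j => (0, b' j) end).
split=> [[i|j]|[v w]].
- have [li ci] := lin i; split=> [a x y|x] /=; first exact: li.
  by apply: (continuous_comp (f := fst) (g := l i)); [exact: cvg_fst|exact: ci].
- have [li ci] := lin' j; split=> [a x y|x] /=; first exact: li.
  by apply: (continuous_comp (f := snd) (g := l' j)); [exact: cvg_snd|exact: ci].
rewrite big_sumType /=.
have -> : \sum_i l i v *: (b i, 0 : W) = (v, 0).
  rewrite [in RHS](e v).
  elim/big_rec2: _ => // i x y _ ->.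
  by apply/eqP; rewrite xpair_eqE /= scaler0 addr0 !eqxx.
have -> : \sum_i l' i w *: (0 : V, b' i) = (0, w).
  rewrite [in RHS](e' w).
  elim/big_rec2: _ => // i x y _ ->.
  by apply/eqP; rewrite xpair_eqE /= scaler0 addr0 !eqxx.
by apply/eqP; rewrite xpair_eqE /= addr0 add0r !eqxx.
Qed.

Lemma derive_frame V (f : V -> R) p v (I : finType) (l : I -> V -> R) (b : I -> V) :
  (forall w, w = \sum_i l i w *: b i) ->
  differentiable f p -> 'D_v f p = \sum_i l i v * 'D_(b i) f p.
Proof.
move=> e df; rewrite deriveE// {1}(e v) linear_sum; apply: eq_bigr => i _.
by rewrite linearZ deriveE.
Qed.

Lemma Ck_comp V W n (U : set V) (U' : set W) (f : V -> W) (g : W -> R) : framed W ->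
  open U -> (forall p, U p -> U' (f p)) ->
  Ck n U f -> Ck n U' g -> Ck n U (g \o f).
Proof.
move=> [I [l [b [lin e]]]] oU fU; elim: n g => [|n IH] g.
  by move=> cf cg p Up; apply: continuous_comp; [exact: cf|exact/cg/fU].
move=> cf [dg Dg]; have [df Df] := cf; split=> [p Up|v].
  by apply: differentiable_comp; [exact: df|exact/dg/fU].
apply: (Ck_eq (f := fun p => \sum_i l i ('D_v f p) * 'D_(b i) g (f p))) => //.
  move=> p Up; rewrite [RHS]derive_comp; [|exact: df|exact/dg/fU].
  by rewrite (derive_frame _ e)//; exact/dg/fU.
apply: Ck_sum => // i; apply: CkM => //.
  by apply: (Ck_linear_comp (L := l i)) (Df v) => //; have [] := lin i.
by apply: IH (Dg _); exact: CkS.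
Qed.

End CkCalculus.

(** * Smooth maps *)

Section SmoothCalculus.
Context {R : realType}.
Implicit Types V W Z : normedModType R.

Lemma smooth_sub V W (U U' : set V) (f : V -> W) :
  U' `<=` U -> smooth_on U f -> smooth_on U' f.
Proof. by move=> UU sf n; exact: Ck_sub (sf n). Qed.

Lemma smooth_eq V W (U : set V) (f g : V -> W) : open U ->
  (forall q, U q -> f q = g q) -> smooth_on U f -> smooth_on U g.
Proof. by move=> oU fg sf n; exact: Ck_eq (sf n). Qed.

Lemma smooth_differentiable V W (U : set V) (f : V -> W) p :
  smooth_on U f -> U p -> differentiable f p.
Proof. by move=> /(_ 1%N)[df _] /df. Qed.

Lemma smooth_continuous V W (U : set V) (f : V -> W) p :
  smooth_on U f -> U p -> {for p, continuous f}.
Proof. by move=> /(_ 0%N); apply. Qed.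

Lemma smooth_derive V W (U : set V) (f : V -> W) v :
  smooth_on U f -> smooth_on U ('D_v f).
Proof. by move=> sf n; case: (sf n.+1) => _; exact. Qed.

Lemma smooth_cst V W (U : set V) (a : W) : smooth_on U (fun=> a).
Proof. by move=> n; exact: Ck_cst. Qed.

Lemma smoothD V W (U : set V) (f g : V -> W) : open U ->
  smooth_on U f -> smooth_on U g -> smooth_on U (fun p => f p + g p).
Proof. by move=> oU sf sg n; exact: CkD. Qed.

Lemma smoothM V (U : set V) (f g : V -> R) : open U ->
  smooth_on U f -> smooth_on U g -> smooth_on U (fun p => f p * g p).
Proof. by move=> oU sf sg n; exact: CkM. Qed.

Lemma smooth_sum V W (I : Type) (r : seq I) (U : set V) (F : I -> V -> W) : open U ->
  (forall i, smooth_on U (F i)) -> smooth_on U (fun p => \sum_(i <- r) F i p).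
Proof. by move=> oU sF n; apply: Ck_sum => // i; exact: sF. Qed.

Lemma smooth_pair V W Z (U : set V) (f : V -> W) (g : V -> Z) : open U ->
  smooth_on U f -> smooth_on U g -> smooth_on U (fun p => (f p, g p)).
Proof. by move=> oU sf sg n; exact: Ck_pair. Qed.

Lemma smooth_id V (U : set V) : smooth_on U (fun p => p).
Proof.
case=> [|n]; first by move=> p _; exact: cvg_id.
split=> [p _|v]; first by have := @ex_diff _ _ _ _ _ _ _ (@is_diff_id R V p).
have -> : 'D_v (fun p => p) = (fun=> v) :> (V -> V) by apply/funext => p; exact: derive_id.
exact: Ck_cst.
Qed.

Lemma smooth_linear_comp V W Z (U : set V) (L : W -> Z) (f : V -> W) : open U ->
  linear L -> continuous L -> smooth_on U f -> smooth_on U (L \o f).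
Proof. by move=> oU lL cL sf n; exact: Ck_linear_comp. Qed.

Lemma derive_fst V W Z (f : V -> W * Z) p v : differentiable f p ->
  'D_v (fun q => (f q).1) p = ('D_v f p).1.
Proof.
by move=> df; apply: (@derive_linear_comp _ _ _ _ fst) => // x; exact: cvg_fst.
Qed.

Lemma derive_snd V W Z (f : V -> W * Z) p v : differentiable f p ->
  'D_v (fun q => (f q).2) p = ('D_v f p).2.
Proof.
by move=> df; apply: (@derive_linear_comp _ _ _ _ snd) => // x; exact: cvg_snd.
Qed.

Lemma smooth_fst V W Z (U : set V) (f : V -> W * Z) : open U ->
  smooth_on U f -> smooth_on U (fun p => (f p).1).
Proof.
by move=> oU sf; apply: (smooth_linear_comp (L := fst)) sf => // x; exact: cvg_fst.
Qed.

Lemma smooth_snd V W Z (U : set V) (f : V -> W * Z) : open U ->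
  smooth_on U f -> smooth_on U (fun p => (f p).2).
Proof.
by move=> oU sf; apply: (smooth_linear_comp (L := snd)) sf => // x; exact: cvg_snd.
Qed.

Lemma smoothMl V (U : set V) (f : V -> R) (a : R) : open U ->
  smooth_on U f -> smooth_on U (fun p => a * f p).
Proof. by move=> oU; apply: smoothM => //; exact: smooth_cst. Qed.

Lemma smoothN V (U : set V) (f : V -> R) : open U ->
  smooth_on U f -> smooth_on U (fun p => - f p).
Proof.
by move=> oU /(smoothMl (-1) oU); apply: smooth_eq => // p _; rewrite mulN1r.
Qed.

Lemma smoothB V (U : set V) (f g : V -> R) : open U ->
  smooth_on U f -> smooth_on U g -> smooth_on U (fun p => f p - g p).
Proof. by move=> oU sf /(smoothN oU); exact: smoothD. Qed.

Lemma smooth_comp V W (U : set V) (U' : set W) (f : V -> W) (g : W -> R) : framed W ->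
  open U -> (forall p, U p -> U' (f p)) ->
  smooth_on U f -> smooth_on U' g -> smooth_on U (fun p => g (f p)).
Proof. by move=> fW oU fU sf sg n; exact: (Ck_comp fW oU fU (sf n) (sg n)). Qed.

Lemma smooth_comp2 V W (U : set V) (U' : set W) (f : V -> W) (g : W -> R * R) :
  framed W -> open U -> open U' -> (forall p, U p -> U' (f p)) ->
  smooth_on U f -> smooth_on U' g -> smooth_on U (fun p => g (f p)).
Proof.
move=> fW oU oU' fU sf sg.
apply: (smooth_eq (f := fun p => ((g (f p)).1, (g (f p)).2))) => //.
  by move=> q _; rewrite -surjective_pairing.
apply: smooth_pair => //.
  by apply: (smooth_comp (g := fun q => (g q).1) fW oU fU sf); exact: smooth_fst.
by apply: (smooth_comp (g := fun q => (g q).2) fW oU fU sf); exact: smooth_snd.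
Qed.

Lemma smoothV V (U : set V) (f : V -> R) : open U ->
  (forall p, U p -> f p != 0) -> smooth_on U f -> smooth_on U (fun p => (f p)^-1).
Proof.
move=> oU f0 sf; elim=> [|n IH].
  by move=> p Up; apply: cvgV; [exact: f0|exact: smooth_continuous sf Up].
split=> [p Up|v].
  by apply: differentiableV; [exact: smooth_differentiable sf Up|exact: f0].
apply: (Ck_eq (f := fun p => - 1 * ((f p)^-1 * (f p)^-1 * 'D_v f p))) => //.
  move=> p Up.
  have df := smooth_differentiable sf Up.
  rewrite [RHS](@deriveV R V f p v (f0 p Up) (diff_derivable (v := v) df)).
  by rewrite mulN1r expr2 invfM scaleNr.
by do !apply: CkM => //; [exact: Ck_cst|exact: smooth_derive].
Qed.

Lemma derive_real_comp V (f : V -> R) (h : R -> R) p v dh :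
  differentiable f p -> is_derive (f p) 1 h dh ->
  differentiable (fun q => h (f q)) p /\ 'D_v (fun q => h (f q)) p = 'D_v f p * dh.
Proof.
move=> df dhp; have dhf : differentiable h (f p) by apply/derivable1_diffP.
split; first exact: (differentiable_comp df dhf).
rewrite (derive_comp _ df dhf) deriveE// -[X in 'd h _ X]mulr1 linearZ /=.
by rewrite -deriveE// derive_val.
Qed.

Lemma smooth_sqrt V (U : set V) (f : V -> R) : open U ->
  (forall p, U p -> 0 < f p) -> smooth_on U f -> smooth_on U (fun p => Num.sqrt (f p)).
Proof.
move=> oU f0 sf.
have dsq p v : U p -> differentiable (fun q => Num.sqrt (f q)) p /\
    'D_v (fun q => Num.sqrt (f q)) p = 'D_v f p * (2 * Num.sqrt (f p))^-1.
  move=> Up; apply: derive_real_comp; first exact: smooth_differentiable sf Up.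
  by apply: is_derive1_sqrt; exact: f0.
elim=> [|n IH].
  by move=> p Up; have [/differentiable_continuous] := dsq p 0 Up.
split=> [p Up|v]; first by have [] := dsq p 0 Up.
apply: (Ck_eq (f := fun p => 'D_v f p * (2 * Num.sqrt (f p))^-1)) => //.
  by move=> p Up; have [_ ->] := dsq p v Up.
apply: CkM; [by []|exact: smooth_derive|].
apply: (Ck_eq (f := fun p => 2^-1 * (Num.sqrt (f p) * (f p)^-1))) => //.
  move=> p Up; rewrite invfM; congr (_ * _).
  have fp := f0 p Up; have sp : Num.sqrt (f p) != 0 by rewrite gt_eqF// sqrtr_gt0.
  by rewrite -[X in _ / X](sqr_sqrtr (ltW fp)) expr2 invfM mulVKf.
apply: CkM => //; first exact: Ck_cst.
apply: CkM => //; apply: smoothV => // p Up.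
by rewrite gt_eqF// f0.
Qed.

Lemma smooth_cos V (U : set V) (f : V -> R) : open U ->
  smooth_on U f -> smooth_on U (fun p => cos (f p)).
Proof.
move=> oU sf.
have dc a p v : U p -> differentiable (fun q => cos (f q + a)) p /\
    'D_v (fun q => cos (f q + a)) p = 'D_v f p * cos (f p + (a + pi / 2)).
  move=> Up.
  have df : differentiable f p := smooth_differentiable sf Up.
  have dfa : differentiable (fun q => f q + a) p.
    by apply: differentiableD => //; exact: differentiable_cst.
  have [d1 d2] := derive_real_comp v dfa (is_derive_cos (f p + a)).
  split=> //; rewrite d2 addrA cosDpihalf; congr (_ * _).
  have -> : (fun q => f q + a) = f + cst a by [].
  rewrite deriveD; [|exact: diff_derivable|exact: derivable_cst].
  by rewrite derive_cst addr0.
suff H n a : Ck n U (fun q => cos (f q + a)).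
  by move=> n; apply: Ck_eq (H n 0) => // p _; rewrite addr0.
elim: n a => [|n IH] a.
  by move=> p Up; have [/differentiable_continuous] := dc a p 0 Up.
split=> [p Up|v]; first by have [] := dc a p 0 Up.
apply: (Ck_eq (f := fun p => 'D_v f p * cos (f p + (a + pi / 2)))) => //.
  by move=> p Up; have [_ ->] := dc a p v Up.
by apply: CkM => //; exact: smooth_derive.
Qed.
End SmoothCalculus.

(** * Strict differentiability *)

Section ProductComplete.
Context {R : realType}.
Local Notation plane := (R * R)%type.
(** Completeness of the plane is what Banach's fixed point theorem asks for in the
    proof of the inverse function theorem. *)
Lemma real_plane_complete (F : set_system plane) : ProperFilter F -> cauchy F -> exists l : plane, F --> l.
Proof.
move=> PF /cauchyP cF.
have c1 : cvg (fst @ F).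
  apply: cauchy_cvg; apply/cauchyP => e e0; have [x Fx] := cF e e0.
  have H : F [set y | ball x.1 e y.1] by apply: filterS Fx => y [].
  by exists x.1; exact: H.
have c2 : cvg (snd @ F).
  apply: cauchy_cvg; apply/cauchyP => e e0; have [x Fx] := cF e e0.
  have H : F [set y | ball x.2 e y.2] by apply: filterS Fx => y [].
  by exists x.2; exact: H.
exists (lim (fst @ F), lim (snd @ F)) => A /(cvg_pair c1 c2) FA.
suff: F A by [].
by apply: (@filterS _ F _ _ _ _ FA) => -[a b].
Qed.

HB.saturate prod.
Lemma plane_cauchy_cvg (F : set_system plane) : ProperFilter F -> cauchy F -> [cvg F in plane].
Proof. by move=> PF cF; have [l Fl] := real_plane_complete PF cF; apply/cvg_ex; exists l. Qed.
HB.instance Definition _ := Uniform_isComplete.Build plane plane_cauchy_cvg.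
End ProductComplete.

Section MeanValue.
Context {R : realType}.
Implicit Types V W Z : normedModType R.

Lemma segment_in_ball V (p x y : V) r (t : R) : 0 <= t <= 1 ->
  ball p r x -> ball p r y -> ball p r (x + t *: (y - x)).
Proof.
move=> /andP[t0 t1]; rewrite -!ball_normE /= => px py.
have -> : p - (x + t *: (y - x)) = (1 - t) *: (p - x) + t *: (p - y).
  rewrite opprD addrA -scalerN opprB scalerBl scale1r -[RHS]addrA -scalerN -scalerDr.
  by congr (_ + _ *: _); rewrite opprB addrA subrK.
apply: le_lt_trans (ler_normD _ _) _; rewrite !normrZ !ger0_norm ?subr_ge0//.
have [->|tn0] := eqVneq t 0; first by rewrite subr0 mul1r mul0r addr0.
have tp : 0 < t by rewrite lt_neqAle eq_sym tn0.
have h2 : t * `|p - y| < t * r by rewrite ltr_pM2l.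
have h3 : (1 - t) * `|p - x| <= (1 - t) * r by rewrite ler_wpM2l ?subr_ge0// ltW.
by have := ler_ltD h3 h2; rewrite -mulrDl subrK mul1r.
Qed.

Lemma mean_value V (f : V -> R) x y :
  (forall t : R, 0 <= t <= 1 -> differentiable f (x + t *: (y - x))) ->
  exists2 t : R, 0 <= t <= 1 & f y - f x = 'D_(y - x) f (x + t *: (y - x)).
Proof.
move=> df.
pose g (t : R) := f (x + t *: (y - x)).
have dg (t : R) : 0 <= t <= 1 -> is_derive t 1 g ('D_(y - x) f (x + t *: (y - x))).
  move=> /df dft.
  have da : is_diff t (fun s : R => x + s *: (y - x)) (fun s => s *: (y - x)).
    by apply: is_diff_eq; rewrite add0r.
  have dat : differentiable (fun s : R => x + s *: (y - x)) t by [].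
  apply: DeriveDef.
    by apply: diff_derivable; apply: (differentiable_comp dat dft).
  by rewrite (derive_comp (1 : R) dat dft) [X in 'D_X _ _]deriveE// diff_val scale1r.
have [||t] := @MVT_segment R g (fun t => 'D_(y - x) f (x + t *: (y - x))) 0 1 ler01.
- by move=> t; rewrite in_itv /= => /andP[a b]; apply: dg; rewrite !ltW.
- apply: derivable_within_continuous => t; rewrite in_itv /= => /dg.
  by move=> [].
rewrite in_itv /= => tI; rewrite /g scale1r scale0r addr0 subr0 mulr1.
by rewrite subrKC; exists t.
Qed.

Lemma ball_open_sub V (U : set V) p : open U -> U p ->
  exists2 r : R, 0 < r & ball p r `<=` U.
Proof.
by move=> oU Up; have /nbhs_ballP[r r0 rU] := open_nbhs_nbhs (conj oU Up); exists r.
Qed.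

(** The increment is a derivative at a point of the segment, and the finitely many
    partial derivatives are continuous at [p]. The estimate compares two points
    other than [p]; contractions and second differences need this. *)
Lemma strict_derivative V (U : set V) (f : V -> R) p e : framed V ->
  open U -> U p -> smooth_on U f -> 0 < e ->
  exists2 r : R, 0 < r & ball p r `<=` U /\
    forall x y, ball p r x -> ball p r y ->
      `|f y - f x - 'D_(y - x) f p| <= e * `|y - x|.
Proof.
move=> [I [l [b [lin fr]]]] oU Up sf e0.
have lM i : exists M, 0 < M /\ forall w, `|l i w| <= M * `|w|.
  have [ll cl] := lin i.
  pose Mx := GRing.isLinear.Build _ _ _ _ _ ll.
  pose LL : {linear V -> R} := HB.pack (l i) Mx.
  have /linear_boundedP[M [Mr HM]] := (proj2 (linear_bounded_continuous LL)) cl.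
  exists (`|M| + 1); split; first by rewrite ltr_wpDl.
  by apply: HM; rewrite (le_lt_trans (ler_norm _))// ltrDl.
have [M HM] := choice lM.
pose e' i := e / (M i * #|I|.+1%:R).
have e'0 i : 0 < e' i by rewrite divr_gt0// mulr_gt0// (HM i).1.
have : \forall q \near p, forall i, `|'D_(b i) f p - 'D_(b i) f q| < e' i.
  apply: filter_forall => i.
  have c := smooth_continuous (smooth_derive (b i) sf) Up.
  by move/cvgrPdist_lt : c => /(_ _ (e'0 i)).
move=> /nbhs_ballP[r1 /= r1_gt0 near_p].
have [r2 r2_gt0 r2U] := ball_open_sub oU Up.
exists (Num.min r1 r2); first by rewrite lt_min r1_gt0.
have sub1 : ball p (Num.min r1 r2) `<=` ball p r1 by apply: le_ball; rewrite ge_min lexx.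
have sub2 : ball p (Num.min r1 r2) `<=` U.
  by apply: subset_trans r2U; apply: le_ball; rewrite ge_min lexx orbT.
split=> // x y px py.
have seg t (t01 : 0 <= t <= 1) := segment_in_ball t01 px py.
have [|t t01 ->] := @mean_value V f x y.
  by move=> t /seg /sub2; exact: smooth_differentiable sf.
have dfz := smooth_differentiable sf (sub2 _ (seg t t01)).
rewrite (derive_frame _ fr)// (derive_frame _ fr); last exact: smooth_differentiable sf Up.
rewrite -sumrB; apply: le_trans (ler_norm_sum _ _ _) _.
have -> : e * `|y - x| = \sum_(i : I) M i * `|y - x| * e' i + e * `|y - x| / #|I|.+1%:R.
  rewrite (eq_bigr (fun=> e * `|y - x| / #|I|.+1%:R)); last first.
    move=> i _; rewrite /e'; have M0 : M i != 0 by rewrite gt_eqF// (HM i).1.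
    have N0 : #|I|.+1%:R != 0 :> R by rewrite pnatr_eq0.
    by move: N0; move: (_%:R) => N N0; field; rewrite M0 N0.
  by rewrite sumr_const -mulrSr -[RHS]mulr_natr divfK ?pnatr_eq0.
rewrite ler_wpDr ?divr_ge0 ?mulr_ge0 ?(ltW e0)//.
apply: ler_sum => i _; rewrite -mulrBr normrM ler_pM//; first exact: (HM i).2.
rewrite distrC ltW//; apply: near_p; exact/sub1/seg.
Qed.

End MeanValue.

(** * The inverse function theorem in the plane *)

Definition dir1 {R : realType} : R * R := (1, 0).
Definition dir2 {R : realType} : R * R := (0, 1).

Section Plane.
Context {R : realType}.
Local Notation plane := (R * R)%type.
Implicit Types (f : plane -> plane) (h : plane -> R) (p q : plane) (U : set plane).

Local Notation d1 f := ('D_dir1 f).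
Local Notation d2 f := ('D_dir2 f).

Lemma framed_plane : framed plane.
Proof. exact: framed_pair framed_real framed_real. Qed.

Lemma plane_norm_le p (c : R) : (`|p| <= c) = (`|p.1| <= c) && (`|p.2| <= c).
Proof. by rewrite prod_normE /= ge_max. Qed.

Lemma plane_decomp p : p = p.1 *: dir1 + p.2 *: dir2.
Proof.
case: p => a b; apply: injective_projections => /=.
  by rewrite /GRing.scale /= mulr1 mulr0 addr0.
by rewrite /GRing.scale /= mulr1 mulr0 add0r.
Qed.

Lemma derive_plane (W : normedModType R) (g : plane -> W) p v : differentiable g p ->
  'D_v g p = v.1 *: d1 g p + v.2 *: d2 g p.
Proof.
by move=> dg; rewrite {1}(plane_decomp v) deriveE// linearD !linearZ /= !deriveE.
Qed.

Definition jacobian f q := (d1 f q).1 * (d2 f q).2 - (d2 f q).1 * (d1 f q).2.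

Lemma smooth_jacobian U f : open U -> smooth_on U f -> smooth_on U (jacobian f).
Proof.
move=> oU sf; apply: smoothB => //; apply: smoothM => //.
- by apply: smooth_fst => //; exact: smooth_derive.
- by apply: smooth_snd => //; exact: smooth_derive.
- by apply: smooth_fst => //; exact: smooth_derive.
- by apply: smooth_snd => //; exact: smooth_derive.
Qed.

Lemma near_identity U f p : open U -> U p -> smooth_on U f ->
  d1 f p = dir1 -> d2 f p = dir2 ->
  exists2 r : R, 0 < r & [/\ ball p r `<=` U,
    forall x y, ball p r x -> ball p r y -> `|f y - f x - (y - x)| <= 2^-1 * `|y - x| &
    forall x, ball p r x -> jacobian f x != 0].
Proof.
move=> oU Up sf f1 f2.
have h0 : 0 < 2^-1 :> R by rewrite invr_gt0.
have [r1 r1_gt0 [r1U fst_close]] := strict_derivative framed_plane oU Up (smooth_fst oU sf) h0.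
have [r2 r2_gt0 [r2U snd_close]] := strict_derivative framed_plane oU Up (smooth_snd oU sf) h0.
have Jp : jacobian f p = 1 by rewrite /jacobian f1 f2 /= mulr1 mulr0 subr0.
have := smooth_continuous (smooth_jacobian oU sf) Up.
move/cvgrPdist_lt => /(_ _ ltr01); rewrite Jp => /nbhs_ballP[r3 /= r3_gt0 near_p].
pose r := Num.min r1 (Num.min r2 r3).
have sub1 : ball p r `<=` ball p r1 by apply: le_ball; rewrite ge_min lexx.
have sub2 : ball p r `<=` ball p r2 by apply: le_ball; rewrite !ge_min lexx orbT.
have sub3 : ball p r `<=` ball p r3 by apply: le_ball; rewrite !ge_min lexx !orbT.
exists r; first by rewrite !lt_min r1_gt0 r2_gt0.
have dfp : differentiable f p := smooth_differentiable sf Up.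
split=> [|x y px py|x px].
- exact: subset_trans sub1 r1U.
- have Df v : 'D_v f p = v.
    by rewrite derive_plane// f1 f2 -plane_decomp.
  rewrite plane_norm_le; apply/andP; split.
    have := fst_close x y (sub1 _ px) (sub1 _ py).
    by rewrite derive_fst// Df.
  have := snd_close x y (sub2 _ px) (sub2 _ py).
  by rewrite derive_snd// Df.
- apply/eqP => J0; have := near_p x (sub3 _ px).
  by rewrite J0 subr0 normr1 ltxx.
Qed.

Section LocalInverse.
Variables (f : plane -> plane) (p : plane) (r : R).
Hypotheses (r0 : 0 < r) (sf : smooth_on (ball p r) f).
Hypothesis fI : forall x y, ball p r x -> ball p r y ->
  `|f y - f x - (y - x)| <= 2^-1 * `|y - x|.
Hypothesis fJ : forall x, ball p r x -> jacobian f x != 0.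

Lemma near_identity_expand x y : ball p r x -> ball p r y -> `|y - x| <= 2 * `|f y - f x|.
Proof.
move=> px py; have h := fI px py.
have : `|y - x| <= `|f y - f x| + 2^-1 * `|y - x|.
  rewrite -{1}(subKr (f y - f x) (y - x)).
  by apply: le_trans (ler_normB _ _) _; rewrite lerD2l.
by move: `|y - x| `|f y - f x| => a b; lra.
Qed.

Lemma near_identity_inj x y : ball p r x -> ball p r y -> f x = f y -> x = y.
Proof.
move=> px py fxy; have := near_identity_expand px py.
by rewrite fxy subrr normr0 mulr0 normr_le0 subr_eq0 => /eqP.
Qed.

(** Solving [f x = y] is finding a fixed point of the contraction
    [x |-> x - f x + y]. *)
Lemma near_identity_surj y : ball (f p) (r / 4) y -> exists2 x, ball p r x & f x = y.
Proof.
rewrite -ball_normE /= => yr.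
pose T x := x - f x + y.
pose K := closed_ball p (r / 2).
have KE : K = [set x | `|p - x| <= r / 2] by rewrite /K closed_ballE// divr_gt0.
have Kr : K `<=` ball p r.
  by rewrite KE => x /= px; rewrite -ball_normE /=; apply: le_lt_trans px _; move: r0 => ?; lra.
have pp : ball p r p by exact: ballxx.
have TK : set_fun K K T.
  move=> x Kx; have xr := Kr _ Kx; move: Kx; rewrite KE /= => Kx.
  have -> : p - T x = (f x - f p - (x - p)) + (f p - y).
    rewrite /T; move: (f x) (f p) => fx fp.
    by apply: injective_projections; rewrite /=; ring.
  apply: le_trans (ler_normD _ _) _.
  have := fI pp xr; rewrite [`|x - p|]distrC.
  move: yr Kx; move: `|f x - f p - (x - p)| `|f p - y| `|p - x| => A B C ? ? ?; lra.
pose Tf : {fun K >-> K} := HB.pack T (isFun.Build _ _ K K T TK).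
have cT : is_contraction Tf.
  exists (2^-1)%:nng; split=> /=; first by rewrite invf_lt1// ltr1n.
  move=> [x z] [/= /Kr Kx /Kr Kz].
  have := fI Kx Kz; rewrite [`|z - x|]distrC; congr (_ <= _).
  congr `|_|; rewrite /T; move: (f x) (f z) => fx fz.
  by apply: injective_projections; rewrite /=; ring.
have [] := banach_fixed_point cT.
- exact: closed_ball_closed.
- by exists p; rewrite KE /= subrr normr0 divr_ge0// ltW.
move=> x Kx xT; exists x; first by have := Kr _ Kx; rewrite -ball_normE.
have {}xT : x = x - f x + y := xT.
move: xT; rewrite -addrA -{1}[x]addr0 => /addrI/eqP.
by rewrite eq_sym addrC subr_eq0 => /eqP.
Qed.

Let V := ball (f p) (r / 4).
Let V0 := ball p r `&` f @^-1` V.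

Let f_cont q : ball p r q -> {for q, continuous f}.
Proof. exact: smooth_continuous. Qed.

Lemma local_inverse_domain_open : open V0.
Proof.
have oV : open V by exact: ball_open.
have oB : open (ball p r) by exact: ball_open.
rewrite openE => q [pq fq]; apply: filterI.
  exact: open_nbhs_nbhs.
by apply: f_cont => //; exact: open_nbhs_nbhs.
Qed.

Let g y := get [set x | ball p r x /\ f x = y].

Lemma local_inverseP y : V y -> ball p r (g y) /\ f (g y) = y.
Proof.
by move=> /near_identity_surj[x px fx]; apply: (@getPex _ [set x | ball p r x /\ f x = y]); exists x.
Qed.

Lemma local_inverse_cancel x : V0 x -> g (f x) = x.
Proof.
move=> [px fx]; have [pg fg] := local_inverseP fx.
exact: near_identity_inj.
Qed.

Lemma local_inverse_lipschitz y z : V y -> V z -> `|g z - g y| <= 2 * `|z - y|.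
Proof.
move=> /local_inverseP[py fy] /local_inverseP[pz fz].
by have := near_identity_expand py pz; rewrite fy fz.
Qed.

(** Cramer's formula for the inverse of the derivative of [f] at [q]. *)
Let A q (v : plane) : plane :=
  (((d2 f q).2 * v.1 - (d2 f q).1 * v.2) / jacobian f q,
   ((d1 f q).1 * v.2 - (d1 f q).2 * v.1) / jacobian f q).

(** With [h] the increment of [g] for the increment [k], the error [h - A k] is the
    image under [- A] of the first-order error of [f], and [h] is at most twice
    as long as [k]. *)
Lemma inverse_derive y : V y ->
  differentiable g y /\ forall v, 'D_v g y = A (g y) v.
Proof.
move=> Vy; have [pg fg] := local_inverseP Vy.
set x := g y in pg fg *.
have dfx : differentiable f x := smooth_differentiable sf pg.
have J0 := fJ pg.
have linA : linear (A x).
  move=> a u w; rewrite /A; move: (jacobian f x) J0 (d1 f x) (d2 f x) => J J0 a1 a2.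
  by apply: injective_projections; rewrite /= /GRing.scale /=; field.
have AE v : A x ('d f x v) = v.
  rewrite -deriveE// derive_plane// /A; move: J0; rewrite /jacobian.
  move: (d1 f x) (d2 f x) => a1 a2 J0.
  by apply: injective_projections; rewrite /= /GRing.scale /=; field.
pose M := (`|(d2 f x).2| + `|(d2 f x).1| + `|(d1 f x).1| + `|(d1 f x).2|) / `|jacobian f x| + 1.
have M0 : 0 < M by rewrite ltr_wpDl// divr_ge0// !addr_ge0.
have AM v : `|A x v| <= M * `|v|.
  have [v1 v2] : `|v.1| <= `|v| /\ `|v.2| <= `|v| by apply/andP; rewrite -plane_norm_le.
  have bnd a b c d (C : R) : `|b| <= C -> `|d| <= C -> `|a * b - c * d| <= (`|a| + `|c|) * C.
    move=> bC dC; apply: le_trans (ler_normB _ _) _.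
    by rewrite !normrM mulrDl lerD// ler_wpM2l.
  rewrite plane_norm_le /A /M; set J := jacobian f x; have nJ : 0 < `|J| by rewrite normr_gt0.
  apply/andP; split; rewrite /= normrM normfV mulrDl mul1r ler_wpDr// mulrAC ler_wpM2r ?invr_ge0//.
    by apply: le_trans (bnd _ _ _ _ _ v1 v2) _; rewrite ler_wpM2r// -addrA lerDl addr_ge0.
  apply: le_trans (bnd _ _ _ _ _ v2 v1) _; rewrite ler_wpM2r//.
  by rewrite -[leRHS]addrA lerDr addr_ge0.
have cA : continuous (A x) := linear_bound_continuous linA AM.
apply: differential_intro => // e e0.
have e'0 : 0 < e / (2 * M) by rewrite divr_gt0// mulr_gt0.
have fd := differential_elim dfx e'0.
have [r1 r1_gt0 r1V] := ball_open_sub (ball_open _ _ : open V) Vy.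
have /nbhs_ballP[r2 /= r2_gt0 near0] := fd.
apply/nbhs_ballP; exists (Num.min r1 (r2 / 2)) => /=.
  by rewrite lt_min r1_gt0 divr_gt0.
move=> k; rewrite -ball_normE /= sub0r normrN lt_min => /andP[k1 k2].
have Vk : V (k + y).
  by apply: r1V; rewrite -ball_normE /= opprD addrCA subrr addr0 normrN.
have [pgk fgk] := local_inverseP Vk.
have hk := local_inverse_lipschitz Vy Vk; rewrite addrK in hk.
set h := g (k + y) - g y in hk *.
have hb : ball 0 r2 h.
  rewrite -ball_normE /= sub0r normrN; apply: le_lt_trans hk _.
  by rewrite mulrC -ltr_pdivlMr.
have hx : h + x = g (k + y) by rewrite /h /x subrK.
have := near0 h hb; rewrite hx fgk fg addrK => fh.
have -> : h - A x k = - A x (k - 'd f x h).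
  have -> : A x (k - 'd f x h) = A x k - A x ('d f x h).
    by rewrite -[k in LHS]scale1r -scaleN1r addrC linA scaleN1r scale1r addrC.
  by rewrite AE opprB.
rewrite normrN; apply: le_trans (AM _) _.
have : M * `|k - 'd f x h| <= M * (e / (2 * M) * `|h|) by rewrite ler_pM2l.
move/le_trans; apply.
have -> : M * (e / (2 * M) * `|h|) = e / 2 * `|h| by field; rewrite gt_eqF.
have : e / 2 * `|h| <= e / 2 * (2 * `|k|) by rewrite ler_pM2l// divr_gt0.
by move/le_trans; apply; rewrite mulrA divfK.
Qed.

(** The derivative of [g] is Cramer's expression in the derivatives of [f] at [g],
    so each order of differentiability of [g] gives the next one. *)
Lemma inverse_smooth : smooth_on V g.
Proof.
elim=> [|n IH].
  by move=> y /inverse_derive[/differentiable_continuous].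
have oV : open V by exact: ball_open.
have oB : open (ball p r) by exact: ball_open.
split=> [y /inverse_derive[]//|v].
apply: (Ck_eq (f := fun y => A (g y) v)) => //.
  by move=> y /inverse_derive[_ ->].
have gB y : V y -> ball p r (g y) by move=> /local_inverseP[].
have s1 := smooth_derive dir1 sf; have s2 := smooth_derive dir2 sf.
have s11 := smooth_fst oB s1; have s12 := smooth_snd oB s1.
have s21 := smooth_fst oB s2; have s22 := smooth_snd oB s2.
have sJ := smoothV oB fJ (smooth_jacobian oB sf).
have sc (c : R) := smooth_cst (ball p r) c.
apply: Ck_pair => //.
  apply: (Ck_comp (g := fun q => ((d2 f q).2 * v.1 - (d2 f q).1 * v.2) / jacobian f q)
    framed_plane oV gB IH).
  exact (smoothM oB (smoothB oB (smoothM oB s22 (sc v.1)) (smoothM oB s21 (sc v.2))) sJ n).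
apply: (Ck_comp (g := fun q => ((d1 f q).1 * v.2 - (d1 f q).2 * v.1) / jacobian f q)
  framed_plane oV gB IH).
exact (smoothM oB (smoothB oB (smoothM oB s11 (sc v.2)) (smoothM oB s12 (sc v.1))) sJ n).
Qed.

Lemma near_identity_local_diffeo : local_diffeo f p.
Proof.
exists V0, V, g; split; split.
- exact: local_inverse_domain_open.
- by split; apply: ballxx => //; rewrite divr_gt0.
- exact: ball_open.
- by apply: smooth_sub sf => q [].
- exact: inverse_smooth.
- by move=> q V0q; split; [case: V0q|exact: local_inverse_cancel].
- move=> y Vy; have [pg fg] := local_inverseP Vy.
  by split=> //; split=> //=; rewrite /preimage /= fg.
Qed.

End LocalInverse.

Lemma open_preimage_on (V W : normedModType R) (U : set V) (U' : set W) (f : V -> W) :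
  open U -> open U' -> smooth_on U f -> open (U `&` f @^-1` U').
Proof.
move=> oU oU' sf; rewrite openE => q [Uq fq]; apply: filterI.
  exact: open_nbhs_nbhs.
by apply: (smooth_continuous sf Uq); exact: open_nbhs_nbhs.
Qed.

Lemma local_diffeo_comp f1 f2 p : local_diffeo f1 p -> local_diffeo f2 (f1 p) ->
  local_diffeo (f2 \o f1) p.
Proof.
move=> [U1 [U1' [g1 [[oU1 U1p oU1'] [sf1 sg1 f1K g1K]]]]].
move=> [U2 [U2' [g2 [[oU2 U2p oU2'] [sf2 sg2 f2K g2K]]]]].
exists (U1 `&` f1 @^-1` U2), (U2' `&` g2 @^-1` U1'), (g1 \o g2).
have o1 : open (U1 `&` f1 @^-1` U2) by exact: open_preimage_on.
have o2 : open (U2' `&` g2 @^-1` U1') by exact: open_preimage_on.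
split; split => //.
- apply: (smooth_comp2 framed_plane o1 oU2 _ _ sf2); first by move=> q [].
  by apply: smooth_sub sf1 => q [].
- apply: (smooth_comp2 framed_plane o2 oU1' _ _ sg1); first by move=> q [].
  by apply: smooth_sub sg2 => q [].
- move=> q [U1q U2q]; have [h1 h2] := f1K q U1q; have [h3 h4] := f2K _ U2q.
  by rewrite /= h4 h2; split=> //; split=> //=; rewrite /preimage /= h4.
- move=> q [U1q U2q]; have [h1 h2] := g2K q U1q; have [h3 h4] := g1K _ U2q.
  by rewrite /= h4 h2; split=> //; split=> //=; rewrite /preimage /= h4.
Qed.

Lemma local_diffeo_inv f p : local_diffeo f p ->
  exists g, [/\ local_diffeo g (f p), g (f p) = p,
    (\forall q \near p, g (f q) = q) & (\forall q \near f p, f (g q) = q)].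
Proof.
move=> [U [U' [g [[oU Up oU'] [sf sg fK gK]]]]].
have [U'fp gfp] := fK p Up.
exists g; split=> //.
- by exists U', U, f; split; split.
- by apply: open_near Up _ => // q /fK[].
- by apply: open_near U'fp _ => // q /gK[].
Qed.

Definition linear_map (a b c d : R) p : plane := (a * p.1 + b * p.2, c * p.1 + d * p.2).

Lemma smooth_linear_map a b c d U : open U -> smooth_on U (linear_map a b c d).
Proof.
move=> oU; have sc (e : R) := smooth_cst U e.
have s1 := smooth_fst oU (smooth_id U); have s2 := smooth_snd oU (smooth_id U).
by apply: smooth_pair => //; apply: smoothD => //; apply: smoothM.
Qed.

Lemma linear_map_cancel a b c d p : a * d - b * c != 0 ->
  let D := a * d - b * c in
  linear_map (d / D) (- b / D) (- c / D) (a / D) (linear_map a b c d p) = p.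
Proof. by move=> D0; apply: injective_projections; rewrite /=; field. Qed.

Lemma linear_map_cancel_inv a b c d p : a * d - b * c != 0 ->
  let D := a * d - b * c in
  linear_map a b c d (linear_map (d / D) (- b / D) (- c / D) (a / D) p) = p.
Proof. by move=> D0; apply: injective_projections; rewrite /=; field. Qed.

Lemma linear_map_local_diffeo a b c d p : a * d - b * c != 0 ->
  local_diffeo (linear_map a b c d) p.
Proof.
move=> D0; have oT : open [set: plane] by exact: openT.
pose D := a * d - b * c.
exists setT, setT, (linear_map (d / D) (- b / D) (- c / D) (a / D)); split; split=> //.
- exact: smooth_linear_map.
- exact: smooth_linear_map.
- by move=> q _; split=> //; exact: linear_map_cancel.
- by move=> q _; split=> //; exact: linear_map_cancel_inv.
Qed.

(** Composition with the inverse of the derivative at [p] reduces to the case of a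
    derivative equal to the identity, where [near_identity] applies. *)
Theorem inverse_function U f p : open U -> U p -> smooth_on U f ->
  jacobian f p != 0 -> local_diffeo f p.
Proof.
move=> oU Up sf J0.
have dfp : differentiable f p := smooth_differentiable sf Up.
set a := (d1 f p).1; set b := (d2 f p).1; set c := (d1 f p).2; set d := (d2 f p).2.
have D0 : a * d - b * c != 0 by [].
pose D := a * d - b * c.
pose B := linear_map (d / D) (- b / D) (- c / D) (a / D).
have linB : linear B.
  by move=> e u w; apply: injective_projections; rewrite /= /GRing.scale /=; ring.
have cB : continuous B.
  have sB := smooth_linear_map (d / D) (- b / D) (- c / D) (a / D) (@openT plane).
  by move=> x; exact: (smooth_continuous sB).
have sBf : smooth_on U (B \o f) by exact: smooth_linear_comp.
have e1 : d1 (B \o f) p = dir1.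
  rewrite derive_linear_comp// /B /D; move: D0; rewrite /a /b /c /d.
  move: (d1 f p) (d2 f p) => [x1 x2] [y1 y2] /= D0.
  by apply: injective_projections; rewrite /=; field.
have e2 : d2 (B \o f) p = dir2.
  rewrite derive_linear_comp// /B /D; move: D0; rewrite /a /b /c /d.
  move: (d1 f p) (d2 f p) => [x1 x2] [y1 y2] /= D0.
  by apply: injective_projections; rewrite /=; field.
have [r r0 [rU BI BJ]] := near_identity oU Up sBf e1 e2.
have diffB : local_diffeo (B \o f) p.
  by apply: (near_identity_local_diffeo r0) => //; exact: smooth_sub rU sBf.
have -> : f = linear_map a b c d \o (B \o f).
  by apply/funext => q /=; rewrite linear_map_cancel_inv.
apply: local_diffeo_comp => //; exact: linear_map_local_diffeo.
Qed.

End Plane.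

(** * Taylor expansion with smooth remainder *)

Section UnitAverage.
Context {R : realType}.
Notation mu := (@lebesgue_measure R).
Implicit Types f g : R -> R.

Definition avg f : R := (\int[mu]_(x in `[0, 1]) f x)%R.

Definition cont01 f := forall t : R, 0 <= t <= 1 -> {for t, continuous f}.

Lemma cont01_within f : cont01 f -> {within `[0%R, 1%R], continuous f}.
Proof.
move=> cf; apply: continuous_in_subspaceT => t; rewrite inE /= in_itv /= => t01.
exact: cf.
Qed.

Lemma cont01_integrable f : cont01 f -> mu.-integrable `[0%R, 1%R] (EFin \o f).
Proof.
move=> cf; apply: continuous_compact_integrable; first exact: segment_compact.
exact: cont01_within.
Qed.

Lemma cont01D f g : cont01 f -> cont01 g -> cont01 (fun t => f t + g t).
Proof. by move=> cf cg t t01; apply: cvgD; [exact: cf|exact: cg]. Qed.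

Lemma cont01B f g : cont01 f -> cont01 g -> cont01 (fun t => f t - g t).
Proof. by move=> cf cg t t01; apply: cvgB; [exact: cf|exact: cg]. Qed.

Lemma cont01Z c f : cont01 f -> cont01 (fun t => c * f t).
Proof. by move=> cf t t01; apply: cvgM; [exact: cvg_cst|exact: cf]. Qed.

Lemma avgD f g : cont01 f -> cont01 g -> avg (fun t => f t + g t) = avg f + avg g.
Proof. by move=> cf cg; apply: RintegralD => //; exact: cont01_integrable. Qed.

Lemma avgB f g : cont01 f -> cont01 g -> avg (fun t => f t - g t) = avg f - avg g.
Proof. by move=> cf cg; apply: RintegralB => //; exact: cont01_integrable. Qed.

Lemma avgZ c f : cont01 f -> avg (fun t => c * f t) = c * avg f.
Proof. by move=> cf; apply: RintegralZl => //; exact: cont01_integrable. Qed.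

Lemma eq_avg f g : (forall t, 0 <= t <= 1 -> f t = g t) -> avg f = avg g.
Proof. by move=> fg; apply: eq_Rintegral => t; rewrite inE /= in_itv /= => /fg. Qed.

Lemma avg_cst (c : R) : avg (fun=> c) = c.
Proof.
rewrite /avg Rintegral_cst//=; have := @lebesgue_measure_itv R `[0%R, 1%R].
by rewrite /= lte_fin ltr01 oppr0 adde0 => ->; rewrite mulr1.
Qed.

Lemma avg_bound f C : cont01 f -> (forall t, 0 <= t <= 1 -> `|f t| <= C) -> `|avg f| <= C.
Proof.
move=> cf fC; have if_ := cont01_integrable cf.
apply: le_trans (le_normr_Rintegral _ if_) _ => //.
rewrite -[leRHS]avg_cst; apply: le_Rintegral => //.
- exact: integrable_norm.
- by apply: cont01_integrable => t _; exact: cvg_cst.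
Qed.

Lemma avg_FTC f F : cont01 f -> (forall t : R, 0 <= t <= 1 -> is_derive t 1 F (f t)) ->
  avg f = F 1 - F 0.
Proof.
move=> cf dF; rewrite /avg /Rintegral (@continuous_FTC2 _ f F)//.
- exact: cont01_within.
- split.
  + by move=> t; rewrite in_itv /= => /andP[t0 t1]; have [] := dF t; rewrite ?(ltW t0) ?(ltW t1).
  + apply: cvg_at_right_filter; apply: differentiable_continuous; apply/derivable1_diffP.
    by have [] := dF 0; rewrite ?lexx ?ler01.
  + apply: cvg_at_left_filter; apply: differentiable_continuous; apply/derivable1_diffP.
    by have [] := dF 1; rewrite ?lexx ?ler01.
- move=> t; rewrite in_itv /= => /andP[t0 t1]; rewrite derive1E.
  by have [] := dF t; rewrite ?(ltW t0) ?(ltW t1).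
Qed.

End UnitAverage.

Section ParameterAverage.
Context {R : realType}.
Local Notation plane := (R * R)%type.
Local Notation d1 f := ('D_dir1 f).
Local Notation d2 f := ('D_dir2 f).
Implicit Types (Q : plane -> R) (w : R -> R) (p h : plane).

Definition contract (t : R) p : plane := (t * p.1, p.2).

(** Weighted average along the segment from [(0, p.2)] to [p]. Differentiation in
    the first coordinate multiplies the weight by [t], so that smoothness has to be
    proved for all weights at once. *)
Definition wavg w Q p := avg (fun t => w t * Q (contract t p)).

Variable r : R.
Local Notation B := (ball (0 : plane) r).

Lemma contract_norm t p : 0 <= t <= 1 -> `|contract t p| <= `|p|.
Proof.
move=> /andP[t0 t1]; have /andP[p1 p2] : (`|p.1| <= `|p|) && (`|p.2| <= `|p|).
  by rewrite -plane_norm_le.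
rewrite plane_norm_le /= p2 andbT normrM ger0_norm//.
by apply: le_trans p1; rewrite ler_piMl.
Qed.

Lemma contract_ball t p : 0 <= t <= 1 -> B p -> B (contract t p).
Proof.
move=> t01; rewrite -ball_normE /= !sub0r !normrN.
by apply: le_lt_trans; exact: contract_norm.
Qed.

Lemma contract_continuous p : continuous (contract^~ p).
Proof.
move=> t; have c1 : s * p.1 @[s --> t] --> t * p.1.
  by apply: cvgM; [exact: cvg_id|exact: cvg_cst].
have c2 : cst p.2 s @[s --> t] --> p.2 by exact: cvg_cst.
exact: (cvg_pair c1 c2).
Qed.

Lemma wavg_cont01 w Q p : continuous w -> smooth_on B Q -> B p ->
  cont01 (fun t => w t * Q (contract t p)).
Proof.
move=> cw sQ Bp t t01; apply: cvgM; first exact: cw.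
apply: (@continuous_comp _ _ _ (contract^~ p) Q); first exact: contract_continuous.
by apply: smooth_continuous sQ _; exact: contract_ball.
Qed.

Lemma contractD t h p : contract t (h + p) = contract t h + contract t p.
Proof. by apply: injective_projections; rewrite /= ?mulrDr. Qed.

(** The first-order expansion of [Q] holds uniformly along the compact segment
    of points [contract t p], which allows integrating it. *)
Lemma contract_expansion Q p e : smooth_on B Q -> B p -> 0 < e ->
  \forall h \near (0 : plane), forall t, 0 <= t <= 1 ->
    B (h + p) /\
    `|Q (contract t (h + p)) - Q (contract t p) -
      (t * h.1 * d1 Q (contract t p) + h.2 * d2 Q (contract t p))| <= e * `|h|.
Proof.
have halves (c : R) : e / 2 * c + (c * (e / 4) + c * (e / 4)) <= e * c.
  by rewrite le_eqVlt; apply/orP; left; apply/eqP; field.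
move=> sQ Bp e0; have oB : open B by exact: ball_open.
have nB : \forall h \near (0 : plane), B (h + p).
  have [r1 r1_gt0 r1B] := ball_open_sub oB Bp.
  apply/nbhs_ballP; exists r1 => //= h hB.
  have hr : `|h| < r1 by move: hB; rewrite -ball_normE /= sub0r normrN.
  by apply: r1B; rewrite -ball_normE /= opprD addrCA subrr addr0 normrN.
pose P (h : plane) (t : R) := 0 <= t <= 1 -> B (h + p) /\
    `|Q (contract t (h + p)) - Q (contract t p) -
      (t * h.1 * d1 Q (contract t p) + h.2 * d2 Q (contract t p))| <= e * `|h|.
have cK := @segment_compact R 0 1.
suff H : \forall h \near (0 : plane), ([set` `[0%R, 1%R]] : set R) `<=` P h.
  by apply: filterS H => h H t t01; apply: H => //=; rewrite in_itv.
apply: (proj1 (compact_near_coveringP _) cK _ (nbhs (0 : plane)) P _) => t0; rewrite /= in_itv /= => t01.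
set z0 := contract t0 p.
have Bz0 : B z0 by exact: contract_ball.
have e2 : 0 < e / 2 by rewrite divr_gt0.
have e4 : 0 < e / 4 by rewrite divr_gt0.
have [r1 r1_gt0 [r1B sd]] := strict_derivative framed_plane oB Bz0 sQ e2.
have := smooth_continuous (smooth_derive dir1 sQ) Bz0.
move=> /cvgrPdist_lt/(_ _ e4)/nbhs_ballP[r2 /= r2_gt0 c1].
have := smooth_continuous (smooth_derive dir2 sQ) Bz0.
move=> /cvgrPdist_lt/(_ _ e4)/nbhs_ballP[r3 /= r3_gt0 c2].
pose r' := Num.min r1 (Num.min r2 r3).
have r'0 : 0 < r' by rewrite !lt_min r1_gt0 r2_gt0.
have r'2 : 0 < r' / 2 by rewrite divr_gt0.
have sub1 : ball z0 r' `<=` ball z0 r1 by apply: le_ball; rewrite ge_min lexx.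
have sub2 : ball z0 r' `<=` ball z0 r2 by apply: le_ball; rewrite !ge_min lexx orbT.
have sub3 : ball z0 r' `<=` ball z0 r3 by apply: le_ball; rewrite !ge_min lexx !orbT.
have nt : \forall t \near t0, `|z0 - contract t p| < r' / 2.
  by have /cvgrPdist_lt := @contract_continuous p t0; apply.
have nh : \forall h \near (0 : plane), B (h + p) /\ `|h| < r' / 2.
  apply: filterI => //; apply/nbhs_ballP; exists (r' / 2) => //= h.
  by rewrite -ball_normE /= sub0r normrN.
exists ([set t | `|z0 - contract t p| < r' / 2],
        [set h | B (h + p) /\ `|h| < r' / 2]); first by split.
move=> [t h] /= [zt [Bhp hr]] {}t01; split=> //.
have zx : ball z0 r' (contract t p).
  by rewrite -ball_normE /=; apply: lt_le_trans zt _; rewrite ltW// ltr_pdivrMr// ltr_pMr// ltr1n.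
have hc := contract_norm h t01.
have zy : ball z0 r' (contract t (h + p)).
  rewrite -ball_normE /= contractD opprD addrCA; apply: le_lt_trans (ler_normD _ _) _.
  rewrite normrN [ltRHS](splitr r') ltrD//.
  exact: le_lt_trans hc hr.
have := sd _ _ (sub1 _ zx) (sub1 _ zy).
rewrite contractD addrK -contractD => H1.
have dz0 : differentiable Q z0 := smooth_differentiable sQ Bz0.
rewrite derive_plane// in H1.
have C1 := c1 _ (sub2 _ zx); have C2 := c2 _ (sub3 _ zx).
have /andP[h1 h2] : (`|(contract t h).1| <= `|h|) && (`|(contract t h).2| <= `|h|).
  by rewrite -plane_norm_le.
have -> : Q (contract t (h + p)) - Q (contract t p) -
      (t * h.1 * d1 Q (contract t p) + h.2 * d2 Q (contract t p)) =
   (Q (contract t (h + p)) - Q (contract t p) -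
      ((contract t h).1 *: d1 Q z0 + (contract t h).2 *: d2 Q z0)) +
   ((contract t h).1 * (d1 Q z0 - d1 Q (contract t p)) +
    (contract t h).2 * (d2 Q z0 - d2 Q (contract t p))).
  by rewrite /= /GRing.scale /=; ring.
have M1 : `|(contract t h).1 * (d1 Q z0 - d1 Q (contract t p))| <= `|h| * (e / 4).
  by rewrite normrM; exact: ler_pM (normr_ge0 _) (normr_ge0 _) h1 (ltW C1).
have M2 : `|(contract t h).2 * (d2 Q z0 - d2 Q (contract t p))| <= `|h| * (e / 4).
  by rewrite normrM; exact: ler_pM (normr_ge0 _) (normr_ge0 _) h2 (ltW C2).
have H2 : `|Q (contract t (h + p)) - Q (contract t p) -
      ((contract t h).1 *: d1 Q z0 + (contract t h).2 *: d2 Q z0)| <= e / 2 * `|h|.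
  by apply: le_trans H1 _; rewrite ler_wpM2l// ltW.
apply: le_trans (ler_normD _ _) _; apply: le_trans (lerD H2 (ler_normD _ _)) _.
apply: le_trans (lerD (lexx _) (lerD M1 M2)) _.
exact: halves.
Qed.

Lemma cont01_bounded f : cont01 f -> exists2 M : R, 0 < M & forall t, 0 <= t <= 1 -> `|f t| <= M.
Proof.
move=> cf; have [|t t01 H] := @EVT_max R (fun t => `|f t|) 0 1 ler01.
  apply: continuous_in_subspaceT => t; rewrite inE /= in_itv /= => t01.
  by apply: continuous_comp; [exact: cf|exact: norm_continuous].
exists (`|f t| + 1); first by rewrite ltr_wpDl.
by move=> u u01; apply: le_trans (H u _) _; rewrite ?in_itv// lerDl.
Qed.

Lemma wavg_derive w Q p : continuous w -> smooth_on B Q -> B p ->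
  differentiable (wavg w Q) p /\
  forall v, 'D_v (wavg w Q) p =
    v.1 * wavg (fun t => w t * t) (d1 Q) p + v.2 * wavg w (d2 Q) p.
Proof.
move=> cw sQ Bp.
have cw' : continuous (fun t => w t * t) by move=> t; apply: cvgM => //; exact: cw.
have s1 := smooth_derive dir1 sQ; have s2 := smooth_derive dir2 sQ.
set L := fun v : plane => v.1 * wavg (fun t => w t * t) (d1 Q) p + v.2 * wavg w (d2 Q) p.
have linL : linear L.
  move=> a u v; rewrite /L; move: (wavg _ (d1 Q) p) (wavg w (d2 Q) p) => I1 I2.
  by rewrite /= /GRing.scale /=; ring.
have cL : continuous L.
  by move=> v; apply: cvgD; apply: cvgM; [exact: cvg_fst|exact: cvg_cst|exact: cvg_snd|exact: cvg_cst].
have [M M0 wM] := @cont01_bounded w (fun t _ => cw t).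
apply: differential_intro => // e e0.
have e'0 : 0 < e / M by rewrite divr_gt0.
have ex := contract_expansion sQ Bp e'0; near=> h.
have H : forall t, 0 <= t <= 1 ->  B (h + p) /\
    `|Q (contract t (h + p)) - Q (contract t p) -
      (t * h.1 * d1 Q (contract t p) + h.2 * d2 Q (contract t p))| <= e / M * `|h|.
  by near: h.
have Bhp : B (h + p) by apply: (H 0 _).1; rewrite lexx ler01.
pose f0 t := w t * Q (contract t (h + p)); pose f1 t := w t * Q (contract t p).
pose f2 t := w t * t * d1 Q (contract t p); pose f3 t := w t * d2 Q (contract t p).
have c0 : cont01 f0 := wavg_cont01 cw sQ Bhp.
have c1 : cont01 f1 := wavg_cont01 cw sQ Bp.
have c2 : cont01 f2 := wavg_cont01 cw' s1 Bp.
have c3 : cont01 f3 := wavg_cont01 cw s2 Bp.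
have cZ := cont01D (cont01Z (c := h.1) c2) (cont01Z (c := h.2) c3).
have cY := cont01B c0 c1.
have -> : wavg w Q (h + p) - wavg w Q p - L h =
    avg (fun t => (f0 t - f1 t) - (h.1 * f2 t + h.2 * f3 t)).
  rewrite (avgB cY cZ) (avgB c0 c1) (avgD (cont01Z (c := h.1) c2) (cont01Z (c := h.2) c3)).
  by rewrite (avgZ h.1 c2) (avgZ h.2 c3).
apply: avg_bound; first exact: cont01B.
move=> t t01; have [_ Ht] := H t t01.
have -> : forall a b c d : R, w t * a - w t * b - (h.1 * (w t * t * c) + h.2 * (w t * d)) =
  w t * (a - b - (t * h.1 * c + h.2 * d)) by move=> *; ring.
rewrite normrM; apply: le_trans (ler_pM _ _ (wM t t01) Ht) _ => //.
by rewrite mulrA [M * _]mulrC divfK// gt_eqF.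
Unshelve. all: by end_near. Qed.

Lemma wavg_smooth w Q : continuous w -> smooth_on B Q -> smooth_on B (wavg w Q).
Proof.
move=> cw sQ n; elim: n w Q cw sQ => [|n IH] w Q cw sQ.
  by move=> p /(wavg_derive cw sQ)[/differentiable_continuous].
split=> [p /(wavg_derive cw sQ)[]//|v].
have oB : open B by exact: ball_open.
apply: (Ck_eq (f := fun p =>
    v.1 * wavg (fun t => w t * t) (d1 Q) p + v.2 * wavg w (d2 Q) p)) => //.
  by move=> p /(wavg_derive cw sQ)[_ ->].
apply: CkD => //; (apply: CkM => //; first exact: Ck_cst).
  apply: IH; last exact: smooth_derive.
  by move=> t; apply: cvgM => //; exact: cw.
by apply: IH => //; exact: smooth_derive.
Qed.

Lemma is_derive_contract Q t p : differentiable Q (contract t p) ->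
  is_derive t 1 (fun s => Q (contract s p)) (p.1 * d1 Q (contract t p)).
Proof.
move=> dQ.
have d_t : is_diff t (fun s : R => s * p.1) (fun s => s * p.1).
  have -> : (fun s : R => s * p.1) = (fun s : R => s *: p.1) by [].
  by apply: is_diff_eq.
have dc : is_diff t (contract^~ p) (fun s => (s * p.1, 0)).
  exact: (is_diff_pair d_t (is_diff_cst p.2 t)).
have dct : differentiable (contract^~ p) t by [].
apply: DeriveDef.
  by apply: diff_derivable; exact: (differentiable_comp dct dQ).
rewrite (derive_comp (1 : R) dct dQ) derive_plane// [X in X.1 *: _]deriveE// [X in _ + X.2 *: _]deriveE//.
by rewrite diff_val /= mul1r scale0r addr0.
Qed.

(** The remainder of the expansion in the first variable is [p.1 ^+ 2] times the
    average of [d1 (d1 F)] with weight [1 - t], and such averages are smooth in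
    both variables. *)
Lemma smooth_taylor2 F : smooth_on B F -> exists E, [/\ smooth_on B E,
  (forall p, B p -> F p = F (0, p.2) + p.1 * d1 F (0, p.2) + p.1 ^+ 2 * E p) &
  (forall p, B p -> E (0, p.2) = d1 (d1 F) (0, p.2) / 2)].
Proof.
move=> sF; have s1 := smooth_derive dir1 sF.
have s11 := smooth_derive dir1 s1.
pose w (t : R) := 1 - t.
have cw : continuous w by move=> t; apply: cvgB; [exact: cvg_cst|exact: cvg_id].
have c00 q : contract 0 q = (0, q.2) by rewrite /contract mul0r.
exists (wavg w (d1 (d1 F))); split; first exact: wavg_smooth.
  move=> p Bp.
  (* A primitive of the remainder, found by integration by parts. *)
  pose G t := w t * p.1 * d1 F (contract t p) + F (contract t p).
  have cE := wavg_cont01 cw s11 Bp.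
  have cE2 : cont01 (fun t => p.1 ^+ 2 * (w t * d1 (d1 F) (contract t p))).
    by move=> t t01; apply: cvgM; [exact: cvg_cst|exact: cE].
  have dG (t : R) : 0 <= t <= 1 -> is_derive t 1 G (p.1 ^+ 2 * (w t * d1 (d1 F) (contract t p))).
    move=> t01; have Bt := contract_ball t01 Bp.
    have dg1 := is_derive_contract (smooth_differentiable s1 Bt).
    have dg2 := is_derive_contract (smooth_differentiable sF Bt).
    have dw : is_derive t 1 (fun s => w s * p.1) (- p.1).
      by apply: is_derive_eq; rewrite /GRing.scale /=; ring.
    by apply: is_derive_eq; rewrite /w /GRing.scale /=; ring.
  rewrite /wavg -avgZ// (avg_FTC cE2 dG) /G /w subrr mul0r mul0r add0r subr0 mul1r.
  by rewrite c00 /contract mul1r -surjective_pairing; ring.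
move=> p Bp.
have e t : w t * d1 (d1 F) (contract t (0, p.2)) = d1 (d1 F) (0, p.2) * w t.
  by rewrite /contract mulr0 mulrC.
rewrite /wavg (eq_avg (g := fun t => d1 (d1 F) (0, p.2) * w t)); last by move=> t _; exact: e.
rewrite avgZ; last by move=> t _; exact: cw.
congr (_ * _).
have -> : avg w = (1 - 1 ^+ 2 * 2^-1) - (0 - 0 ^+ 2 * 2^-1).
  apply: (@avg_FTC _ w (fun t => t - t ^+ 2 * 2^-1)) => [t _|t _]; first exact: cw.
  by apply: is_derive_eq; rewrite /w /GRing.scale /=; field.
by rewrite expr1n expr0n mul0r !subr0 mul1r; field.
Qed.
End ParameterAverage.

(** * Symmetry of second derivatives and polar angles *)

Section Schwarz.
Context {R : realType}.
Variables (V : normedModType R) (frV : framed V).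

Lemma deriveZv (F : V -> R) p v (a : R) : differentiable F p -> 'D_(a *: v) F p = a * 'D_v F p.
Proof. by move=> dF; rewrite !deriveE// linearZ. Qed.

(** The mean value theorem for [x |-> F (x + s *: v) - F x] leaves an increment of
    ['D_u F], which strict differentiability compares with ['D_v ('D_u F) p]. *)
Lemma second_difference (U : set V) (F : V -> R) (p u v : V) (e : R) : open U -> U p ->
  smooth_on U F -> 0 < e ->
  exists2 d : R, 0 < d & forall s : R, 0 < s < d ->
    `|F (p + s *: u + s *: v) - F (p + s *: u) - (F (p + s *: v) - F p)
      - s * (s * 'D_v ('D_u F) p)| <= e * (s * s).
Proof.
move=> oU Up sF e0.
have e'0 : 0 < e / (`|v| + 1) by rewrite divr_gt0// ltr_wpDl.
have su := smooth_derive u sF.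
have [r r0 [rU sd]] := strict_derivative frV oU Up su e'0.
have uv0 : 0 < `|u| + `|v| + 1 by rewrite ltr_wpDl// addr_ge0.
exists (r / (`|u| + `|v| + 1)); first by rewrite divr_gt0.
move=> s /andP[s0 sd'].
have sr : s * (`|u| + `|v| + 1) < r by rewrite -ltr_pdivlMr.
have inB (t t' : R) : 0 <= t <= s -> 0 <= t' <= s -> ball p r (p + t *: u + t' *: v).
  move=> /andP[t0 ts] /andP[t'0 t's].
  rewrite -ball_normE /= -addrA opprD addrA subrr add0r normrN.
  apply: le_lt_trans (ler_normD _ _) _; rewrite !normrZ !ger0_norm//.
  apply: le_lt_trans sr; rewrite !mulrDr mulr1.
  have h1 : t * `|u| <= s * `|u| by rewrite ler_wpM2r.
  have h2 : t' * `|v| <= s * `|v| by rewrite ler_wpM2r.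
  by rewrite -[leLHS]addr0 lerD ?lerD// ltW.
have s00 : 0 <= (0 : R) <= s by rewrite lexx ltW.
have ss : 0 <= s <= s by rewrite lexx ltW.
pose phi x := F (x + s *: v) - F x.
have dF x : ball p r x -> differentiable F x.
  by move=> /rU; exact: smooth_differentiable.
have dsh (x : V) : is_diff x (fun y : V => y + s *: v) id.
  by apply: is_diff_eq; apply/funext => y /=; rewrite addr0.
have dphi (t : R) : 0 <= t <= s -> differentiable phi (p + t *: u) /\
   'D_u phi (p + t *: u) = 'D_u F (p + t *: u + s *: v) - 'D_u F (p + t *: u).
  move=> ts; have d1 : differentiable F (p + t *: u).
    by apply: dF; have := inB t 0 ts s00; rewrite scale0r addr0.
  have d2 : differentiable F (p + t *: u + s *: v) by apply: dF; exact: inB.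
  have ds : differentiable (fun y : V => y + s *: v) (p + t *: u) by [].
  have d3 : differentiable (F \o (fun y : V => y + s *: v)) (p + t *: u).
    exact: differentiable_comp.
  split; first exact: differentiableB.
  rewrite (@deriveB _ _ _ (F \o (fun y : V => y + s *: v)) F); [|exact: diff_derivable|exact: diff_derivable].
  by rewrite derive_comp// [X in 'D_X _ _]deriveE// diff_val.
have E : p + s *: u - p = s *: u by rewrite addrAC subrr add0r.
have [t t01|t t01] := @mean_value R V phi p (p + s *: u).
  rewrite E scalerA; apply: (dphi _ _).1.
  by case/andP: t01 => t0 t1; rewrite mulr_ge0 ?(ltW s0)//= ler_piMl// ltW.
have ts : 0 <= t * s <= s.
  by case/andP: t01 => t0 t1; rewrite mulr_ge0 ?(ltW s0)//= ler_piMl// ltW.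
rewrite E scalerA; have [dp Dp] := dphi _ ts.
rewrite deriveZv// Dp /phi => ->.
rewrite -mulrBr normrM (gtr0_norm s0) mulrCA ler_pM2l//.
have b1 := inB _ _ ts s00; rewrite scale0r addr0 in b1.
have := sd _ _ b1 (inB _ _ ts ss).
have E' x : x + s *: v - x = s *: v by rewrite addrAC subrr add0r.
rewrite E' deriveZv; last exact: smooth_differentiable su Up.
move/le_trans; apply.
rewrite normrZ (gtr0_norm s0) mulrCA [leRHS]mulrC ler_pM2l//.
rewrite mulrAC ler_pdivrMr ?ltr_wpDl// ler_wpM2l ?(ltW e0)//.
by rewrite lerDl.
Qed.

(** The second difference along [u] and [v] is symmetric and approximates both
    iterated derivatives. *)
Lemma derive_comm (U : set V) (F : V -> R) (p u v : V) : open U -> U p ->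
  smooth_on U F -> 'D_u ('D_v F) p = 'D_v ('D_u F) p.
Proof.
have half (x : R) : 0 < x -> x <= x / 4 + x / 4 -> False by move=> ? ?; lra.
move=> oU Up sF; set a := 'D_u _ _; set b := 'D_v _ _.
apply/eqP; rewrite -subr_eq0 -normr_le0 leNgt; apply/negP => ab.
have e0 : 0 < `|a - b| / 4 by rewrite divr_gt0.
have [d1 d10 H1] := second_difference u v oU Up sF e0.
have [d2 d20 H2] := second_difference v u oU Up sF e0.
have m0 : 0 < Num.min d1 d2 by rewrite lt_min d10.
have [s [s0 s1 s2]] : exists s, [/\ 0 < s, s < d1 & s < d2].
  exists (Num.min d1 d2 / 2); rewrite divr_gt0//.
  have : Num.min d1 d2 / 2 < Num.min d1 d2 by rewrite ltr_pdivrMr// ltr_pMr// ltr1n.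
  by rewrite lt_min => /andP[].
have := H1 s; rewrite s0 s1 => /(_ isT); have := H2 s; rewrite s0 s2 => /(_ isT).
rewrite -/a -/b [p + s *: v + s *: u]addrAC.
move: (F (p + s *: u + s *: v)) (F (p + s *: u)) (F (p + s *: v)) (F p) => A B C D h1 h2.
have : `|s * (s * a) - s * (s * b)| <= `|a - b| / 4 * (s * s) + `|a - b| / 4 * (s * s).
  apply: le_trans (lerD h2 h1); rewrite [X in _ <= _ + X]distrC.
  apply: le_trans (ler_normD _ _); rewrite [leRHS](_ : _ = `|s * (s * a) - s * (s * b)|)//.
  by congr `|_|; ring.
rewrite -!mulrBr !normrM (gtr0_norm s0) mulrA.
have ss0 : 0 < s * s by rewrite mulr_gt0.
rewrite -mulrDl [leRHS]mulrC ler_pM2l// => h.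
exact: half ab h.
Qed.

End Schwarz.

Section Angles.
Context {R : realType}.
Local Notation plane := (R * R)%type.

Lemma unit_angle (x y : R) : x ^+ 2 + y ^+ 2 = 1 ->
  exists2 t : R, `|t| <= pi & (x = cos t) /\ (y = sin t).
Proof.
move=> xy; have x1 : -1 <= x <= 1.
  by have y2 := sqr_ge0 y; apply/andP; split; nra.
have s0 := acos_ge0 x1; have sp := acos_lepi x1.
have sq : Num.sqrt (1 - x ^+ 2) = `|y|.
  by rewrite -xy addrAC subrr add0r sqrtr_sqr.
have [y0|y0] := leP 0 y.
  exists (acos x); first by rewrite ger0_norm.
  by rewrite acosK ?in_itv//= sin_acos// sq ger0_norm.
exists (- acos x); first by rewrite normrN ger0_norm.
by rewrite cosN sinN acosK ?in_itv//= sin_acos// sq ltr0_norm// opprK.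
Qed.

Lemma polar_exists (u v : R) : (u, v) != 0 :> plane ->
  exists r t : R, [/\ 0 < r, `|t| <= pi & (u, v) = polar r t].
Proof.
move=> uv; pose n := Num.sqrt (u ^+ 2 + v ^+ 2).
have n0 : 0 < n.
  rewrite sqrtr_gt0 lt0r addr_ge0 ?sqr_ge0// andbT paddr_eq0 ?sqr_ge0//.
  rewrite !sqrf_eq0; apply: contra uv => /andP[/eqP-> /eqP->].
  by [].
have n2 : n ^+ 2 = u ^+ 2 + v ^+ 2 by rewrite sqr_sqrtr// addr_ge0 ?sqr_ge0.
have [|t tpi [ct st]] := @unit_angle (u / n) (v / n).
  by rewrite !expr_div_n -mulrDl n2 divff// -n2 expf_neq0// gt_eqF.
exists n, t; split=> //.
by rewrite /polar -ct -st ![n * _]mulrC !divfK// gt_eqF.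
Qed.

Lemma polar_norm (r t : R) : 0 <= r -> `|polar r t| <= r.
Proof.
move=> r0; rewrite plane_norm_le /= !normrM (ger0_norm r0) !ler_piMr//.
  exact: sin_max.
exact: cos_max.
Qed.

Lemma polar_neq0 (t : R) : polar 1 t != 0.
Proof.
rewrite xpair_eqE /= !mul1r; apply/negP => /andP[/eqP c0 /eqP s0].
by have := cos2Dsin2 t; rewrite c0 s0 expr0n /= addr0 => /eqP; rewrite eq_sym oner_eq0.
Qed.

End Angles.

(** * Coordinates adapted to a fold *)

Section DerivativeRules.
Context {R : realType}.
Local Notation plane := (R * R)%type.
Local Notation d1 f := ('D_dir1 f).
Local Notation d2 f := ('D_dir2 f).

Lemma derive_mul (V : normedModType R) (f g : V -> R) p v :
  differentiable f p -> differentiable g p ->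
  'D_v (fun q => f q * g q) p = 'D_v f p * g p + f p * 'D_v g p.
Proof.
move=> df dg; rewrite [LHS]deriveM; [|exact: diff_derivable|exact: diff_derivable].
by rewrite addrC /GRing.scale /= mulrC.
Qed.

Lemma derive_sub (V : normedModType R) (f g : V -> R) p v :
  differentiable f p -> differentiable g p ->
  'D_v (fun q => f q - g q) p = 'D_v f p - 'D_v g p.
Proof. by move=> df dg; rewrite [LHS]deriveB//; exact: diff_derivable. Qed.

Lemma derive_add (V : normedModType R) (f g : V -> R) p v :
  differentiable f p -> differentiable g p ->
  'D_v (fun q => f q + g q) p = 'D_v f p + 'D_v g p.
Proof. by move=> df dg; rewrite [LHS]deriveD//; exact: diff_derivable. Qed.

Lemma derive_chain (V : normedModType R) (g : V -> plane) (F : plane -> R) q v :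
  differentiable g q -> differentiable F (g q) ->
  'D_v (fun q => F (g q)) q = ('D_v g q).1 * d1 F (g q) + ('D_v g q).2 * d2 F (g q).
Proof. by move=> dg dF; rewrite [LHS](derive_comp v dg dF) derive_plane. Qed.

Lemma smooth_plane_fst (U : set plane) : open U -> smooth_on U (fun q : plane => q.1).
Proof. by move=> oU; exact: smooth_fst oU (smooth_id U). Qed.

Lemma smooth_plane_snd (U : set plane) : open U -> smooth_on U (fun q : plane => q.2).
Proof. by move=> oU; exact: smooth_snd oU (smooth_id U). Qed.

Lemma derive_plane_fst p v : 'D_v (fun q : plane => q.1) p = v.1.
Proof. by rewrite derive_fst// derive_id. Qed.

Lemma derive_plane_snd p v : 'D_v (fun q : plane => q.2) p = v.2.
Proof. by rewrite derive_snd// derive_id. Qed.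

Lemma plane_ball0 (r : R) (q : plane) : ball (0 : plane) r q <-> `|q.1| < r /\ `|q.2| < r.
Proof.
rewrite -ball_normE /= sub0r normrN prod_normE /= gt_max.
by split=> [/andP[]|[-> ->]].
Qed.

Lemma ball0_axis1 (r : R) (q : plane) : ball (0 : plane) r q -> ball (0 : plane) r (0, q.1).
Proof.
move=> /plane_ball0[h1 _]; apply/plane_ball0; split=> //=.
by rewrite normr0; exact: le_lt_trans h1.
Qed.

Lemma ball0_axis2 (r : R) (q : plane) : ball (0 : plane) r q -> ball (0 : plane) r (0, q.2).
Proof.
move=> /plane_ball0[_ h2]; apply/plane_ball0; split=> //=.
by rewrite normr0; exact: le_lt_trans h2.
Qed.

Lemma ball0_swap_axis2 (r : R) (q : plane) : ball (0 : plane) r q -> ball (0 : plane) r (q.2, 0).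
Proof.
move=> /plane_ball0[_ h2]; apply/plane_ball0; split=> //=.
by rewrite normr0; exact: le_lt_trans h2.
Qed.

Lemma local_diffeo_smooth (g : plane -> plane) p : local_diffeo g p ->
  exists U, [/\ open U, U p & smooth_on U g].
Proof. by move=> [U [_ [_ [[oU Up _] [sg _ _ _]]]]]; exists U. Qed.

Lemma diff_mul (V : normedModType R) (f g : V -> R) p :
  differentiable f p -> differentiable g p -> differentiable (fun q => f q * g q) p.
Proof. by move=> df dg; exact: differentiableM. Qed.

End DerivativeRules.

Lemma dir1_1 {R : realType} : (dir1 : R * R).1 = 1. Proof. by []. Qed.
Lemma dir1_2 {R : realType} : (dir1 : R * R).2 = 0. Proof. by []. Qed.
Lemma dir2_1 {R : realType} : (dir2 : R * R).1 = 0. Proof. by []. Qed.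
Lemma dir2_2 {R : realType} : (dir2 : R * R).2 = 1. Proof. by []. Qed.

Section ChartAlgebra.
Variable K : fieldType.
Implicit Types (A b c : K).

(** In these computations [X] and [Y] are the components of a partial derivative of
    the inverse chart [g], and the hypotheses are the chain rule for [F \o g],
    [G \o g] and [crit \o g]. Here the linear system eliminates [Y], and leaves
    the derivative of [F \o g] as [crit] times [X / g2]. *)
Lemma chart_elimination (l X Y f1 f2 g1 g2 q1 : K) : g2 != 0 -> f1 * g2 - f2 * g1 = q1 ->
  X * g1 + Y * g2 = 0 -> l = X * f1 + Y * f2 -> l = q1 * (X / g2).
Proof.
move=> g20 <- /eqP; rewrite addrC addr_eq0 => /eqP H ->.
have -> : Y = - (X * g1) / g2 by apply: (mulIf g20); rewrite divfK.
by field.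
Qed.

Lemma chart_slope1 (X Y a c' g1 g2 A b : K) : A != 0 -> b != 0 ->
  a = A * b -> g1 = 0 -> g2 = b ->
  X * a + Y * c' = 1 -> X * g1 + Y * g2 = 0 -> X = (A * b)^-1.
Proof.
move=> A0 b0 -> -> -> h1 /eqP; rewrite mulr0 add0r mulf_eq0 (negPf b0) orbF => /eqP h2.
move: h1; rewrite h2 mul0r addr0 => h1.
have Ab0 : A * b != 0 by rewrite mulf_neq0.
by apply: (mulIf Ab0); rewrite h1 mulVf.
Qed.

Lemma chart_slope2 (X Y a c' g1 g2 A b c : K) : A != 0 -> b != 0 ->
  a = A * b -> c' = c * b -> g1 = 0 -> g2 = b ->
  X * a + Y * c' = 0 -> X * g1 + Y * g2 = 1 -> X = - c / (A * b) /\ Y = b^-1.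
Proof.
move=> A0 b0 -> -> -> -> h1; rewrite mulr0 add0r => h2.
have Ye : Y = b^-1 by apply: (mulIf b0); rewrite h2 mulVf.
split=> //; have Ab0 : A * b != 0 by rewrite mulf_neq0.
apply: (mulIf Ab0); rewrite divfK//.
have e : b^-1 * (c * b) = c by rewrite mulrCA mulVf// mulr1.
by move/eqP: h1; rewrite addr_eq0 Ye e => /eqP ->.
Qed.

Lemma chart_second1 (l z s s' X g2 A b : K) : l = 1 * s + z * s' -> z = 0 -> s = X / g2 ->
  X = (A * b)^-1 -> g2 = b -> l = (A * b ^+ 2)^-1.
Proof. by move=> -> -> -> -> ->; rewrite mul0r addr0 mul1r -invfM -mulrA. Qed.

Lemma chart_second2 (l l1 l2 m n m' n' f1 f2 f1' f2' x11 x12 x21 x22 A b c : K) :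
  A != 0 -> b != 0 ->
  l = l1 + l2 -> l1 = m' * f1 + m * f1' -> l2 = n' * f2 + n * f2' ->
  f1' = m * x11 + n * x12 -> f2' = m * x21 + n * x22 ->
  f1 = 0 -> f2 = 0 -> m = - c / (A * b) -> n = b^-1 ->
  x11 = A -> x12 = c -> x21 = c -> x22 = - A -> l = - (A ^+ 2 + c ^+ 2) / (A * b ^+ 2).
Proof.
move=> A0 b0 -> -> -> -> -> -> -> -> -> -> -> -> ->.
by field; rewrite A0 b0.
Qed.

End ChartAlgebra.

Lemma chart_pos1 (K : realFieldType) (A b : K) : 0 < A -> b != 0 -> 0 < (A * b ^+ 2)^-1 / 2.
Proof. by move=> A0 b0; rewrite divr_gt0// invr_gt0 mulr_gt0// exprn_even_gt0. Qed.

Lemma chart_pos2 (K : realFieldType) (A b c : K) : 0 < A -> b != 0 ->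
  0 < - (- (A ^+ 2 + c ^+ 2) / (A * b ^+ 2) / 2).
Proof.
move=> A0 b0; rewrite -mulNr -mulNr opprK divr_gt0// divr_gt0//.
  by rewrite ltr_wpDr ?sqr_ge0// exprn_gt0.
by rewrite mulr_gt0// exprn_even_gt0.
Qed.

Section FoldCoordinates.
Context {R : realType}.
Local Notation plane := (R * R)%type.
Local Notation d1 f := ('D_dir1 f).
Local Notation d2 f := ('D_dir2 f).
(* Keeps conversion from unfolding the limits behind derivatives. *)
#[local] Opaque derive dir1 dir2.
Variables (U : set plane) (F G : plane -> R) (A b : R).
Hypotheses (oU : open U) (U0 : U 0) (sF : smooth_on U F) (sG : smooth_on U G).
Hypotheses (F0 : F 0 = 0) (G0 : G 0 = 0) (F1 : d1 F 0 = 0) (F2 : d2 F 0 = 0).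
Hypotheses (G1 : d1 G 0 = 0) (G2 : d2 G 0 = b) (b0 : b != 0).
Hypotheses (F11 : d1 (d1 F) 0 = A) (F22 : d2 (d2 F) 0 = - A) (A0 : 0 < A).

Let A_neq0 : A != 0. Proof. exact: lt0r_neq0. Qed.
Let c := d2 (d1 F) 0.
Let F21 : d1 (d2 F) 0 = c.
Proof. exact: (derive_comm framed_plane _ _ oU). Qed.

Let crit q := d1 F q * d2 G q - d2 F q * d1 G q.

Let s1F := smooth_derive dir1 sF.
Let s2F := smooth_derive dir2 sF.
Let s1G := smooth_derive dir1 sG.
Let s2G := smooth_derive dir2 sG.

Let crit_smooth : smooth_on U crit.
Proof. exact (smoothB oU (smoothM oU s1F s2G) (smoothM oU s2F s1G)). Qed.

Let crit_derive v : 'D_v crit 0 = 'D_v (d1 F) 0 * b.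
Proof.
have e1 := smooth_differentiable s1F U0; have e2 := smooth_differentiable s2F U0.
have e3 := smooth_differentiable s1G U0; have e4 := smooth_differentiable s2G U0.
have alg (l l1 l2 x y z w f1 f2 g1 g2 : R) : l = l1 - l2 -> l1 = x * g2 + f1 * y ->
    l2 = z * g1 + f2 * w -> f1 = 0 -> f2 = 0 -> g1 = 0 -> g2 = b -> l = x * b.
  by move=> -> -> -> -> -> -> ->; ring.
exact: (alg _ _ _ _ _ _ _ _ _ _ _ (derive_sub v (diff_mul e1 e4) (diff_mul e2 e3))
  (derive_mul v e1 e4) (derive_mul v e2 e3) F1 F2 G1 G2).
Qed.

Let kappa q : plane := (crit q, G q).

Let kappa_smooth : smooth_on U kappa.
Proof. exact (smooth_pair oU crit_smooth sG). Qed.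

Let kappa0 : kappa 0 = 0.
Proof.
have alg (x y z w : R) : x = 0 -> z = 0 -> x * y - z * w = 0 by move=> -> ->; ring.
by apply: injective_projections; [exact: alg F1 F2|exact: G0].
Qed.

Let kappa_derive v : ('D_v kappa 0).1 = 'D_v (d1 F) 0 * b /\ ('D_v kappa 0).2 = 'D_v G 0.
Proof.
have dk := smooth_differentiable kappa_smooth U0.
split; first exact: etrans (esym (derive_fst v dk)) (crit_derive v).
exact: esym (derive_snd v dk).
Qed.

Let kappa_jacobian : jacobian kappa 0 != 0.
Proof.
have [k11 k12] := kappa_derive dir1; have [k21 k22] := kappa_derive dir2.
have alg (x y z w : R) : x = A * b -> y = b -> w = 0 -> x * y - z * w = A * b * b.
  by move=> -> -> ->; ring.
have -> : jacobian kappa 0 = A * b * b.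
  exact: alg (etrans k11 (congr1 ( *%R^~ b) F11)) (etrans k22 G2) (etrans k12 G1).
exact: mulf_neq0 (mulf_neq0 (lt0r_neq0 A0) b0) b0.
Qed.

(** Along the kernel of the derivative, [crit] has the derivative [A * b != 0] and
    [G] has the derivative zero, so [crit] and [G] form a chart of the source. *)
Lemma fold_chart : exists (g : plane -> plane) (r : R),
  [/\ local_diffeo g (0 : plane), g 0 = 0, 0 < r, smooth_on (ball (0 : plane) r) g &
   forall q, ball (0 : plane) r q -> [/\ U (g q), d2 G (g q) != 0, crit (g q) = q.1 & G (g q) = q.2]].
Proof.
have /local_diffeo_inv[g [dg g0 _ kg]] := inverse_function oU U0 kappa_smooth kappa_jacobian.
rewrite kappa0 in dg g0 kg.
have [U1 [oU1 U10 sg]] := local_diffeo_smooth dg.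
have oW : open (U `&` d2 G @^-1` [set x | x != 0]).
  by apply: open_preimage_on => //; exact: open_neq.
have oU1W := open_preimage_on oU1 oW sg.
have G20 : d2 G 0 != 0 by rewrite G2.
have U1W0 : (U1 `&` g @^-1` (U `&` d2 G @^-1` [set x | x != 0])) 0.
  split; first exact: U10.
  change ((U `&` d2 G @^-1` [set x | x != 0]) (g 0)); rewrite g0.
  split; first exact: U0.
  exact: G20.
have /nbhs_ballP[r /= r0 rB] : \forall q \near (0 : plane),
    (U1 q /\ U (g q) /\ d2 G (g q) != 0) /\ kappa (g q) = q.
  by apply: filterI kg; apply: (open_nbhs_nbhs (conj oU1W U1W0)).
exists g, r; split; [exact: dg|exact: g0|exact: r0| |].
  by apply: smooth_sub sg => q /rB[[]].
move=> q /rB[[U1q [Ugq G2q]] kq]; split; [exact: Ugq|exact: G2q| |].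
  exact: (congr1 (fun z : plane => z.1) kq).
exact: (congr1 (fun z : plane => z.2) kq).
Qed.

(** In the chart of [fold_chart] the derivative of [F] along the first
    coordinate is divisible by that coordinate. *)
Section InChart.
Variables (g : plane -> plane) (r : R).
Local Notation B := (ball (0 : plane) r).
Hypotheses (g0 : g 0 = 0) (r0 : 0 < r) (sg : smooth_on B g).
Hypothesis gP : forall q, B q ->
  [/\ U (g q), d2 G (g q) != 0, crit (g q) = q.1 & G (g q) = q.2].

Let oB : open B. Proof. exact: ball_open. Qed.
Let B0 : B 0. Proof. exact: ballxx. Qed.
Let BU q : B q -> U (g q). Proof. by case/gP. Qed.
Let Ft q := F (g q).
Let sFt : smooth_on B Ft. Proof. exact: (smooth_comp framed_plane oB BU sg sF). Qed.
Let dgq q : B q -> differentiable g q.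
Proof. by move=> Bq; exact: (smooth_differentiable sg Bq). Qed.

Let DFt q v : B q -> 'D_v Ft q = ('D_v g q).1 * d1 F (g q) + ('D_v g q).2 * d2 F (g q).
Proof.
by move=> Bq; exact: (derive_chain v (dgq Bq) (smooth_differentiable sF (BU Bq))).
Qed.

Let Dcrit q v : B q -> ('D_v g q).1 * d1 crit (g q) + ('D_v g q).2 * d2 crit (g q) = v.1.
Proof.
move=> Bq; apply: etrans (derive_plane_fst q v).
apply: etrans (esym (derive_chain v (dgq Bq) (smooth_differentiable crit_smooth (BU Bq)))) _.
by apply: (derive_eq_on _ oB Bq) => z /gP[].
Qed.

Let DG q v : B q -> ('D_v g q).1 * d1 G (g q) + ('D_v g q).2 * d2 G (g q) = v.2.
Proof.
move=> Bq; apply: etrans (derive_plane_snd q v).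
apply: etrans (esym (derive_chain v (dgq Bq) (smooth_differentiable sG (BU Bq)))) _.
by apply: (derive_eq_on _ oB Bq) => z /gP[].
Qed.

Let s1g := smooth_derive dir1 sg.
Let s2g := smooth_derive dir2 sg.
Let S q := (d1 g q).1 / d2 G (g q).
Let sS : smooth_on B S.
Proof.
apply: (smoothM oB (smooth_fst oB s1g)).
apply: (smoothV oB); first by move=> q /gP[].
exact: (smooth_comp framed_plane oB BU sg s2G).
Qed.

Let D1Ft q : B q -> d1 Ft q = q.1 * S q.
Proof.
move=> Bq; have [_ G2q cq _] := gP Bq.
exact: chart_elimination G2q cq (etrans (DG dir1 Bq) dir1_2) (DFt dir1 Bq).
Qed.

Let D1g0 : (d1 g 0).1 = (A * b)^-1.
Proof.
have := Dcrit dir1 B0; have := DG dir1 B0; rewrite g0 dir1_1 dir1_2 => h1 h2.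
exact: chart_slope1 A_neq0 b0 (etrans (crit_derive dir1) (congr1 ( *%R^~ b) F11)) G1 G2 h2 h1.
Qed.

Let D2g0 : (d2 g 0).1 = - c / (A * b) /\ (d2 g 0).2 = b^-1.
Proof.
have := Dcrit dir2 B0; have := DG dir2 B0; rewrite g0 dir2_1 dir2_2 => h1 h2.
exact: chart_slope2 A_neq0 b0 (etrans (crit_derive dir1) (congr1 ( *%R^~ b) F11)) (crit_derive dir2) G1 G2 h2 h1.
Qed.

Let D11Ft0 : d1 (d1 Ft) 0 = (A * b ^+ 2)^-1.
Proof.
have d1q := smooth_differentiable (smooth_plane_fst oB) B0.
have dS := smooth_differentiable sS B0.
have e := derive_mul dir1 d1q dS; rewrite derive_plane_fst dir1_1 in e.
apply: (chart_second1 (etrans _ e) _ (erefl (S 0))).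
- by apply: (derive_eq_on _ oB B0) => q; exact: D1Ft.
- by [].
- exact: D1g0.
- by rewrite g0.
Qed.

Let D22Ft0 : d2 (d2 Ft) 0 = - (A ^+ 2 + c ^+ 2) / (A * b ^+ 2).
Proof.
have a1 := smooth_differentiable (smooth_fst oB s2g) B0.
have a2 := smooth_differentiable (smooth_snd oB s2g) B0.
have a3 := smooth_differentiable (smooth_comp framed_plane oB BU sg s1F) B0.
have a4 := smooth_differentiable (smooth_comp framed_plane oB BU sg s2F) B0.
have e0 := derive_add dir2 (diff_mul a1 a3) (diff_mul a2 a4).
have e1 := derive_mul dir2 a1 a3; have e2 := derive_mul dir2 a2 a4.
have e3 := derive_chain dir2 (dgq B0) (smooth_differentiable s1F (BU B0)).
have e4 := derive_chain dir2 (dgq B0) (smooth_differentiable s2F (BU B0)).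
have [m0 n0] := D2g0.
rewrite g0 in e1 e2 e3 e4.
apply: (chart_second2 A_neq0 b0 (etrans _ e0) e1 e2 e3 e4 F1 F2 m0 n0 F11 erefl F21 F22).
by apply: (derive_eq_on _ oB B0) => q; exact: DFt.
Qed.

(** Exchanges the axes: the Taylor formula in the first variable then applies to
    the restriction of [Ft] to the second axis. *)
Let L (p : plane) : plane := (0, p.1).
Let Fy p := Ft (L p).

Let L_ball q : B q -> B (L q).
Proof. exact: ball0_axis1. Qed.

Let sL : smooth_on B L.
Proof. exact: (smooth_pair oB (smooth_cst B 0) (smooth_plane_fst oB)). Qed.

Let D1L (f : plane -> R) p : smooth_on B f -> B p -> d1 (fun p => f (L p)) p = d2 f (L p).
Proof.
move=> sf Bp; have dL := smooth_differentiable sL Bp.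
have := derive_chain dir1 dL (smooth_differentiable sf (L_ball Bp)).
have -> : (d1 L p).1 = 0 by rewrite -(derive_fst _ dL); exact: derive_cst.
have -> : (d1 L p).2 = 1 by rewrite -(derive_snd _ dL); exact: derive_plane_fst.
by move: (d1 f (L p)) (d2 f (L p)) => x y; rewrite mul0r mul1r add0r.
Qed.

Let D11Fy0 : d1 (d1 Fy) 0 = - (A ^+ 2 + c ^+ 2) / (A * b ^+ 2).
Proof.
apply: etrans D22Ft0; apply: etrans (D1L (smooth_derive dir2 sFt) B0).
by apply: (derive_eq_on _ oB B0) => q Bq; exact: D1L.
Qed.

Let D2Ft0 : d2 Ft 0 = 0.
Proof.
have alg (l x y x' y' : R) : l = x' * x + y' * y -> x = 0 -> y = 0 -> l = 0.
  by move=> -> -> ->; rewrite !mulr0 addr0.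
by have e := DFt dir2 B0; rewrite g0 in e; exact: alg e F1 F2.
Qed.

Let sFy : smooth_on B Fy.
Proof. exact: (smooth_comp framed_plane oB L_ball sL sFt). Qed.

Let Fy_taylor : exists E, [/\ smooth_on B E, E 0 = d1 (d1 Fy) 0 / 2 &
  forall p, B p -> Fy p = p.1 ^+ 2 * E p].
Proof.
have [E [sE FyE E0]] := smooth_taylor2 sFy.
exists E; split; [exact: sE|exact: (E0 0 B0)|].
move=> p Bp; apply: etrans (FyE p Bp) _.
have Bp2 : B (0, p.2) := ball0_axis2 Bp.
have alg (x y z e : R) : x = 0 -> y = 0 -> x + z * y + e = e.
  by move=> -> ->; rewrite mulr0 !add0r.
apply: alg; first by rewrite /Fy /L /Ft /= g0.
exact: etrans (D1L sFt Bp2) D2Ft0.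
Qed.

(** The first derivative of [Ft] in the chart vanishes on the axis [q.1 = 0], so the
    Taylor expansion in [q.1] has no linear term, and its constant term is a
    function of [q.2] that vanishes to second order. *)
Lemma chart_form : exists (E : plane -> R) (N : R -> R),
  [/\ smooth_on B E, smooth_on B (fun q => N q.2), 0 < E 0, 0 < N 0 &
   forall q, B q -> F (g q) = q.1 ^+ 2 * E q - q.2 ^+ 2 * N q.2].
Proof.
have [E [sE FtE E0]] := smooth_taylor2 sFt.
have [E2 [sE2 E20 FyE]] := Fy_taylor.
have Bswap q : B q -> B (q.2, 0) by exact: ball0_swap_axis2.
exists E, (fun y => - E2 (y, 0)); split.
- exact: sE.
- apply: (smoothN oB).
  apply: (smooth_comp (f := fun q : plane => (q.2, 0) : plane) framed_plane oB Bswap _ sE2).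
  exact: (smooth_pair oB (smooth_plane_snd oB) (smooth_cst B 0)).
- have -> : E 0 = (A * b ^+ 2)^-1 / 2.
    by apply: etrans (E0 0 B0) _; congr (_ / _); exact: D11Ft0.
  exact: chart_pos1.
- have -> : E2 (0, 0) = - (A ^+ 2 + c ^+ 2) / (A * b ^+ 2) / 2.
    by apply: etrans E20 _; congr (_ / _); exact: D11Fy0.
  exact: chart_pos2.
move=> q Bq; apply: etrans (FtE q Bq) _.
have Bq2 : B (0, q.2) := ball0_axis2 Bq.
have e := FyE _ (Bswap q Bq).
have alg (x y s e1 e2 t : R) : x = t ^+ 2 * e2 -> y = 0 ->
    x + s * y + s ^+ 2 * e1 = s ^+ 2 * e1 - t ^+ 2 * - e2.
  by move=> -> ->; ring.
apply: alg e _; apply: etrans (D1Ft Bq2) _.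
exact: mul0r.
Qed.

End InChart.

Lemma fold_coordinates : exists (g : plane -> plane) (r : R) (E : plane -> R) (N : R -> R),
  [/\ local_diffeo g (0 : plane), g 0 = 0 & 0 < r] /\
  [/\ smooth_on (ball (0 : plane) r) E, smooth_on (ball (0 : plane) r) (fun q => N q.2),
   0 < E 0, 0 < N 0 &
   forall q, ball (0 : plane) r q ->
     F (g q) = q.1 ^+ 2 * E q - q.2 ^+ 2 * N q.2 /\ G (g q) = q.2].
Proof.
have [g [r [dg g0 r0 sg gP]]] := fold_chart.
have [E [N [sE sN E0 N0 H]]] := chart_form g0 r0 sg gP.
exists g, r, E, N; split; first by split; [exact: dg|exact: g0|exact: r0].
split; [exact: sE|exact: sN|exact: E0|exact: N0|].
by move=> q Bq; split; [exact: H|have [] := gP q Bq].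
Qed.

End FoldCoordinates.

(** * Standard form of a fold up to radial changes *)

Section FoldStandard.
Context {R : realType}.
Local Notation plane := (R * R)%type.
Local Notation d1 f := ('D_dir1 f).
Local Notation d2 f := ('D_dir2 f).
#[local] Opaque derive dir1 dir2.

Definition ray_preserving (rho : plane -> plane) := exists2 e : R, 0 < e &
  forall r t : R, 0 < r < e -> exists2 r' : R, 0 < r' & rho (polar r t) = polar r' t.

Lemma jacobian_triangular (a b : plane -> R) (U : set plane) (x y : R) :
  open U -> U 0 -> smooth_on U a -> smooth_on U b ->
  d1 a 0 = x -> d1 b 0 = 0 -> d2 b 0 = y -> x != 0 -> y != 0 ->
  local_diffeo (fun q => (a q, b q)) (0 : plane).
Proof.
move=> oU U0 sa sb a1 b1 b2 x0 y0.
have sab := smooth_pair oU sa sb; have dab := smooth_differentiable sab U0.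
apply: (inverse_function oU U0 sab).
have alg (a' b' c' d' : R) : a' = x -> d' = y -> c' = 0 -> a' * d' - b' * c' != 0.
  by move=> -> -> ->; rewrite mulr0 subr0 mulf_neq0.
exact: alg (etrans (esym (derive_fst _ dab)) a1) (etrans (esym (derive_snd _ dab)) b2)
  (etrans (esym (derive_snd _ dab)) b1).
Qed.

Lemma derive_vanishing_mul (U : set plane) (l k : plane -> R) v : open U -> U 0 ->
  smooth_on U l -> smooth_on U k -> l 0 = 0 ->
  'D_v (fun q => l q * k q) 0 = 'D_v l 0 * k 0.
Proof.
move=> oU U0 sl sk l0.
have e := derive_mul v (smooth_differentiable sl U0) (smooth_differentiable sk U0).
have alg (x y z w t : R) : x = y * z + w * t -> w = 0 -> x = y * z.
  by move=> -> ->; rewrite mul0r addr0.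
exact: alg e l0.
Qed.

Variables (r0 : R) (E : plane -> R) (N : R -> R).
Hypothesis r0_gt0 : 0 < r0.
Local Notation B0 := (ball (0 : plane) r0).
Hypotheses (sE0 : smooth_on B0 E) (sN0 : smooth_on B0 (fun q => N q.2)).
Hypotheses (E_gt0 : 0 < E 0) (N_gt0 : 0 < N 0).

Lemma fold_positive_ball : exists2 r : R, 0 < r &
  ball (0 : plane) r `<=` B0 `&` [set q | 0 < E q /\ 0 < N q.2].
Proof.
have oB : open B0 by exact: ball_open.
have B00 : B0 0 by exact: ballxx.
have o1 := open_preimage_on oB (@open_gt R 0) sE0.
have o2 := open_preimage_on oB (@open_gt R 0) sN0.
have m1 : (B0 `&` E @^-1` [set y | 0 < y]) 0 by split.
have m2 : (B0 `&` (fun q => N q.2) @^-1` [set y | 0 < y]) 0 by split.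
have [r r_gt0 rB] := ball_open_sub (openI o1 o2) (conj m1 m2).
by exists r => // q /rB[[Bq Eq] [_ Nq]].
Qed.

Definition fold_shape (z : plane) : plane := (z.1 ^+ 2 * E z - z.2 ^+ 2 * N z.2, z.2).

(** Multiplying the target by [N] of its second coordinate is a map [T] that
    preserves rays, and [T (fold_shape z)] has the components
    [(z.1 k)^2 - (z.2 N)^2] and [z.2 N], where [k^2 = E N]. So [T] and the source map
    [theta] reduce the fold to the hyperbolic singularity. *)
Lemma fold_standard : exists gam rho : plane -> plane,
  [/\ local_diffeo gam (0 : plane), gam 0 = 0, local_diffeo rho (0 : plane), rho 0 = 0
    & ray_preserving rho] /\
  \forall q \near (0 : plane), ball (0 : plane) r0 (gam q) /\
     rho (hyperbolic_singularity q) = fold_shape (gam q).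
Proof.
have [r r_gt0 rB] := fold_positive_ball.
set B := ball (0 : plane) r in rB *.
have oB : open B by exact: ball_open.
have B0 : B 0 by exact: ballxx.
have sE : smooth_on B E by apply: smooth_sub sE0 => q /rB[].
have sN : smooth_on B (fun q => N q.2) by apply: smooth_sub sN0 => q /rB[].
have s1 := smooth_plane_fst oB; have s2 := smooth_plane_snd oB.
pose k q := Num.sqrt (E q * N q.2).
have sk : smooth_on B k.
  apply: (smooth_sqrt oB); last exact: (smoothM oB sE sN).
  by move=> q /rB[_ [Eq Nq]]; rewrite mulr_gt0.
pose theta (q : plane) : plane := (q.1 * k q, q.2 * N q.2).
pose T (q : plane) : plane := (q.1 * N q.2, q.2 * N q.2).
have k0 : k 0 != 0 by rewrite gt_eqF// sqrtr_gt0 mulr_gt0.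
have n0 : N 0 != 0 by rewrite gt_eqF.
have D2N v : 'D_v (fun q : plane => q.2 * N q.2) 0 = v.2 * N 0.
  by rewrite (derive_vanishing_mul _ oB B0 s2 sN)//= derive_plane_snd.
have D1 (f : plane -> R) v : smooth_on B f -> 'D_v (fun q : plane => q.1 * f q) 0 = v.1 * f 0.
  by move=> sf; rewrite (derive_vanishing_mul _ oB B0 s1 sf)//= derive_plane_fst.
have m1 x : dir1.1 * x = x :> R by rewrite dir1_1 mul1r.
have m2 x : dir1.2 * x = 0 :> R by rewrite dir1_2 mul0r.
have m3 x : dir2.2 * x = x :> R by rewrite dir2_2 mul1r.
have dtheta : local_diffeo theta (0 : plane).
  exact: (jacobian_triangular oB B0 (smoothM oB s1 sk) (smoothM oB s2 sN)
    (etrans (D1 k dir1 sk) (m1 _)) (etrans (D2N dir1) (m2 _)) (etrans (D2N dir2) (m3 _)) k0 n0).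
have dT : local_diffeo T (0 : plane).
  exact: (jacobian_triangular oB B0 (smoothM oB s1 sN) (smoothM oB s2 sN)
    (etrans (D1 _ dir1 sN) (m1 _)) (etrans (D2N dir1) (m2 _)) (etrans (D2N dir2) (m3 _)) n0 n0).
have theta0 : theta 0 = 0 by rewrite /theta /= !mul0r.
have T0 : T 0 = 0 by rewrite /T /= !mul0r.
have [gam [dgam gam0 _ thetaK]] := local_diffeo_inv dtheta.
have [rho [drho rho0 rhoK TK]] := local_diffeo_inv dT.
rewrite theta0 in dgam gam0 thetaK; rewrite T0 in drho rho0 TK.
have near_in (f : plane -> plane) (P : plane -> Prop) : local_diffeo f 0 -> f 0 = 0 ->
    (\forall z \near (0 : plane), P z) -> \forall q \near (0 : plane), P (f q).
  move=> /local_diffeo_smooth[U [_ U0 sf]] f0 nP.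
  by apply: (smooth_continuous sf U0); rewrite f0.
have nB : \forall z \near (0 : plane), B z by exact: open_nbhs_nbhs.
exists gam, rho; split.
  split=> //.
  have /nbhs_ballP[e /= e0 eP] : \forall q \near (0 : plane), T (rho q) = q /\ B (rho q).
    exact: filterI TK (near_in rho B drho rho0 nB).
  exists e => // s t /andP[s0 se].
  have [Tz Bz] : T (rho (polar s t)) = polar s t /\ B (rho (polar s t)).
    apply: eP; rewrite -ball_normE /= sub0r normrN.
    by apply: le_lt_trans se; exact: polar_norm (ltW s0).
  move: (rho (polar s t)) Tz Bz => z Tz /rB[_ [_ Nz]].
  exists (s / N z.2); first by rewrite divr_gt0.
  case: z Tz Nz => z1 z2; rewrite /T /polar /= => -[h1 h2] Nz.
  have Nz0 : N z2 != 0 by rewrite gt_eqF.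
  by apply: injective_projections => /=; rewrite mulrAC -?h1 -?h2 mulfK.
have smF : smooth_on B fold_shape.
  apply: (smooth_pair oB) => //; apply: (smoothB oB); apply: (smoothM oB) => //.
    exact: (smoothM oB s1 s1).
  exact: (smoothM oB s2 s2).
have nF : \forall z \near (0 : plane), rho (T (fold_shape z)) = fold_shape z.
  have f0 : fold_shape 0 = 0 by rewrite /fold_shape /= expr0n !mul0r subr0.
  have cF := smooth_continuous smF B0; rewrite /prop_for /continuous_at f0 in cF.
  exact: (cF _ rhoK).
have nall : \forall q \near (0 : plane), theta (gam q) = q /\
    B (gam q) /\ rho (T (fold_shape (gam q))) = fold_shape (gam q).
  exact: filterI thetaK (near_in gam _ dgam gam0 (filterI nB nF)).
apply: filterS nall => q [tq [Bz <-]]; have [B0z [Ez Nz]] := rB _ Bz.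
split=> //; congr rho; rewrite -[in LHS]tq.
move: (gam q) Ez Nz => z Ez Nz.
have ksq : k z * k z = E z * N z.2 by rewrite -expr2 sqr_sqrtr// mulr_ge0// ltW.
apply: injective_projections; rewrite /= /hyperbolic_singularity /T /fold_shape /=.
  by rewrite !expr2 mulrACA ksq; ring.
by [].
Qed.

End FoldStandard.

(** * Radial equivalence read off from 2-jets *)

Section RadialEquivalence.
Context {R : realType}.
Local Notation plane := (R * R)%type.
Local Notation d1 f := ('D_dir1 f).
Local Notation d2 f := ('D_dir2 f).
#[local] Opaque derive dir1 dir2.

Lemma local_diffeo_id (p : plane) : local_diffeo (fun q : plane => q) p.
Proof.
exists setT, setT, id; split; split=> //; try exact: openT; exact: smooth_id.
Qed.

Lemma radial_id : radial_transformation (fun q : R * R => q).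
Proof.
split=> //; first exact: local_diffeo_id.
by exists 1 => // t; exists t => r /andP[r0 _]; exists r.
Qed.

Lemma radial_linear_comp (a b c d : R) (rho : plane -> plane) : a * d - b * c != 0 ->
  local_diffeo rho (0 : plane) -> rho 0 = 0 -> ray_preserving rho ->
  radial_transformation (linear_map a b c d \o rho).
Proof.
move=> D0 drho rho0 [e e0 ray]; split.
- apply: local_diffeo_comp => //; exact: linear_map_local_diffeo.
- by rewrite /= rho0 /linear_map /= !mulr0 !addr0.
exists e => // t.
have L1 : linear_map a b c d (polar 1 t) != 0.
  apply/eqP => L0; have := linear_map_cancel (polar 1 t) D0.
  rewrite L0 /linear_map /= !mulr0 !addr0 => /esym/eqP.
  by rewrite (negPf (polar_neq0 t)).
move: L1; rewrite [linear_map _ _ _ _ _]surjective_pairing => /polar_exists[n [t' [n0 _ Lt]]].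
exists t' => r re; have [r' r'0 e'] := ray r t re.
rewrite -[(_ \o _) _]/(linear_map a b c d (rho (polar r t))) e'; exists (r' * n); first by rewrite mulr_gt0.
move: Lt; rewrite /linear_map /polar /= !mul1r => -[h1 h2].
by apply: injective_projections; rewrite /= -mulrA -?h1 -?h2; ring.
Qed.

Definition affine_map (p : plane) (a b c d : R) (z : plane) : plane :=
  p + linear_map a b c d z.

Lemma smooth_affine_map p a b c d (U : set plane) : open U -> smooth_on U (affine_map p a b c d).
Proof.
by move=> oU; apply: smoothD => //; [exact: smooth_cst|exact: smooth_linear_map].
Qed.

Lemma affine_map_local_diffeo p a b c d q : a * d - b * c != 0 ->
  local_diffeo (affine_map p a b c d) q.
Proof.
move=> D0; have oT : open [set: plane] by exact: openT.
apply: (local_diffeo_comp (linear_map_local_diffeo q D0) (f2 := fun z => p + z)).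
exists setT, setT, (fun z => - p + z); split; split=> //.
- by apply: smoothD => //; [exact: smooth_cst|exact: smooth_id].
- by apply: smoothD => //; [exact: smooth_cst|exact: smooth_id].
- by move=> z _; split=> //; rewrite addKr.
- by move=> z _; split=> //; rewrite addNKr.
Qed.

Lemma derive_affine_map p a b c d z v :
  'D_v (affine_map p a b c d) z = linear_map a b c d v.
Proof.
have linB : linear (linear_map a b c d).
  by move=> e u w; apply: injective_projections; rewrite /= /GRing.scale /=; ring.
have cB : continuous (linear_map a b c d).
  have sB := smooth_linear_map a b c d (@openT plane).
  by move=> x; exact: (smooth_continuous sB).
have [dL DL] := derive_linear z linB cB.
have -> : affine_map p a b c d = cst p + linear_map a b c d by [].
rewrite deriveD; [|exact: derivable_cst|exact: diff_derivable].
by rewrite derive_cst add0r DL.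
Qed.

Definition comb (V : normedModType R) (a b : R) (f g : V -> R) (q : V) := a * f q + b * g q.

Lemma comb_eq (V : normedModType R) a b (f g : V -> R) q x y :
  f q = x -> g q = y -> comb a b f g q = a * x + b * y.
Proof. by move=> <- <-. Qed.

Lemma smooth_comb (V : normedModType R) (U : set V) a b f g : open U ->
  smooth_on U f -> smooth_on U g -> smooth_on U (comb a b f g).
Proof. by move=> oU sf sg; apply: smoothD => //; exact: smoothMl. Qed.

Lemma derive_comb (V : normedModType R) (U : set V) a b f g q v : U q ->
  smooth_on U f -> smooth_on U g -> 'D_v (comb a b f g) q = a * 'D_v f q + b * 'D_v g q.
Proof.
move=> Uq sf sg; have df := smooth_differentiable sf Uq; have dg := smooth_differentiable sg Uq.
have d1 := derive_mul v (differentiable_cst a q) df.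
have d2 := derive_mul v (differentiable_cst b q) dg.
have e := derive_add v (diff_mul (differentiable_cst a q) df) (diff_mul (differentiable_cst b q) dg).
rewrite derive_cst mul0r add0r in d1; rewrite derive_cst mul0r add0r in d2.
exact: etrans e (congr2 +%R d1 d2).
Qed.

Lemma derive2_comb (V : normedModType R) (U : set V) a b f g q v w : open U -> U q ->
  smooth_on U f -> smooth_on U g ->
  'D_w ('D_v (comb a b f g)) q = a * 'D_w ('D_v f) q + b * 'D_w ('D_v g) q.
Proof.
move=> oU Uq sf sg.
apply: etrans (derive_comb a b w Uq (smooth_derive v sf) (smooth_derive v sg)).
by apply: (derive_eq_on _ oU Uq) => z Uz; exact: (derive_comb a b v Uz sf sg).
Qed.

#[local] Opaque comb.

Section Slice.
Variables (Psi : R * R * R -> R * R) (p : R * R * R) (U : set plane).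
Let f (z : plane) : plane := Psi (z, p.2).
Hypotheses (oU : open U) (Up : U p.1) (sf : smooth_on U f) (f0 : Psi p = 0).

Let fp : f p.1 = 0.
Proof. by rewrite /f -surjective_pairing. Qed.

(** The local inverse is the source diffeomorphism; the target map is the identity. *)
Lemma regular_equivalence : jacobian f p.1 != 0 ->
  radially_equivalent Psi p regular_singularity.
Proof.
move=> J0; have [g [dg g0 _ fg]] := local_diffeo_inv (inverse_function oU Up sf J0).
rewrite fp in dg g0 fg.
exists g, (fun q => q); split=> //; first exact: radial_id.
apply: filterS fg => q fgq; rewrite -[LHS]/(f (g q)) fgq.
exact: surjective_pairing.
Qed.

Variables (co si m1 m2 s : R).
Hypotheses (cs1 : co ^+ 2 + si ^+ 2 = 1) (mm1 : m1 ^+ 2 + m2 ^+ 2 = 1).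
Let h1 (z : plane) := (f z).1.
Let h2 (z : plane) := (f z).2.
Let al := affine_map p.1 co (- si) si co.

(** Components of [f] across and along the image line of its derivative, in
    coordinates along and across the kernel of that derivative. *)
Let hF := comb (- (s * m2)) (s * m1) h1 h2.
Let hG := comb m1 m2 h1 h2.
Let F (z : plane) := hF (al z).
Let G (z : plane) := hG (al z).

Let al_diffeo : local_diffeo al (0 : plane).
Proof.
apply: affine_map_local_diffeo.
by rewrite mulNr opprK -!expr2 cs1 oner_eq0.
Qed.

Let al0 : al 0 = p.1.
Proof.
rewrite /al /affine_map; have -> : linear_map co (- si) si co 0 = 0.
  by rewrite /linear_map /= !mulr0 !addr0.
exact: addr0.
Qed.

Let U' : set plane := setT `&` al @^-1` U.

Let sal : smooth_on setT al.
Proof. exact: smooth_affine_map openT. Qed.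

Let oU' : open U'.
Proof. exact: (open_preimage_on openT oU sal). Qed.

Let U'0 : U' 0.
Proof. by split=> //; change (U (al 0)); rewrite al0. Qed.

Let sal' : smooth_on U' al.
Proof. exact: smooth_affine_map. Qed.

Let U'U z : U' z -> U (al z). Proof. by case. Qed.

Let sh1 := smooth_fst oU sf.
Let sh2 := smooth_snd oU sf.

Let derive_al (h : plane -> R) z v : smooth_on U h -> U' z ->
  'D_v (fun z => h (al z)) z =
  (co * v.1 - si * v.2) * d1 h (al z) + (si * v.1 + co * v.2) * d2 h (al z).
Proof.
move=> sh U'z; have dal := smooth_differentiable sal' U'z.
have e := derive_chain v dal (smooth_differentiable sh (U'U U'z)).
by rewrite derive_affine_map /= mulNr in e.
Qed.

Let D1al h z : smooth_on U h -> U' z -> d1 (fun z => h (al z)) z = comb co si (d1 h) (d2 h) (al z).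
Proof.
move=> sh U'z; apply: etrans (derive_al dir1 sh U'z) _.
by rewrite dir1_1 dir1_2 !mulr1 !mulr0 subr0 addr0.
Qed.

Let D2al h z : smooth_on U h -> U' z ->
  d2 (fun z => h (al z)) z = comb (- si) co (d1 h) (d2 h) (al z).
Proof.
move=> sh U'z; apply: etrans (derive_al dir2 sh U'z) _.
by rewrite dir2_1 dir2_2 !mulr1 !mulr0 sub0r add0r.
Qed.

Let D11al h : smooth_on U h -> d1 (d1 (fun z => h (al z))) 0 =
  co * (co * d1 (d1 h) p.1 + si * d1 (d2 h) p.1) + si * (co * d2 (d1 h) p.1 + si * d2 (d2 h) p.1).
Proof.
move=> sh; have s1 := smooth_derive dir1 sh; have s2 := smooth_derive dir2 sh.
have sc := smooth_comb co si oU s1 s2.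
have e : d1 (d1 (fun z => h (al z))) 0 = d1 (fun z => comb co si (d1 h) (d2 h) (al z)) 0.
  by apply: (derive_eq_on _ oU' U'0) => z U'z; exact: D1al.
apply: etrans e (etrans (D1al sc U'0) _); rewrite al0.
by apply: comb_eq; [exact: (derive_comb co si dir1 Up s1 s2)|exact: (derive_comb co si dir2 Up s1 s2)].
Qed.

Let D22al h : smooth_on U h -> d2 (d2 (fun z => h (al z))) 0 =
  - si * (- si * d1 (d1 h) p.1 + co * d1 (d2 h) p.1) + co * (- si * d2 (d1 h) p.1 + co * d2 (d2 h) p.1).
Proof.
move=> sh; have s1 := smooth_derive dir1 sh; have s2 := smooth_derive dir2 sh.
have sc := smooth_comb (- si) co oU s1 s2.
have e : d2 (d2 (fun z => h (al z))) 0 = d2 (fun z => comb (- si) co (d1 h) (d2 h) (al z)) 0.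
  by apply: (derive_eq_on _ oU' U'0) => z U'z; exact: D2al.
apply: etrans e (etrans (D2al sc U'0) _); rewrite al0.
by apply: comb_eq; [exact: (derive_comb (- si) co dir1 Up s1 s2)|exact: (derive_comb (- si) co dir2 Up s1 s2)].
Qed.

Variables (x1 y1 x2 y2 a1 b1 a2 b2 a : R).
Hypotheses (x1E : d1 h1 p.1 = x1) (y1E : d2 h1 p.1 = y1).
Hypotheses (x2E : d1 h2 p.1 = x2) (y2E : d2 h2 p.1 = y2).
Hypotheses (a1E : d1 (d1 h1) p.1 = a1) (b1E : d1 (d2 h1) p.1 = b1) (c1E : d2 (d2 h1) p.1 = - a1).
Hypotheses (a2E : d1 (d1 h2) p.1 = a2) (b2E : d1 (d2 h2) p.1 = b2) (c2E : d2 (d2 h2) p.1 = - a2).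
Hypotheses (a_neq0 : a != 0) (ss1 : s * s = 1).
Hypotheses (k1 : co * x1 + si * y1 = 0) (k2 : co * x2 + si * y2 = 0).
Hypotheses (t1 : - si * x1 + co * y1 = a * m1) (t2 : - si * x2 + co * y2 = a * m2).
Let Q1 := (co ^+ 2 - si ^+ 2) * a1 + 2 * co * si * b1.
Let Q2 := (co ^+ 2 - si ^+ 2) * a2 + 2 * co * si * b2.
Hypothesis nondeg : 0 < s * (m1 * Q2 - m2 * Q1).

Let b1E' : d2 (d1 h1) p.1 = b1.
Proof. exact: etrans (derive_comm framed_plane _ _ oU Up sh1) b1E. Qed.
Let b2E' : d2 (d1 h2) p.1 = b2.
Proof. exact: etrans (derive_comm framed_plane _ _ oU Up sh2) b2E. Qed.

Let shF : smooth_on U hF. Proof. exact: smooth_comb. Qed.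
Let shG : smooth_on U hG. Proof. exact: smooth_comb. Qed.
Let sF : smooth_on U' F.
Proof. exact: (smooth_comp framed_plane oU' U'U sal' shF). Qed.
Let sG : smooth_on U' G.
Proof. exact: (smooth_comp framed_plane oU' U'U sal' shG). Qed.

Let h10 : h1 p.1 = 0. Proof. by rewrite /h1 fp. Qed.
Let h20 : h2 p.1 = 0. Proof. by rewrite /h2 fp. Qed.

Let comb0 u w : comb u w h1 h2 p.1 = 0.
Proof. by rewrite (comb_eq u w h10 h20) !mulr0 addr0. Qed.

Let F0 : F 0 = 0. Proof. by rewrite /F al0; exact: comb0. Qed.
Let G0 : G 0 = 0. Proof. by rewrite /G al0; exact: comb0. Qed.

Let D1comb u w : d1 (comb u w h1 h2) p.1 = u * x1 + w * x2.
Proof. by apply: etrans (derive_comb u w dir1 Up sh1 sh2) _; rewrite x1E x2E. Qed.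
Let D2comb u w : d2 (comb u w h1 h2) p.1 = u * y1 + w * y2.
Proof. by apply: etrans (derive_comb u w dir2 Up sh1 sh2) _; rewrite y1E y2E. Qed.

Let D1K u w : d1 (fun z => comb u w h1 h2 (al z)) 0 =
  co * (u * x1 + w * x2) + si * (u * y1 + w * y2).
Proof.
apply: etrans (D1al (smooth_comb u w oU sh1 sh2) U'0) _; rewrite al0.
by apply: comb_eq; [exact: D1comb|exact: D2comb].
Qed.

Let D2K u w : d2 (fun z => comb u w h1 h2 (al z)) 0 =
  - si * (u * x1 + w * x2) + co * (u * y1 + w * y2).
Proof.
apply: etrans (D2al (smooth_comb u w oU sh1 sh2) U'0) _; rewrite al0.
by apply: comb_eq; [exact: D1comb|exact: D2comb].
Qed.

Let F1 : d1 F 0 = 0.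
Proof.
apply: etrans (D1K _ _) _.
have -> : co * (- (s * m2) * x1 + s * m1 * x2) + si * (- (s * m2) * y1 + s * m1 * y2) =
  - (s * m2) * (co * x1 + si * y1) + s * m1 * (co * x2 + si * y2) by ring.
by rewrite k1 k2 !mulr0 addr0.
Qed.

Let G1 : d1 G 0 = 0.
Proof.
apply: etrans (D1K _ _) _.
have -> : co * (m1 * x1 + m2 * x2) + si * (m1 * y1 + m2 * y2) =
  m1 * (co * x1 + si * y1) + m2 * (co * x2 + si * y2) by ring.
by rewrite k1 k2 !mulr0 addr0.
Qed.

Let F2 : d2 F 0 = 0.
Proof.
apply: etrans (D2K _ _) _.
have -> : - si * (- (s * m2) * x1 + s * m1 * x2) + co * (- (s * m2) * y1 + s * m1 * y2) =
  - (s * m2) * (- si * x1 + co * y1) + s * m1 * (- si * x2 + co * y2) by ring.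
by rewrite t1 t2; ring.
Qed.

Let G2 : d2 G 0 = a.
Proof.
apply: etrans (D2K _ _) _.
have -> : - si * (m1 * x1 + m2 * x2) + co * (m1 * y1 + m2 * y2) =
  m1 * (- si * x1 + co * y1) + m2 * (- si * x2 + co * y2) by ring.
rewrite t1 t2; have -> : m1 * (a * m1) + m2 * (a * m2) = a * (m1 ^+ 2 + m2 ^+ 2) by ring.
by rewrite mm1 mulr1.
Qed.

Let A := s * (m1 * Q2 - m2 * Q1).

Let hessian_alg (l x11 x12 x21 x22 c0 s0 u w p1 q1 p2 q2 : R) :
  l = c0 * (c0 * x11 + s0 * x21) + s0 * (c0 * x12 + s0 * x22) ->
  x11 = u * p1 + w * p2 -> x12 = u * q1 + w * q2 -> x21 = u * q1 + w * q2 ->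
  x22 = u * - p1 + w * - p2 ->
  l = u * ((c0 ^+ 2 - s0 ^+ 2) * p1 + 2 * c0 * s0 * q1) + w * ((c0 ^+ 2 - s0 ^+ 2) * p2 + 2 * c0 * s0 * q2).
Proof. by move=> -> -> -> -> ->; ring. Qed.

Let hess u w v v' p1 p2 : 'D_v' ('D_v h1) p.1 = p1 -> 'D_v' ('D_v h2) p.1 = p2 ->
  'D_v' ('D_v (comb u w h1 h2)) p.1 = u * p1 + w * p2.
Proof. by move=> <- <-; exact: (derive2_comb u w v v' oU Up sh1 sh2). Qed.

Let F11 : d1 (d1 F) 0 = A.
Proof.
apply: etrans (hessian_alg (D11al shF) (hess _ _ a1E a2E) (hess _ _ b1E' b2E') (hess _ _ b1E b2E) (hess _ _ c1E c2E)) _.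
by rewrite /A /Q1 /Q2; ring.
Qed.

Let F22 : d2 (d2 F) 0 = - A.
Proof.
have alg (l x11 x12 x21 x22 : R) :
    l = - si * (- si * x11 + co * x21) + co * (- si * x12 + co * x22) ->
    l = co * (co * x22 + - si * x12) + - si * (co * x21 + - si * x11).
  by move=> ->; ring.
have e := alg _ _ _ _ _ (D22al shF).
have e' (u w x y : R) : u * x + w * y = u * - - x + w * - - y by rewrite !opprK.
have H := hessian_alg e (hess _ _ c1E c2E) (hess _ _ b1E b2E) (hess _ _ b1E' b2E') (etrans (hess _ _ a1E a2E) (e' _ _ _ _)).
apply: etrans H _.
by rewrite /A /Q1 /Q2; ring.
Qed.

(** In the notation of the section, [(co, si)] spans the kernel and [(m1, m2)] the
    image of the derivative, and [s] is the sign that makes [d1 (d1 F)] positive.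
    The radial map of the target is the rescaling of [fold_standard] followed by
    the orthogonal map that undoes the passage to [F] and [G]. *)
Lemma fold_equivalence : radially_equivalent Psi p hyperbolic_singularity.
Proof.
have [g [r [E [N [[dg g0 r_gt0] [sE sN E_gt0 N_gt0 gP]]]]]] :=
  fold_coordinates oU' U'0 sF sG F0 G0 F1 F2 G1 G2 a_neq0 F11 F22 nondeg.
have [gam [rho [[dgam gam0 drho rho0 ray] near0]]] := fold_standard r_gt0 sE sN E_gt0 N_gt0.
exists (al \o (g \o gam)), (linear_map (- (s * m2)) m1 (s * m1) m2 \o rho); split.
- apply: local_diffeo_comp; first by apply: local_diffeo_comp => //; rewrite gam0.
  by rewrite /= gam0 g0.
- by rewrite /= gam0 g0 al0.
- apply: radial_linear_comp => //.
  have -> : - (s * m2) * m2 - m1 * (s * m1) = - s * (m1 ^+ 2 + m2 ^+ 2) by ring.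
  rewrite mm1 mulr1 oppr_eq0; apply/eqP => s0.
  by move: ss1; rewrite s0 mul0r => /esym/eqP; rewrite oner_eq0.
apply: filterS near0 => q [Bq rhoq].
have [Fq Gq] := gP _ Bq.
rewrite -[RHS]/(linear_map (- (s * m2)) m1 (s * m1) m2 (rho (hyperbolic_singularity q))).
rewrite rhoq /fold_shape -Fq -Gq.
rewrite /F /G /hF /hG !(comb_eq _ _ (erefl _) (erefl _)) -[LHS]/(f (al (g (gam q)))) /h1 /h2 /=.
case: (f (al (g (gam q)))) => u w /=.
have mm : m1 * m1 + m2 * m2 = 1 by rewrite -!expr2.
apply: injective_projections => /=.
  have -> : - (s * m2) * (- (s * m2) * u + s * m1 * w) + m1 * (m1 * u + m2 * w) =
    (s * s) * (m2 * m2 * u - m1 * m2 * w) + m1 * m1 * u + m1 * m2 * w by ring.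
  rewrite ss1 mul1r; have -> : m2 * m2 * u - m1 * m2 * w + m1 * m1 * u + m1 * m2 * w =
    (m1 * m1 + m2 * m2) * u by ring.
  by rewrite mm mul1r.
have -> : s * m1 * (- (s * m2) * u + s * m1 * w) + m2 * (m1 * u + m2 * w) =
  (s * s) * (m1 * m1 * w - m1 * m2 * u) + m1 * m2 * u + m2 * m2 * w by ring.
rewrite ss1 mul1r; have -> : m1 * m1 * w - m1 * m2 * u + m1 * m2 * u + m2 * m2 * w =
  (m1 * m1 + m2 * m2) * w by ring.
by rewrite mm mul1r.
Qed.

End Slice.
End RadialEquivalence.

(** * A counting argument *)

Section Pigeonhole.
Context {R : realType}.

Lemma same_cell (C k : R) (x y : R) : 0 < k -> `|x| <= C -> `|y| <= C ->
  Num.truncn ((x + C) * k) = Num.truncn ((y + C) * k) -> `|x - y| <= k^-1.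
Proof.
move=> k0 xC yC e.
have /andP[x1 x2] : - C <= x <= C by rewrite -ler_norml.
have /andP[y1 y2] : - C <= y <= C by rewrite -ler_norml.
have px : 0 <= (x + C) * k by apply: mulr_ge0 (ltW k0); lra.
have py : 0 <= (y + C) * k by apply: mulr_ge0 (ltW k0); lra.
have /andP[tx1 tx2] := truncn_itv px; have /andP[ty1 ty2] := truncn_itv py.
move: tx1 tx2; rewrite e => tx1 tx2.
rewrite -[leRHS]mul1r ler_pdivlMr// -[X in _ * X](gtr0_norm k0) -normrM.
move: ty1 ty2 tx1 tx2; rewrite -natr1; move: (_%:R) => n ? ? ? ?.
by rewrite ler_norml; apply/andP; split; lra.
Qed.

Lemma cell_count (I J N : nat) (a : nat) : (J < I)%N -> N = (a ^ J)%N ->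
  ((a * N) ^ J < N.+1 ^ I)%N.
Proof.
move=> JI NE; rewrite expnMn -NE -expnS.
apply: (@leq_trans (N.+1 ^ J.+1)%N); last by rewrite leq_pexp2l.
by rewrite ltn_exp2r.
Qed.

(** Close witnesses have close points, and the witnesses have lower dimension than
    the points. In a cube of points take a grid with [N.+1] points on each side; its
    [N.+1 ^ #|I|] points outnumber the [(c * D * N) ^ #|J|] cells of side
    proportional to [1 / N] of the box of witnesses. Two grid points with witnesses
    in the same cell would be closer than the mesh. *)
Lemma pigeonhole_avoid (I J : finType) (C L d : R) (Bad : (I -> R) -> (J -> R) -> Prop) :
  (#|J| < #|I|)%N -> 0 <= C -> 0 <= L -> 0 < d ->
  (forall s z, (forall i, 0 <= s i <= d) -> Bad s z -> forall j, `|z j| <= C) ->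
  (forall s z s' z' e, (forall i, 0 <= s i <= d) -> (forall i, 0 <= s' i <= d) ->
     Bad s z -> Bad s' z' -> (forall j, `|z j - z' j| <= e) ->
     forall i, `|s i - s' i| <= L * e) ->
  exists s : I -> R, (forall i, 0 <= s i <= d) /\ forall z, ~ Bad s z.
Proof.
move=> JI C0 L0 d0 bndC lip; apply: contrapT => noS.
have ex s : (forall i, 0 <= s i <= d) -> exists z, Bad s z.
  move=> sd; apply: contrapT => nz; apply: noS; exists s; split=> // z bz.
  by apply: nz; exists z.
pose D := (Num.bound (L / d)).+1; pose c := (Num.bound (2 * C)).+1.
have DL : L / d < D%:R.
  by apply: lt_trans (archi_boundP _) _; rewrite ?ltr_nat// divr_ge0// ltW.
have cC : 2 * C < c%:R.
  by apply: lt_trans (archi_boundP _) _; rewrite ?ltr_nat// mulr_ge0.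
(* With this [N] the two counts compare by [cell_count]. *)
pose N := ((c * D) ^ #|J|)%N.
have N0 : (0 < N)%N by rewrite expn_gt0 muln_gt0.
pose k := (D * N)%N; have k0 : 0 < k%:R :> R by rewrite ltr0n muln_gt0.
have NR : 0 < N%:R :> R by rewrite ltr0n.
pose pt (g : {ffun I -> 'I_N.+1}) (i : I) : R := d * (g i)%:R / N%:R.
have ptd g i : 0 <= pt g i <= d.
  rewrite /pt divr_ge0 ?mulr_ge0 ?ler0n ?(ltW d0)//=.
  by rewrite ler_pdivrMr// ler_pM2l// ler_nat -ltnS.
have [w wP] := choice (fun g => ex (pt g) (ptd g)).
have wC g j : `|w g j| <= C by apply: (bndC (pt g)); [exact: ptd|exact: wP].
pose M := (c * k)%N.
have cellM g j : (Num.truncn ((w g j + C) * k%:R) < M)%N.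
  have := wC g j; rewrite ler_norml => /andP[w1 w2].
  rewrite truncn_lt_nat; last by apply: mulr_ge0 (ltW k0); move: w1 w2 => ? ?; lra.
  rewrite /M natrM ltr_pM2r//; apply: le_lt_trans cC.
  by rewrite mulr_natl mulr2n lerD2r.
pose cell g : {ffun J -> 'I_M} := [ffun j => Ordinal (cellM g j)].
have cell_inj : injective cell.
  move=> g g' /ffunP gg; apply/ffunP => i; apply/eqP; apply: contraT => ne.
  have close j : `|w g j - w g' j| <= k%:R^-1.
    apply: (same_cell k0 (wC g j) (wC g' j)).
    by have := gg j; rewrite !ffunE => /(congr1 val).
  have := lip _ _ _ _ _ (ptd g) (ptd g') (wP g) (wP g') close i.
  have far : d / N%:R <= `|pt g i - pt g' i|.
    rewrite /pt -mulrBl -mulrBr !normrM (gtr0_norm d0) normfV (gtr0_norm NR).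
    rewrite ler_pM2r ?invr_gt0// ler_peMr ?(ltW d0)//.
    have ne' : (g i : nat) != g' i by [].
    case: (ltngtP (g i) (g' i)) ne' => // lt_g _.
      by rewrite distrC -natrB 1?ltnW// normr_nat ler1n subn_gt0.
    by rewrite -natrB 1?ltnW// normr_nat ler1n subn_gt0.
  move=> /(le_trans far); rewrite leNgt => /negP[].
  rewrite /k natrM invfM mulrA ltr_pM2r ?invr_gt0//.
  by rewrite ltr_pdivrMr ?ltr0n// mulrC -ltr_pdivrMr.
have := leq_card cell cell_inj; rewrite !card_ffun !card_ord leqNgt.
by rewrite /M /k mulnA (cell_count JI).
Qed.

End Pigeonhole.

(** * Standing waves *)

Section TrigWaves.
Context {R : realType}.
Local Notation spacetime := (R * R * R)%type.

Lemma framed_spacetime : framed spacetime.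
Proof. exact: framed_pair (framed_pair framed_real framed_real) framed_real. Qed.

(** The [n]-th derivative of the cosine. *)
Definition cosn (n : nat) (x : R) : R := cos (x + n%:R * (pi / 2)).

Lemma cosnS n x : cosn n.+1 x = - sin (x + n%:R * (pi / 2)).
Proof. by rewrite /cosn -natr1 mulrDl mul1r addrA cosDpihalf. Qed.

Lemma cosnSS n x : cosn n.+2 x = - cosn n x.
Proof. by rewrite cosnS -natr1 mulrDl mul1r addrA sinDpihalf. Qed.

Lemma cosn_at0 : cosn 0 0 = 1 /\ cosn 1 0 = 0.
Proof. by rewrite cosnS /cosn mul0r !addr0 cos0 sin0 oppr0. Qed.

Lemma cosn_le1 n x : `|cosn n x| <= 1.
Proof. exact: cos_max. Qed.

Lemma smooth_cosn (V : normedModType R) (U : set V) n (f : V -> R) : open U ->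
  smooth_on U f -> smooth_on U (fun q => cosn n (f q)).
Proof.
move=> oU sf; apply: (smooth_cos oU).
by apply: (smoothD oU sf); exact: smooth_cst.
Qed.

Lemma derive_cosn (V : normedModType R) n (f : V -> R) p v : differentiable f p ->
  'D_v (fun q => cosn n (f q)) p = 'D_v f p * cosn n.+1 (f p).
Proof.
move=> df; have dh : is_derive (f p) 1 (cosn n) (cosn n.+1 (f p)).
  by rewrite cosnS; apply: is_derive_eq; rewrite /GRing.scale /=; ring.
by have [_ ->] := derive_real_comp v df dh.
Qed.

Variable p0 : spacetime.

(** The orders [m], [n], [l] of the cosines, which are shifts of the phases by
    quarter periods, make the family stable under all partial derivatives. *)
Definition trig_wave (c a b w : R) (m n l : nat) (p : spacetime) : R :=
  c * (cosn m (a * (p.1.1 - p0.1.1)) *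
       (cosn n (b * (p.1.2 - p0.1.2)) * cosn l (w * (p.2 - p0.2)))).

Let lin1 (a : R) (p : spacetime) := a * (p.1.1 - p0.1.1).
Let lin2 (b : R) (p : spacetime) := b * (p.1.2 - p0.1.2).
Let lin3 (w : R) (p : spacetime) := w * (p.2 - p0.2).

Let coord (U : set spacetime) : open U ->
  [/\ smooth_on U (fun p => p.1.1), smooth_on U (fun p => p.1.2) & smooth_on U (fun p => p.2)].
Proof.
move=> oU; have s1 := smooth_fst oU (smooth_id U).
by split; [exact: smooth_fst|exact: smooth_snd|exact: (smooth_snd oU (smooth_id U))].
Qed.

Let slin a (U : set spacetime) : open U ->
  [/\ smooth_on U (lin1 a), smooth_on U (lin2 a) & smooth_on U (lin3 a)].
Proof.
move=> oU; have [s1 s2 s3] := coord oU.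
by split; apply: (smoothMl _ oU); apply: (smoothB oU) => //; exact: smooth_cst.
Qed.

Let oT : open [set: spacetime]. Proof. exact: openT. Qed.

Lemma smooth_trig_wave c a b w m n l : smooth_on setT (trig_wave c a b w m n l).
Proof.
have [s1 _ _] := slin a oT; have [_ s2 _] := slin b oT; have [_ _ s3] := slin w oT.
apply: (smoothMl _ oT); apply: (smoothM oT); first exact: smooth_cosn.
by apply: (smoothM oT); exact: smooth_cosn.
Qed.

Let derive_affine (a : R) (f : spacetime -> R) r (p v : spacetime) : differentiable f p ->
  'D_v (fun p => a * (f p - r)) p = a * 'D_v f p.
Proof.
move=> df.
have e := derive_mul v (differentiable_cst a p) (differentiableB df (differentiable_cst r p)).
rewrite derive_cst mul0r add0r in e; apply: etrans e _; congr (_ * _).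
by rewrite (derive_sub v df (differentiable_cst r p)) derive_cst subr0.
Qed.

Lemma derive_trig_wave c a b w m n l (p v : spacetime) : 'D_v (trig_wave c a b w m n l) p =
  v.1.1 * trig_wave (c * a) a b w m.+1 n l p + v.1.2 * trig_wave (c * b) a b w m n.+1 l p
  + v.2 * trig_wave (c * w) a b w m n l.+1 p.
Proof.
have [s1 _ _] := slin a oT; have [_ s2 _] := slin b oT; have [_ _ s3] := slin w oT.
have [c1 c2 c3] := coord oT.
have dc1 := smooth_differentiable c1 (I : setT p).
have dc2 := smooth_differentiable c2 (I : setT p).
have dc3 := smooth_differentiable c3 (I : setT p).
have d1 := smooth_differentiable s1 (I : setT p).
have d2 := smooth_differentiable s2 (I : setT p).
have d3 := smooth_differentiable s3 (I : setT p).
have k1 := smooth_differentiable (smooth_cosn m oT s1) (I : setT p).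
have k2 := smooth_differentiable (smooth_cosn n oT s2) (I : setT p).
have k3 := smooth_differentiable (smooth_cosn l oT s3) (I : setT p).
have D0 : 'D_v (fun p : spacetime => p) p = v by exact: derive_id.
have Dfst : 'D_v (fun p : spacetime => p.1) p = v.1 by rewrite derive_fst ?D0.
have did := smooth_differentiable (smooth_fst oT (smooth_id [set: spacetime])) (I : setT p).
have E1 : 'D_v (lin1 a) p = a * v.1.1.
  by rewrite (derive_affine a _ v dc1) (derive_fst v did) Dfst.
have E2 : 'D_v (lin2 b) p = b * v.1.2.
  by rewrite (derive_affine b _ v dc2) (derive_snd v did) Dfst.
have E3 : 'D_v (lin3 w) p = w * v.2.
  by rewrite (derive_affine w _ v dc3) derive_snd ?D0.
have F1 := derive_cosn m v d1; have F2 := derive_cosn n v d2; have F3 := derive_cosn l v d3.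
rewrite E1 in F1; rewrite E2 in F2; rewrite E3 in F3.
have G1 := derive_mul v k2 k3; have G2 := derive_mul v k1 (diff_mul k2 k3).
have G3 := derive_mul v (differentiable_cst c p) (diff_mul k1 (diff_mul k2 k3)).
rewrite derive_cst mul0r add0r in G3.
apply: etrans G3 _; rewrite G2 G1 F1 F2 F3 /trig_wave /lin1 /lin2 /lin3.
rewrite /cst; ring.
Qed.

Lemma derive_trig_wave_x c a b w m n l :
  'D_ex (trig_wave c a b w m n l) = trig_wave (c * a) a b w m.+1 n l.
Proof. by apply/funext => p; rewrite derive_trig_wave /= mul1r !mul0r !addr0. Qed.

Lemma derive_trig_wave_y c a b w m n l :
  'D_ey (trig_wave c a b w m n l) = trig_wave (c * b) a b w m n.+1 l.
Proof. by apply/funext => p; rewrite derive_trig_wave /= mul1r !mul0r addr0 add0r. Qed.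

Lemma derive_trig_wave_t c a b w m n l :
  'D_et (trig_wave c a b w m n l) = trig_wave (c * w) a b w m n l.+1.
Proof. by apply/funext => p; rewrite derive_trig_wave /= mul1r !mul0r !add0r. Qed.

Lemma trig_waveE c a b w m n l p : trig_wave c a b w m n l p =
  c * (cosn m (a * (p.1.1 - p0.1.1)) *
       (cosn n (b * (p.1.2 - p0.1.2)) * cosn l (w * (p.2 - p0.2)))).
Proof. by []. Qed.

#[local] Opaque ex ey et derive trig_wave.

Lemma derive_trig_wave_xx c a b w m n l :
  'D_ex ('D_ex (trig_wave c a b w m n l)) = trig_wave (c * a * a) a b w m.+2 n l.
Proof.
exact: etrans (congr1 (fun g => 'D_ex g) (derive_trig_wave_x c a b w m n l))
  (derive_trig_wave_x (c * a) a b w m.+1 n l).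
Qed.

Lemma derive_trig_wave_yy c a b w m n l :
  'D_ey ('D_ey (trig_wave c a b w m n l)) = trig_wave (c * b * b) a b w m n.+2 l.
Proof.
exact: etrans (congr1 (fun g => 'D_ey g) (derive_trig_wave_y c a b w m n l))
  (derive_trig_wave_y (c * b) a b w m n.+1 l).
Qed.

Lemma derive_trig_wave_xy c a b w m n l :
  'D_ex ('D_ey (trig_wave c a b w m n l)) = trig_wave (c * b * a) a b w m.+1 n.+1 l.
Proof.
exact: etrans (congr1 (fun g => 'D_ex g) (derive_trig_wave_y c a b w m n l))
  (derive_trig_wave_x (c * b) a b w m n.+1 l).
Qed.

Lemma derive_trig_wave_tt c a b w m n l :
  'D_et ('D_et (trig_wave c a b w m n l)) = trig_wave (c * w * w) a b w m n l.+2.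
Proof.
exact: etrans (congr1 (fun g => 'D_et g) (derive_trig_wave_t c a b w m n l))
  (derive_trig_wave_t (c * w) a b w m n l.+1).
Qed.

Lemma trig_wave_laplacian c a b w m n l (k : R) (p : spacetime) : a ^+ 2 + b ^+ 2 = k ^+ 2 ->
  'D_ex ('D_ex (trig_wave c a b w m n l)) p + 'D_ey ('D_ey (trig_wave c a b w m n l)) p =
  - k ^+ 2 * trig_wave c a b w m n l p.
Proof.
move=> abk; have alg (x y x' y' : R) : x = x' -> y = y' -> x + y = x' + y' by move=> -> ->.
apply: etrans (alg _ _ _ _ (congr1 (fun g => g p) (derive_trig_wave_xx c a b w m n l))
  (congr1 (fun g => g p) (derive_trig_wave_yy c a b w m n l))) _.
rewrite !trig_waveE -abk !cosnSS.
by move: (cosn m _) (cosn n _) (cosn l _) => x y z; ring.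
Qed.

Lemma trig_wave_dtt c a b w m n l (p : spacetime) :
  'D_et ('D_et (trig_wave c a b w m n l)) p = - w ^+ 2 * trig_wave c a b w m n l p.
Proof.
apply: etrans (congr1 (fun g => g p) (derive_trig_wave_tt c a b w m n l)) _.
rewrite !trig_waveE !cosnSS.
by move: (cosn m _) (cosn n _) (cosn l _) => x y z; ring.
Qed.

(** Each partial derivative is again a [trig_wave], its amplitude multiplied by one
    of the three frequencies. *)
Lemma iter_derive_trig_wave c a b w m n l K (vs : seq spacetime) (p : spacetime) :
  `|a| <= K -> `|b| <= K -> `|w| <= K -> 1 <= K ->
  (forall v, v \in vs -> v \in [:: ex; ey; et]) ->
  `|iter_derive vs (trig_wave c a b w m n l) p| <= `|c| * K ^+ size vs.
Proof.
move=> aK bK wK K1 vsE.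
suff : exists c' m' n' l', iter_derive vs (trig_wave c a b w m n l) = trig_wave c' a b w m' n' l' /\
    `|c'| <= `|c| * K ^+ size vs.
  move=> [c' [m' [n' [l' [-> c'le]]]]]; apply: le_trans c'le.
  rewrite trig_waveE normrM ler_piMr// normrM mulr_ile1 ?normr_ge0 ?cosn_le1//.
  by rewrite normrM mulr_ile1 ?normr_ge0 ?cosn_le1.
elim: vs vsE => [_|v vs IH vsE] /=.
  by exists c, m, n, l; rewrite expr0 mulr1.
have [|c' [m' [n' [l' [-> c'le]]]]] := IH.
  by move=> u uvs; apply: vsE; rewrite inE uvs orbT.
have bnd (x : R) : `|x| <= K -> `|c' * x| <= `|c| * K ^+ (size vs).+1.
  by move=> xK; rewrite normrM exprSr mulrA ler_pM.
have := vsE v (mem_head _ _); rewrite !inE => /or3P[] /eqP ->.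
- by exists (c' * a), m'.+1, n', l'; split; [exact: derive_trig_wave_x|exact: bnd].
- by exists (c' * b), m', n'.+1, l'; split; [exact: derive_trig_wave_y|exact: bnd].
- by exists (c' * w), m', n', l'.+1; split; [exact: derive_trig_wave_t|exact: bnd].
Qed.

End TrigWaves.

(** * Jets of standing waves *)

Section Jets.
Context {R : realType}.
Local Notation spacetime := (R * R * R)%type.

(** Coordinates on the spatial 2-jets of solutions of the Helmholtz equation, which
    recovers the value of the function from the two pure second derivatives. At a
    zero these two are opposite. *)
Definition jet (i : 'I_5) (f : spacetime -> R) : spacetime -> R :=
  nth (fun=> 0) [:: 'D_ey ('D_ey f); 'D_ex f; 'D_ey f; 'D_ex ('D_ex f); 'D_ex ('D_ey f)] i.

Lemma ord5_ind (P : 'I_5 -> Prop) :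
  P (inord 0) -> P (inord 1) -> P (inord 2) -> P (inord 3) -> P (inord 4) -> forall i, P i.
Proof.
move=> p0 p1 p2 p3 p4 i; rewrite -(inord_val i).
by case: i => -[|[|[|[|[|]]]]].
Qed.

Lemma jetE f :
  [/\ jet (inord 0) f = 'D_ey ('D_ey f), jet (inord 1) f = 'D_ex f, jet (inord 2) f = 'D_ey f,
   jet (inord 3) f = 'D_ex ('D_ex f) & jet (inord 4) f = 'D_ex ('D_ey f)].
Proof. by rewrite /jet !inordK. Qed.

Lemma smooth_jet (U : set spacetime) i f : smooth_on U f -> smooth_on U (jet i f).
Proof.
move=> sf; have [e0 e1 e2 e3 e4] := jetE f.
by elim/ord5_ind: i; rewrite (e0, e1, e2, e3, e4); do ?exact: smooth_derive; exact/smooth_derive/smooth_derive.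
Qed.

Section Basis.
Variables (k w : R) (p0 : spacetime).
Hypothesis k0 : k != 0.

(** Cosines in [y] and in [x] carry the pure second derivatives, sines the first
    derivatives. The mixed derivative needs a wave vector with two nonzero
    components; [(3/5 k, 4/5 k)] is a rational choice of norm [k]. The amplitudes
    normalise the jets at [p0]. *)
Definition basis_wave (i : 'I_5) : spacetime -> R :=
  trig_wave p0
    (nth 0 [:: - (k ^+ 2)^-1; k^-1; k^-1; - (k ^+ 2)^-1; (3 / 5 * k * (4 / 5 * k))^-1] i)
    (nth 0 [:: 0; k; 0; k; 3 / 5 * k] i) (nth 0 [:: k; 0; k; 0; 4 / 5 * k] i) w
    (nth 0 [:: 0; 3; 0; 0; 3] i)%N (nth 0 [:: 0; 0; 3; 0; 3] i)%N 0.

Lemma basis_wave_number (i : 'I_5) :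
  (nth 0 [:: 0; k; 0; k; 3 / 5 * k] i) ^+ 2 + (nth 0 [:: k; 0; k; 0; 4 / 5 * k] i) ^+ 2 = k ^+ 2.
Proof. by elim/ord5_ind: i; rewrite inordK//=; field. Qed.

Lemma trig_wave_at_center c a b m n :
  trig_wave p0 c a b w m n 0 p0 = c * (cosn m 0 * cosn n 0).
Proof.
rewrite trig_waveE !subrr !mulr0.
by have [-> _] := @cosn_at0 R; rewrite mulr1.
Qed.

Lemma jet_trig_wave_center (i : 'I_5) c a b m n : jet i (trig_wave p0 c a b w m n 0) p0 =
  nth 0 [:: c * b * b * (cosn m 0 * cosn n.+2 0); c * a * (cosn m.+1 0 * cosn n 0);
    c * b * (cosn m 0 * cosn n.+1 0); c * a * a * (cosn m.+2 0 * cosn n 0);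
    c * b * a * (cosn m.+1 0 * cosn n.+1 0)] i.
Proof.
have [e0 e1 e2 e3 e4] := jetE (trig_wave p0 c a b w m n 0).
elim/ord5_ind: i; rewrite inordK//=.
- rewrite e0; apply: etrans (congr1 (fun g => g p0) (derive_trig_wave_yy p0 c a b w m n 0)) _.
  exact: trig_wave_at_center.
- rewrite e1; apply: etrans (congr1 (fun g => g p0) (derive_trig_wave_x p0 c a b w m n 0)) _.
  exact: trig_wave_at_center.
- rewrite e2; apply: etrans (congr1 (fun g => g p0) (derive_trig_wave_y p0 c a b w m n 0)) _.
  exact: trig_wave_at_center.
- rewrite e3; apply: etrans (congr1 (fun g => g p0) (derive_trig_wave_xx p0 c a b w m n 0)) _.
  exact: trig_wave_at_center.
- rewrite e4; apply: etrans (congr1 (fun g => g p0) (derive_trig_wave_xy p0 c a b w m n 0)) _.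
  exact: trig_wave_at_center.
Qed.

Lemma jet_basis_wave i j : jet i (basis_wave j) p0 = (i == j)%:R.
Proof.
have -> : (i == j) = ((i : nat) == j) by [].
rewrite jet_trig_wave_center.
have [C0 C1] := @cosn_at0 R.
by elim/ord5_ind: j; elim/ord5_ind: i; rewrite !inordK//=; do ?rewrite cosnSS; rewrite ?C0 ?C1; field.
Qed.

End Basis.
End Jets.

(** * Lipschitz estimates *)

Section Lipschitz.
Context {R : realType}.

Lemma smooth_lipschitz (V : normedModType R) (U : set V) (f : V -> R) p : framed V ->
  open U -> U p -> smooth_on U f ->
  exists r L : R, [/\ 0 < r, 0 <= L & forall x y, ball p r x -> ball p r y ->
    `|f y - f x| <= L * `|y - x|].
Proof.
move=> frV oU Up sf; have [r r0 [_ sd]] := strict_derivative frV oU Up sf ltr01.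
have df := smooth_differentiable sf Up.
have /linear_boundedP[M [Mr HM]] := (proj2 (linear_bounded_continuous ('d f p))) (diff_continuous df).
have bM v : `|'d f p v| <= (`|M| + 1) * `|v|.
  by apply: HM; rewrite (le_lt_trans (ler_norm _))// ltrDl.
exists r, (`|M| + 1 + 1); split; [exact: r0|by rewrite !addr_ge0|move=> x y px py].
have h1 := sd x y px py; rewrite deriveE// in h1.
have h2 := bM (y - x).
rewrite -[X in `|X|](subrK ('d f p (y - x))); apply: le_trans (ler_normD _ _) _.
by rewrite mulrDl addrC lerD.
Qed.

Lemma smooth_lipschitz_family (K : finType) (V : normedModType R) (U : set V)
    (f : K -> V -> R) p : framed V ->
  open U -> U p -> (forall k, smooth_on U (f k)) ->
  exists r L : R, [/\ 0 < r, 0 <= L & forall k x y, ball p r x -> ball p r y ->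
    `|f k y - f k x| <= L * `|y - x|].
Proof.
move=> frV oU Up sf.
have [r rP] := choice (fun k => smooth_lipschitz frV oU Up (sf k)).
have [L LP] := choice rP.
exists (\big[Num.min/1]_k r k), (\sum_k L k); split.
- by apply: lt_bigmin => // k _; have [] := LP k.
- by apply: sumr_ge0 => k _; have [] := LP k.
move=> k x y px py; have [rk Lk H] := LP k.
have sub : ball p (\big[Num.min/1]_k r k) `<=` ball p (r k) by apply: le_ball; exact: bigmin_le.
apply: le_trans (H x y (sub _ px) (sub _ py)) _; rewrite ler_wpM2r//.
by rewrite (bigD1 k)//= lerDl sumr_ge0// => l _; have [] := LP l.
Qed.

(** At an index where [`|D i|] is maximal, the difference to the identity matrix
    contributes at most half of this maximum. *)
Lemma near_identity_matrix (I : finType) (M : I -> I -> R) (D : I -> R) (B : R) :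
  (forall i l, `|M i l - (i == l)%:R| * #|I|%:R <= 2^-1) ->
  (forall i, `|\sum_l M i l * D l| <= B) -> forall i, `|D i| <= 2 * B.
Proof.
move=> MI MD i.
have [i0 _ i0P] := @arg_maxP _ _ I i predT (fun i => `|D i|) isT.
have I0 : 0 < #|I|%:R :> R by rewrite ltr0n; apply/card_gt0P; exists i.
apply: le_trans (i0P i isT) _.
have E : D i0 = \sum_l M i0 l * D l - \sum_l (M i0 l - (i0 == l)%:R) * D l.
  rewrite -sumrB (eq_bigr (fun l => (i0 == l)%:R * D l)); last by move=> l _; ring.
  rewrite (bigD1 i0)//= eqxx mul1r big1 ?addr0// => l; rewrite eq_sym => /negPf ->.
  by rewrite mul0r.
have S : `|\sum_l (M i0 l - (i0 == l)%:R) * D l| <= 2^-1 * `|D i0|.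
  apply: le_trans (ler_norm_sum _ _ _) _.
  have -> : 2^-1 * `|D i0| = \sum_(l : I) (2^-1 / #|I|%:R * `|D i0|).
    by rewrite sumr_const -[RHS]mulr_natr [RHS]mulrAC divfK// gt_eqF.
  apply: ler_sum => l _; rewrite normrM ler_pM//; first by rewrite ler_pdivlMr.
  exact: i0P.
have h : `|D i0| <= B + 2^-1 * `|D i0|.
  by rewrite {1}E; apply: le_trans (ler_normB _ _) _; rewrite lerD.
by move: h; move: (`|D i0|) => x h; lra.
Qed.

Lemma cos_lipschitz (x y : R) : `|cos x - cos y| <= `|x - y|.
Proof.
have dc (t : R) : differentiable cos t by apply/derivable1_diffP; exact: derivable_cos.
have [t _ ->] := @mean_value R R cos y x (fun t _ => dc _).
rewrite -[X in 'D_X _ _]mulr1 (deriveZv _ _ (dc _)) derive_val normrM normrN.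
by rewrite ler_piMr// sin_max.
Qed.

Lemma sin_lipschitz (x y : R) : `|sin x - sin y| <= `|x - y|.
Proof.
rewrite -!cosBpihalf; apply: le_trans (cos_lipschitz _ _) _.
by rewrite opprB addrA subrK.
Qed.

Section BoundedLipschitz.
Variables (J : finType) (C : R).
Hypothesis C0 : 0 <= C.
Implicit Types (f g : (J -> R) -> R) (z : J -> R).

Definition in_box z := forall j, `|z j| <= C.

(** The bound belongs to the notion because products of Lipschitz functions are
    Lipschitz only if the factors are bounded. *)
Definition lipschitz_on_box f := exists2 M : R, 0 <= M &
  (forall z, in_box z -> `|f z| <= M) /\
  (forall z z' e, in_box z -> in_box z' -> 0 <= e -> (forall j, `|z j - z' j| <= e) ->
     `|f z - f z'| <= M * e).

Lemma lip_cst c : lipschitz_on_box (fun=> c).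
Proof.
exists `|c| => //; split=> // z z' e _ _ e0 _.
by rewrite subrr normr0 mulr_ge0.
Qed.

Lemma lip_coord j : lipschitz_on_box (fun z => z j).
Proof.
exists (C + 1); first by rewrite addr_ge0.
split=> [z zC|z z' e _ _ e0 ze]; first by apply: le_trans (zC j) _; rewrite lerDl.
by apply: le_trans (ze j) _; rewrite mulrDl mul1r lerDr mulr_ge0.
Qed.

Lemma lip_cos j : lipschitz_on_box (fun z => cos (z j)).
Proof.
exists 1 => //; split=> [z zC|z z' e _ _ e0 ze]; first exact: cos_max.
by rewrite mul1r; apply: le_trans (cos_lipschitz _ _) _.
Qed.

Lemma lip_sin j : lipschitz_on_box (fun z => sin (z j)).
Proof.
exists 1 => //; split=> [z zC|z z' e _ _ e0 ze]; first exact: sin_max.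
by rewrite mul1r; apply: le_trans (sin_lipschitz _ _) _.
Qed.

Lemma lipD f g : lipschitz_on_box f -> lipschitz_on_box g ->
  lipschitz_on_box (fun z => f z + g z).
Proof.
move=> [M M0 [fM fL]] [N N0 [gM gL]]; exists (M + N); first by rewrite addr_ge0.
split=> [z zC|z z' e zC zC' e0 ze].
  by apply: le_trans (ler_normD _ _) _; rewrite lerD ?fM ?gM.
rewrite opprD addrACA mulrDl; apply: le_trans (ler_normD _ _) _.
by rewrite lerD ?fL ?gL.
Qed.

Lemma lipM f g : lipschitz_on_box f -> lipschitz_on_box g ->
  lipschitz_on_box (fun z => f z * g z).
Proof.
move=> [M M0 [fM fL]] [N N0 [gM gL]]; exists (M * N + M * N); first by rewrite addr_ge0// mulr_ge0.
split=> [z zC|z z' e zC zC' e0 ze].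
  rewrite normrM; apply: (@le_trans _ _ (M * N)); first by rewrite ler_pM ?fM ?gM.
  by rewrite lerDl mulr_ge0.
have -> : f z * g z - f z' * g z' = f z * (g z - g z') + (f z - f z') * g z' by ring.
apply: le_trans (ler_normD _ _) _; rewrite !normrM mulrDl lerD//.
  by rewrite -mulrA ler_pM ?fM ?gL.
by rewrite mulrAC ler_pM ?fL ?gM.
Qed.

Lemma lipN f : lipschitz_on_box f -> lipschitz_on_box (fun z => - f z).
Proof.
move=> [M M0 [fM fL]]; exists M => //; split=> [z zC|z z' e zC zC' e0 ze].
  by rewrite normrN fM.
by rewrite -opprD normrN fL.
Qed.

Lemma lip_common (K : finType) (f : K -> (J -> R) -> R) :
  (forall k, lipschitz_on_box (f k)) -> exists2 M : R, 0 <= M &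
  forall k z z' e, in_box z -> in_box z' -> 0 <= e -> (forall j, `|z j - z' j| <= e) ->
     `|f k z - f k z'| <= M * e.
Proof.
move=> lf.
have ex k : exists M, 0 <= M /\
    forall z z' e, in_box z -> in_box z' -> 0 <= e -> (forall j, `|z j - z' j| <= e) ->
     `|f k z - f k z'| <= M * e by have [M M0 [_ L]] := lf k; exists M.
have [M MP] := choice ex.
exists (\sum_k M k); first by apply: sumr_ge0 => k _; have [] := MP k.
move=> k z z' e zC zC' e0 ze; have [_ H] := MP k.
apply: le_trans (H z z' e zC zC' e0 ze) _; rewrite ler_wpM2r//.
by rewrite (bigD1 k)//= lerDl sumr_ge0// => l _; have [] := MP l.
Qed.

End BoundedLipschitz.
End Lipschitz.

(** * Degenerate 2-jets *)

Section DegenerateJets.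
Context {R : realType}.

(** The 2-jet at a zero with degenerate fold: [z 3] and [z 4] are the angles of the
    kernel and of the image of the derivative, [z 5] is the derivative across the
    kernel, [z 6] the second derivative along the kernel, which points along the
    image, and [z 7], [z 8] the mixed second derivative. *)
Definition fold_jet (j : bool) (i : 'I_5) (z : 'I_9 -> R) : R :=
  let co := cos (z (inord 3)) in
  let si := sin (z (inord 3)) in
  let m := if j then sin (z (inord 4)) else cos (z (inord 4)) in
  let a := z (inord 5) in
  let b := z (inord 6) in
  let c := if j then z (inord 8) else z (inord 7) in
  let h := b * m * (co * co + - (si * si)) + - (c * (2 * (co * si))) in
  nth 0 [:: - h; - (a * si * m); a * co * m; h;
    b * m * (2 * (co * si)) + c * (co * co + - (si * si))] i.

Lemma fold_jet_lipschitz (C : R) j i : 0 <= C -> lipschitz_on_box C (fold_jet j i).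
Proof.
move=> C0; pose lc := lip_coord (J := 'I_9) C0.
have Lco : lipschitz_on_box C (fun z : 'I_9 -> R => cos (z (inord 3))) by exact: lip_cos.
have Lsi : lipschitz_on_box C (fun z : 'I_9 -> R => sin (z (inord 3))) by exact: lip_sin.
have Lm : lipschitz_on_box C (fun z : 'I_9 -> R =>
    if j then sin (z (inord 4)) else cos (z (inord 4))).
  by case: (j); [exact: lip_sin|exact: lip_cos].
have Lc : lipschitz_on_box C (fun z : 'I_9 -> R => if j then z (inord 8) else z (inord 7)).
  by case: (j); exact: lc.
have La := lc (inord 5); have Lb := lc (inord 6).
have L2 := @lip_cst R 'I_9 C 2.
have LC := lipD (lipM Lco Lco) (lipN (lipM Lsi Lsi)).
have LS := lipM L2 (lipM Lco Lsi).
have Lbm := lipM Lb Lm.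
have Lh := lipD (lipM Lbm LC) (lipN (lipM Lc LS)).
rewrite /fold_jet; elim/ord5_ind: i; rewrite inordK//=.
- exact: lipN Lh.
- exact: lipN (lipM (lipM La Lsi) Lm).
- exact: lipM (lipM La Lco) Lm.
- exact: lipD (lipM Lbm LS) (lipM Lc LC).
Qed.

Section Dichotomy.
Variables (x1 y1 x2 y2 a1 b1 a2 b2 : R).

Let Q (co si a b : R) := (co ^+ 2 - si ^+ 2) * a + 2 * co * si * b.

Lemma kernel_angle : x1 * y2 - y1 * x2 = 0 ->
  exists2 t : R, `|t| <= pi & cos t * x1 + sin t * y1 = 0 /\ cos t * x2 + sin t * y2 = 0.
Proof.
move=> J0.
have [z1|nz1] := eqVneq ((- y1, x1) : R * R) 0.
  have [z2|nz2] := eqVneq ((- y2, x2) : R * R) 0.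
    exists 0; first by rewrite normr0 pi_ge0.
    case: z1 z2 => /eqP + -> [/eqP + ->]; rewrite !oppr_eq0 => /eqP -> /eqP ->.
    by rewrite !mulr0 addr0.
  have [r [t [r0 tpi [e1 e2]]]] := polar_exists nz2; exists t => //.
  case: z1 => /eqP + ->; rewrite oppr_eq0 => /eqP ->; rewrite !mulr0 addr0; split=> //.
  have -> : y2 = - (r * cos t) by rewrite -e1 opprK.
  by rewrite e2; ring.
have [r [t [r0 tpi [e1 e2]]]] := polar_exists nz1; exists t => //.
have y1E : y1 = - (r * cos t) by rewrite -e1 opprK.
split; first by rewrite y1E e2; ring.
apply: (mulfI (lt0r_neq0 r0)); rewrite mulr0 -J0 y1E e2; ring.
Qed.

(** Only one angle [u] is available for the derivative across the kernel and for the
    second derivative along it. It is taken from the former if that is nonzero,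
    and then the two vectors are either independent, which is the nondegenerate
    fold, or parallel; otherwise [u] is taken from the latter. *)
Lemma fold_dichotomy : x1 * y2 - y1 * x2 = 0 ->
  exists t u a : R, [/\ `|t| <= pi, `|u| <= pi,
    cos t * x1 + sin t * y1 = 0 /\ cos t * x2 + sin t * y2 = 0,
    - sin t * x1 + cos t * y1 = a * cos u /\ - sin t * x2 + cos t * y2 = a * sin u &
    (a != 0 /\ cos u * Q (cos t) (sin t) a2 b2 - sin u * Q (cos t) (sin t) a1 b1 != 0) \/
    exists b, Q (cos t) (sin t) a1 b1 = b * cos u /\ Q (cos t) (sin t) a2 b2 = b * sin u].
Proof.
move=> /kernel_angle[t tpi ker].
set T1 := - sin t * x1 + cos t * y1; set T2 := - sin t * x2 + cos t * y2.
set q1 := Q (cos t) (sin t) a1 b1; set q2 := Q (cos t) (sin t) a2 b2.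
have [T0|nT] := eqVneq ((T1, T2) : R * R) 0.
  case: T0 => T10 T20.
  have [q0|nq] := eqVneq ((q1, q2) : R * R) 0.
    exists t, 0, 0; rewrite normr0 pi_ge0 -/T1 -/T2 T10 T20 !mul0r; split=> //.
    by case: q0 => q10 q20; right; exists 0; rewrite -/q1 -/q2 q10 q20 !mul0r.
  have [r [u [r0 upi [e1 e2]]]] := polar_exists nq.
  exists t, u, 0; rewrite -/T1 -/T2 T10 T20 !mul0r; split=> //.
  by right; exists r.
have [r [u [r0 upi [e1 e2]]]] := polar_exists nT.
exists t, u, r; split=> //.
have [w0|w0] := eqVneq (cos u * q2 - sin u * q1) 0; last by left; rewrite gt_eqF.
right; rewrite -/q1 -/q2; exists (cos u * q1 + sin u * q2).
have cs := cos2Dsin2 u.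
have h : cos u * q2 = sin u * q1 by apply/eqP; rewrite -subr_eq0 w0.
split.
  have -> : (cos u * q1 + sin u * q2) * cos u = cos u ^+ 2 * q1 + sin u * (cos u * q2) by ring.
  by rewrite h mulrA -expr2 -mulrDl cs mul1r.
have -> : (cos u * q1 + sin u * q2) * sin u = cos u * (sin u * q1) + sin u ^+ 2 * q2 by ring.
by rewrite -h mulrA -expr2 -mulrDl cs mul1r.
Qed.

End Dichotomy.

(** A traceless Hessian is turned into its values along the kernel and on the mixed
    pair of directions by the rotation of angle [2 t], and recovered from them by
    the opposite rotation. *)
Lemma fold_jet_solve (z : 'I_9 -> R) (j : bool) (f : 'I_5 -> R) (t u a b : R) :
  z (inord 3) = t -> z (inord 4) = u -> z (inord 5) = a -> z (inord 6) = b ->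
  (if j then z (inord 8) else z (inord 7)) =
    - (2 * cos t * sin t) * f (inord 3) + (cos t ^+ 2 - sin t ^+ 2) * f (inord 4) ->
  let m := if j then sin u else cos u in
  f (inord 0) = - f (inord 3) ->
  cos t * f (inord 1) + sin t * f (inord 2) = 0 ->
  - sin t * f (inord 1) + cos t * f (inord 2) = a * m ->
  (cos t ^+ 2 - sin t ^+ 2) * f (inord 3) + 2 * cos t * sin t * f (inord 4) = b * m ->
  forall i, f i = fold_jet j i z.
Proof.
move=> e3 e4 e5 e6 e7 m f0 k k' q i; rewrite /fold_jet e3 e4 e5 e6 e7.
have cs := cos2Dsin2 t.
have cs2 : (cos t ^+ 2 - sin t ^+ 2) ^+ 2 + (2 * cos t * sin t) ^+ 2 = 1.
  have -> : (cos t ^+ 2 - sin t ^+ 2) ^+ 2 + (2 * cos t * sin t) ^+ 2 =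
    (cos t ^+ 2 + sin t ^+ 2) ^+ 2 by ring.
  by rewrite cs expr1n.
rewrite -/m; move: cs cs2 k k' q f0.
move: (cos t) (sin t) => c s cs cs2 k k' q f0.
have c2 : c * c = 1 - s * s by rewrite -cs; ring.
have h3 : b * m * (c * c + - (s * s)) +
    - ((- (2 * c * s) * f (inord 3) + (c ^+ 2 - s ^+ 2) * f (inord 4)) * (2 * (c * s))) = f (inord 3).
  transitivity (((c ^+ 2 - s ^+ 2) ^+ 2 + (2 * c * s) ^+ 2) * f (inord 3)).
    by rewrite -q; ring.
  by rewrite cs2 mul1r.
elim/ord5_ind: i; rewrite inordK//=.
- by rewrite h3.
- have -> : a * s * m = s * (a * m) by ring.
  rewrite -k'; apply/eqP; rewrite -subr_eq0; apply/eqP.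
  have -> : f (inord 1) - - (s * (- s * f (inord 1) + c * f (inord 2))) =
    (1 - s * s) * f (inord 1) + c * s * f (inord 2) by ring.
  rewrite -c2; have -> : c * c * f (inord 1) + c * s * f (inord 2) =
    c * (c * f (inord 1) + s * f (inord 2)) by ring.
  by rewrite k mulr0.
- have -> : a * c * m = c * (a * m) by ring.
  rewrite -k'; apply/eqP; rewrite -subr_eq0; apply/eqP.
  have -> : f (inord 2) - c * (- s * f (inord 1) + c * f (inord 2)) =
    (1 - c * c) * f (inord 2) + s * c * f (inord 1) by ring.
  have -> : 1 - c * c = s * s by rewrite c2; ring.
  have -> : s * s * f (inord 2) + s * c * f (inord 1) =
    s * (c * f (inord 1) + s * f (inord 2)) by ring.
  by rewrite k mulr0.
- transitivity (((c ^+ 2 - s ^+ 2) ^+ 2 + (2 * c * s) ^+ 2) * f (inord 4)).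
    by rewrite cs2 mul1r.
  by rewrite -q; ring.
Qed.

Lemma fold_parameter_bound (u q1 q2 b X : R) : 0 <= X ->
  q1 = b * cos u -> q2 = b * sin u -> `|q1| <= X -> `|q2| <= X -> `|b| <= 2 * X.
Proof.
move=> X0 e1 e2 h1 h2.
have -> : b = cos u * q1 + sin u * q2.
  by rewrite e1 e2 -[LHS]mulr1 -[X in _ * X](cos2Dsin2 u); ring.
apply: le_trans (ler_normD _ _) _; rewrite !normrM mulr_natl mulr2n lerD//.
  by apply: le_trans h1; rewrite ler_piMl// cos_max.
by apply: le_trans h2; rewrite ler_piMl// sin_max.
Qed.

Lemma rotation_bound (t x y X : R) : `|x| <= X -> `|y| <= X ->
  `|- sin t * x + cos t * y| <= 2 * X /\
  `|(cos t ^+ 2 - sin t ^+ 2) * x + 2 * cos t * sin t * y| <= 2 * X /\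
  `|- (2 * cos t * sin t) * x + (cos t ^+ 2 - sin t ^+ 2) * y| <= 2 * X.
Proof.
move=> hx hy; have X0 : 0 <= X by apply: le_trans hx.
have lin (p q : R) : `|p| <= 1 -> `|q| <= 1 -> `|p * x + q * y| <= 2 * X.
  move=> p1 q1; apply: le_trans (ler_normD _ _) _; rewrite !normrM mulr_natl mulr2n.
  by rewrite lerD//; [apply: le_trans hx|apply: le_trans hy]; rewrite ler_piMl.
have cs := cos2Dsin2 t.
have C2 : `|cos t ^+ 2 - sin t ^+ 2| <= 1.
  by rewrite ler_norml; have := sqr_ge0 (cos t); have := sqr_ge0 (sin t); move=> ? ?; apply/andP; split; lra.
have S2 : `|2 * cos t * sin t| <= 1.
  rewrite ler_norml; have h1 := sqr_ge0 (cos t + sin t); have h2 := sqr_ge0 (cos t - sin t).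
  by rewrite sqrrD in h1; rewrite sqrrB in h2; apply/andP; split; lra.
by split; [|split]; apply: lin; rewrite ?normrN ?sin_max ?cos_max.
Qed.

(** [F j i] stands for the [i]-th jet coordinate of the [j]-th component: the
    direction of angle [t] lies in the kernel of the derivative, the image of the
    derivative lies in the direction of angle [u], and so does the second
    derivative along the kernel. *)
Definition degenerate_zero (F : bool -> 'I_5 -> R) : Prop :=
  exists t u a b : R, [/\ `|t| <= pi, `|u| <= pi &
    forall j, let m := if j then sin u else cos u in
    [/\ F j (inord 0) = - F j (inord 3),
        cos t * F j (inord 1) + sin t * F j (inord 2) = 0,
        - sin t * F j (inord 1) + cos t * F j (inord 2) = a * m &
        (cos t ^+ 2 - sin t ^+ 2) * F j (inord 3) + 2 * cos t * sin t * F j (inord 4) = b * m]].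

(** The pigeonhole argument requires all nine parameters to stay in a box; the
    orthogonality of the rotations bounds them by the size of the jets. *)
Lemma degenerate_zero_witness (F : bool -> 'I_5 -> R) (X x y z : R) :
  (forall j i, `|F j i| <= X) -> degenerate_zero F ->
  exists w : 'I_9 -> R, [/\ w (inord 0) = x /\ w (inord 1) = y /\ w (inord 2) = z,
    in_box (`|x| + `|y| + `|z| + pi + 4 * X) w & forall j i, F j i = fold_jet j i w].
Proof.
move=> FX [t [u [a [b [tpi upi E]]]]].
have X0 : 0 <= X by apply: le_trans (FX true (inord 0)).
have pi0 := pi_ge0 R.
pose mixed j := - (2 * cos t * sin t) * F j (inord 3) + (cos t ^+ 2 - sin t ^+ 2) * F j (inord 4).
pose w (i : 'I_9) := nth 0 [:: x; y; z; t; u; a; b; mixed false; mixed true] i.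
have [_ _ k1 q1] := E false; have [_ _ k2 q2] := E true.
have rot j := rotation_bound t (FX j (inord 1)) (FX j (inord 2)).
have rot2 j := rotation_bound t (FX j (inord 3)) (FX j (inord 4)).
have X2 : 0 <= 2 * X by rewrite mulr_ge0.
have four : 2 * (2 * X) = 4 * X by ring.
have aX : `|a| <= 4 * X.
  rewrite -four; apply: (fold_parameter_bound X2 k1 k2); first by have [] := rot false.
  by have [] := rot true.
have bX : `|b| <= 4 * X.
  rewrite -four; apply: (fold_parameter_bound X2 q1 q2).
    by have [_ []] := rot2 false.
  by have [_ []] := rot2 true.
have mX j : `|mixed j| <= 4 * X.
  by have [_ [_ h]] := rot2 j; apply: le_trans h _; lra.
exists w; split; first by rewrite /w !inordK.
  have := (normr_ge0 x, normr_ge0 y, normr_ge0 z) => -[[nx ny] nz].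
  have m0 := mX false; have m1 := mX true.
  by case=> -[|[|[|[|[|[|[|[|[|]]]]]]]]] lt9; rewrite ?ltnS// /w /=; lra.
move=> j i; have [e0 e1 e2 e3] := E j.
have w3 : w (inord 3) = t by rewrite /w inordK.
have w4 : w (inord 4) = u by rewrite /w inordK.
have w5 : w (inord 5) = a by rewrite /w inordK.
have w6 : w (inord 6) = b by rewrite /w inordK.
have w7 : (if j then w (inord 8) else w (inord 7)) = mixed j by case: (j); rewrite /w inordK.
exact: (fold_jet_solve w3 w4 w5 w6 w7 e0 e1 e2 e3).
Qed.

End DegenerateJets.

(** * Trichotomy at a zero *)

Section Slices.
Context {R : realType}.
Local Notation plane := (R * R)%type.
Local Notation spacetime := (R * R * R)%type.
Local Notation d1 f := ('D_dir1 f).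
Local Notation d2 f := ('D_dir2 f).

Lemma exE : (dir1, 0) = ex :> spacetime. Proof. by []. Qed.
Lemma eyE : (dir2, 0) = ey :> spacetime. Proof. by []. Qed.

Lemma normalizing_sign (w : R) : w != 0 -> exists2 s : R, s * s = 1 & 0 < s * w.
Proof.
case: ltrgt0P => // w0 _.
  by exists 1; rewrite !mul1r.
by exists (-1); rewrite ?mulrNN ?mul1r// mulN1r oppr_gt0.
Qed.

#[local] Opaque derive dir1 dir2 ex ey et.

Definition slice (t : R) (z : plane) : spacetime := (z, t).

Lemma smooth_slice t (U : set plane) : open U -> smooth_on U (slice t).
Proof. by move=> oU; exact: smooth_pair oU (smooth_id U) (smooth_cst U t). Qed.

Lemma derive_slice t z v : 'D_v (slice t) z = (v, 0).
Proof.
have ds := smooth_differentiable (smooth_slice t openT) (I : setT z).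
apply: injective_projections.
  by apply: etrans (esym (derive_fst v ds)) _; exact: derive_id.
by apply: etrans (esym (derive_snd v ds)) _; exact: derive_cst.
Qed.

Lemma derive_slice_comp (h : spacetime -> R) t z v : differentiable h (slice t z) ->
  'D_v (fun z => h (slice t z)) z = 'D_((v, 0) : spacetime) h (slice t z).
Proof.
move=> dh; have ds := smooth_differentiable (smooth_slice t openT) (I : setT z).
by rewrite -(derive_slice t z v); exact: (derive_comp v ds dh).
Qed.

Section OnSlice.
Variables (V : set spacetime) (q : spacetime).
Hypotheses (oV : open V) (Vq : V q).
Let W : set plane := setT `&` slice q.2 @^-1` V.

Lemma slice_open : open W.
Proof. exact: (open_preimage_on openT oV (smooth_slice q.2 openT)). Qed.

Lemma slice_center : slice q.2 q.1 = q.
Proof. by rewrite /slice -surjective_pairing. Qed.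

Lemma slice_mem : W q.1.
Proof. by split; [exact: I|]; change (V (slice q.2 q.1)); rewrite slice_center. Qed.

Lemma slice_smooth (f : spacetime -> plane) : smooth_on V f -> smooth_on W (fun z => f (slice q.2 z)).
Proof.
move=> sf; have sW : forall z, W z -> V (slice q.2 z) by move=> z [].
exact: (smooth_comp2 framed_spacetime slice_open oV sW (smooth_slice q.2 slice_open) sf).
Qed.

Let slice_derive (h : spacetime -> R) z v : smooth_on V h -> W z ->
  'D_v (fun z => h (slice q.2 z)) z = 'D_((v, 0) : spacetime) h (slice q.2 z).
Proof.
move=> sh [_ Vz]; apply: derive_slice_comp.
exact: (smooth_differentiable sh Vz).
Qed.

Lemma slice_d1 (h : spacetime -> R) : smooth_on V h -> d1 (fun z => h (slice q.2 z)) q.1 = 'D_ex h q.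
Proof. by move=> sh; apply: etrans (slice_derive dir1 sh slice_mem) _; rewrite slice_center exE. Qed.

Lemma slice_d2 (h : spacetime -> R) : smooth_on V h -> d2 (fun z => h (slice q.2 z)) q.1 = 'D_ey h q.
Proof. by move=> sh; apply: etrans (slice_derive dir2 sh slice_mem) _; rewrite slice_center eyE. Qed.

Lemma slice_d11 (h : spacetime -> R) : smooth_on V h -> d1 (d1 (fun z => h (slice q.2 z))) q.1 = 'D_ex ('D_ex h) q.
Proof.
move=> sh; apply: etrans (slice_d1 (smooth_derive ex sh)).
apply: (derive_eq_on _ slice_open slice_mem) => z Wz.
by rewrite -exE; exact: slice_derive.
Qed.

Lemma slice_d12 (h : spacetime -> R) : smooth_on V h -> d1 (d2 (fun z => h (slice q.2 z))) q.1 = 'D_ex ('D_ey h) q.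
Proof.
move=> sh; apply: etrans (slice_d1 (smooth_derive ey sh)).
apply: (derive_eq_on _ slice_open slice_mem) => z Wz.
by rewrite -eyE; exact: slice_derive.
Qed.

Lemma slice_d22 (h : spacetime -> R) : smooth_on V h -> d2 (d2 (fun z => h (slice q.2 z))) q.1 = 'D_ey ('D_ey h) q.
Proof.
move=> sh; apply: etrans (slice_d2 (smooth_derive ey sh)).
apply: (derive_eq_on _ slice_open slice_mem) => z Wz.
by rewrite -eyE; exact: slice_derive.
Qed.

Definition component (j : bool) (x : plane) : R := if j then x.2 else x.1.

Lemma smooth_component (f : spacetime -> plane) j : smooth_on V f ->
  smooth_on V (fun p => component j (f p)).
Proof. by case: j => sf; [exact: smooth_snd|exact: smooth_fst]. Qed.

Variable Phi : spacetime -> plane.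
Hypotheses (sPhi : smooth_on V Phi) (Phi0 : Phi q = 0).
Let h (j : bool) p := component j (Phi p).
Hypothesis traceless : forall j, jet (inord 0) (h j) q = - jet (inord 3) (h j) q.

(** The hypothesis [traceless] is the Helmholtz equation at a zero. If the spatial
    derivative is singular, [fold_dichotomy] supplies the angles with which
    [fold_equivalence] is applied. *)
Lemma zero_trichotomy :
  (radially_equivalent Phi q regular_singularity \/
   radially_equivalent Phi q hyperbolic_singularity) \/
  degenerate_zero (fun j i => jet i (h j) q).
Proof.
have sf := slice_smooth sPhi.
have sh j := smooth_component j sPhi.
have [e10 e11 e12 e13 e14] := jetE (h false); have [e20 e21 e22 e23 e24] := jetE (h true).
have t1 := traceless false; have t2 := traceless true.
have X1 := slice_d1 (sh false); have Y1 := slice_d2 (sh false).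
have X2 := slice_d1 (sh true); have Y2 := slice_d2 (sh true).
have A1 := slice_d11 (sh false); have B1 := slice_d12 (sh false); have C1 := slice_d22 (sh false).
have A2 := slice_d11 (sh true); have B2 := slice_d12 (sh true); have C2 := slice_d22 (sh true).
rewrite e10 e13 in t1; rewrite e20 e23 in t2; rewrite t1 in C1; rewrite t2 in C2.
pose x1 := 'D_ex (h false) q; pose y1 := 'D_ey (h false) q.
pose x2 := 'D_ex (h true) q; pose y2 := 'D_ey (h true) q.
pose a1 := 'D_ex ('D_ex (h false)) q; pose b1 := 'D_ex ('D_ey (h false)) q.
pose a2 := 'D_ex ('D_ex (h true)) q; pose b2 := 'D_ex ('D_ey (h true)) q.
have [J0|J0] := eqVneq (x1 * y2 - y1 * x2) 0; last first.
  left; left; apply: (regular_equivalence slice_open slice_mem sf Phi0).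
  have ds := smooth_differentiable sf slice_mem.
  have alg (p p' r r' : R) : p = x1 -> p' = y1 -> r = x2 -> r' = y2 -> p * r' - p' * r != 0.
    by move=> -> -> -> ->.
  exact: alg (etrans (esym (derive_fst dir1 ds)) X1) (etrans (esym (derive_fst dir2 ds)) Y1)
    (etrans (esym (derive_snd dir1 ds)) X2) (etrans (esym (derive_snd dir2 ds)) Y2).
have [t [u [a [tpi upi [k1 k2] [l1 l2] alt]]]] := fold_dichotomy a1 b1 a2 b2 J0.
case: alt => [[a0 nd]|[b [q1 q2]]]; last first.
  right; exists t, u, a, b; split; [exact: tpi|exact: upi|].
  case.
    by split; [exact: traceless|rewrite e21 e22|rewrite e21 e22|rewrite e23 e24].
  by split; [exact: traceless|rewrite e11 e12|rewrite e11 e12|rewrite e13 e14].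
left; right.
have [s ss sw] := normalizing_sign nd.
exact: (fold_equivalence slice_open slice_mem sf Phi0 (cos2Dsin2 t) (cos2Dsin2 u)
  X1 Y1 X2 Y2 A1 B1 C1 A2 B2 C2 a0 ss k1 k2 l1 l2 sw).
Qed.

End OnSlice.
End Slices.

(** * Perturbation by standing waves *)

Section IteratedDerivatives.
Context {R : realType} {V : normedModType R}.
Variable U : set V.
Hypothesis oU : open U.
Implicit Types (f g : V -> R) (vs : seq V).

Lemma smooth_iter_derive (W : normedModType R) vs (f : V -> W) :
  smooth_on U f -> smooth_on U (iter_derive vs f).
Proof. by move=> sf; elim: vs => [|v vs IH] //=; exact: smooth_derive. Qed.

Lemma iter_derive_affine vs f g a p : smooth_on U f -> smooth_on U g -> U p ->
  iter_derive vs (fun q => a * f q + g q) p = a * iter_derive vs f p + iter_derive vs g p.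
Proof.
move=> sf sg; elim: vs p => [|v vs IH] p Up //=.
have df := smooth_differentiable (smooth_iter_derive vs sf) Up.
have dg := smooth_differentiable (smooth_iter_derive vs sg) Up.
apply: etrans (derive_eq_on v oU Up IH) _.
have dc := differentiable_cst a p.
apply: etrans (derive_add v (diff_mul dc df) dg) _; congr (_ + _).
apply: etrans (derive_mul v dc df) _.
have alg (x y z t : R) : x = 0 -> x * y + z * t = z * t by move=> ->; rewrite mul0r add0r.
exact: alg (derive_cst _ _ _).
Qed.

Lemma iter_derive_superpose (I : Type) (r : seq I) (s : I -> R) (f : I -> V -> R) g vs p :
  (forall i, smooth_on U (f i)) -> smooth_on U g -> U p ->
  iter_derive vs (fun q => g q + \sum_(i <- r) s i * f i q) p =
  iter_derive vs g p + \sum_(i <- r) s i * iter_derive vs (f i) p.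
Proof.
move=> sf sg Up; elim: r => [|i r IH].
  have e : (fun q => g q + \sum_(i <- [::]) s i * f i q) = g.
    by apply/funext => q; rewrite big_nil addr0.
  by rewrite e big_nil addr0.
have e : (fun q => g q + \sum_(j <- i :: r) s j * f j q) =
    (fun q => s i * f i q + (g q + \sum_(j <- r) s j * f j q)).
  by apply/funext => q; rewrite big_cons addrCA.
have sS : smooth_on U (fun q => g q + \sum_(j <- r) s j * f j q).
  apply: (smoothD oU sg); apply: (smooth_sum r oU) => j.
  exact: (smoothMl (s j) oU (sf j)).
rewrite e big_cons; apply: etrans (iter_derive_affine vs (s i) (sf i) sS Up) _.
by rewrite IH addrCA.
Qed.

Lemma iter_derive_component vs (f : V -> R * R) j p : smooth_on U f -> U p ->
  iter_derive vs (fun q => component j (f q)) p = component j (iter_derive vs f p).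
Proof.
move=> sf; elim: vs p => [|v vs IH] p Up //=.
have df := smooth_differentiable (smooth_iter_derive vs sf) Up.
apply: etrans (derive_eq_on v oU Up IH) _.
by case: j {IH}; [exact: derive_snd|exact: derive_fst].
Qed.

End IteratedDerivatives.

Section Superposition.
Context {R : realType}.
Local Notation plane := (R * R)%type.
Local Notation spacetime := (R * R * R)%type.

Lemma eq_component (x y : plane) : (forall j, component j x = component j y) -> x = y.
Proof. by move=> e; apply: injective_projections; [exact: (e false)|exact: (e true)]. Qed.

Lemma component_norm_lt (x : plane) (e : R) : (forall j, `|component j x| < e) -> `|x| < e.
Proof. by move=> h; rewrite prod_normE gt_max (h false) (h true). Qed.

Definition jet_directions (i : 'I_5) : seq spacetime :=
  nth [::] [:: [:: ey; ey]; [:: ex]; [:: ey]; [:: ex; ex]; [:: ex; ey]] i.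

Lemma jet_iter_derive i (f : spacetime -> R) : jet i f = iter_derive (jet_directions i) f.
Proof. by rewrite /jet_directions /jet; elim/ord5_ind: i; rewrite inordK. Qed.

#[local] Opaque derive ex ey et.

Definition scalar_helmholtz (k w : R) (U : set spacetime) (h : spacetime -> R) : Prop :=
  forall p, U p ->
    iter_derive [:: ex; ex] h p + iter_derive [:: ey; ey] h p = - k ^+ 2 * h p /\
    iter_derive [:: et; et] h p = - w ^+ 2 * h p.

Lemma helmholtz_wave_components k c (U : set spacetime) (f : spacetime -> plane) : open U ->
  smooth_on U f -> helmholtz_wave k c U f <->
  forall j, scalar_helmholtz k (c * k) U (fun p => component j (f p)).
Proof.
move=> oU sf.
have it vs j p (Up : U p) := iter_derive_component oU vs j sf Up.
have lapE j p : component j (laplacian f p) =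
    component j (iter_derive [:: ex; ex] f p) + component j (iter_derive [:: ey; ey] f p).
  by case: j.
have cZ j (a : R) x : component j (a *: x) = a * component j x by case: j.
have cD j x y : component j (x + y) = component j x + component j y by case: j.
have c0 j : component j 0 = 0 :> R by case: j.
split=> [[_ E1 E2] j p Up|E].
  rewrite (it [:: ex; ex] j p Up) (it [:: ey; ey] j p Up) (it [:: et; et] j p Up).
  have e1 := congr1 (component j) (E1 p Up); have e2 := congr1 (component j) (E2 p Up).
  rewrite cD cZ c0 in e1; rewrite cZ in e2; rewrite -lapE.
  have e3 : component j (laplacian f p) = - k ^+ 2 * component j (f p).
    by apply/eqP; rewrite mulNr -addr_eq0; apply/eqP.
  by split=> //; apply: etrans e2 _; rewrite e3 exprMn !mulNr mulrN mulrA.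
have lapc j p : U p -> component j (laplacian f p) = - k ^+ 2 * component j (f p).
  move=> Up; have [h _] := E j p Up.
  apply: etrans (lapE j p) (etrans _ h).
  exact: (congr2 +%R (esym (it [:: ex; ex] j p Up)) (esym (it [:: ey; ey] j p Up))).
split=> // p Up; apply: eq_component => j.
  by rewrite cD cZ c0 lapc// mulNr addNr.
rewrite cZ lapc//; have [_ h] := E j p Up.
apply: etrans (etrans (esym (it [:: et; et] j p Up)) h) _.
by rewrite exprMn !mulNr mulrN mulrA.
Qed.

Lemma basis_wave_helmholtz (k w : R) p0 i : scalar_helmholtz k w setT (basis_wave k w p0 i).
Proof.
move=> p _; split; last exact: trig_wave_dtt.
exact: trig_wave_laplacian (basis_wave_number k i).
Qed.

Lemma smooth_basis_wave (k w : R) p0 i (U : set spacetime) : smooth_on U (basis_wave k w p0 i).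
Proof. by apply: (@smooth_sub R _ _ setT) => //; exact: smooth_trig_wave. Qed.

Section Perturbation.
Variables (k c : R) (U : set spacetime) (Psi : spacetime -> plane) (p0 : spacetime).
Hypotheses (oU : open U) (sPsi : smooth_on U Psi).
Let B i := basis_wave k (c * k) p0 i.

Definition perturbed (s : bool * 'I_5 -> R) (p : spacetime) : plane :=
  ((Psi p).1 + \sum_i s (false, i) * B i p, (Psi p).2 + \sum_i s (true, i) * B i p).

Lemma component_perturbed s j p :
  component j (perturbed s p) = component j (Psi p) + \sum_i s (j, i) * B i p.
Proof. by case: j. Qed.

Lemma smooth_perturbed s : smooth_on U (perturbed s).
Proof.
have sB j : smooth_on U (fun p => \sum_i s (j, i) * B i p).
  by apply: (smooth_sum _ oU) => i; apply: (smoothMl _ oU); exact: smooth_basis_wave.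
by apply: (smooth_pair oU); apply: (smoothD oU) => //; [exact: smooth_fst|exact: smooth_snd].
Qed.

Lemma iter_derive_perturbed s j vs p : U p ->
  iter_derive vs (fun q => component j (perturbed s q)) p =
  iter_derive vs (fun q => component j (Psi q)) p + \sum_i s (j, i) * iter_derive vs (B i) p.
Proof.
move=> Up; have -> : (fun q => component j (perturbed s q)) =
  (fun q => component j (Psi q) + \sum_i s (j, i) * B i q).
  by apply/funext => q; exact: component_perturbed.
apply: (iter_derive_superpose oU) => //; last exact: smooth_component.
by move=> i; exact: smooth_basis_wave.
Qed.

Lemma perturbed_helmholtz s : helmholtz_wave k c U Psi -> helmholtz_wave k c U (perturbed s).
Proof.
move=> /(helmholtz_wave_components k c oU sPsi) HPsi.
apply/(helmholtz_wave_components k c oU (smooth_perturbed s)) => j p Up.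
have [h1 h2] := HPsi j p Up.
have hB i := basis_wave_helmholtz k (c * k) p0 i (I : setT p).
have P vs := iter_derive_perturbed s j vs Up.
have alg (a a' b b' h T m : R) : a + b = m * h -> a' + b' = m * T ->
    (a + a') + (b + b') = m * (h + T) by move=> e e'; rewrite addrACA e e' mulrDr.
have alg' (a a' h T m : R) : a = m * h -> a' = m * T -> a + a' = m * (h + T).
  by move=> -> ->; rewrite mulrDr.
have sumE (F G : 'I_5 -> R) m : (forall i, F i = m * G i) ->
    \sum_i s (j, i) * F i = m * \sum_i s (j, i) * G i.
  by move=> FG; rewrite mulr_sumr; apply: eq_bigr => i _; rewrite FG mulrCA.
have cP := component_perturbed s j p.
split.
  apply: etrans (congr2 +%R (P [:: ex; ex]) (P [:: ey; ey])) _.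
  rewrite cP; apply: alg h1 _; rewrite -big_split /=.
  rewrite -(sumE (fun i => iter_derive [:: ex; ex] (B i) p + iter_derive [:: ey; ey] (B i) p)).
    by apply: eq_bigr => i _; rewrite mulrDr.
  by move=> i; have [] := hB i.
apply: etrans (P [:: et; et]) _.
by rewrite cP; apply: alg' h2 _; apply: sumE => i; have [] := hB i.
Qed.

Lemma basis_wave_bound (N : nat) : exists2 A : R, 0 <= A & forall i vs p, (size vs <= N)%N ->
  (forall v, v \in vs -> v \in [:: ex; ey; et]) -> `|iter_derive vs (B i) p| <= A.
Proof.
pose K := 1 + `|k| + `|c * k|.
have K1 : 1 <= K by rewrite /K -addrA lerDl addr_ge0.
have kK : `|k| <= K by rewrite /K addrAC lerDr addr_ge0.
have wK : `|c * k| <= K by rewrite /K lerDr addr_ge0.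
have K0 : `|0 : R| <= K by rewrite normr0; apply: le_trans K1.
have fK (t : R) : 0 <= t <= 1 -> `|t * k| <= K.
  move=> /andP[t0 t1]; rewrite normrM; apply: le_trans kK; rewrite ler_piMl//.
  by rewrite ger0_norm.
have k3 : `|3 / 5 * k| <= K by apply: fK; lra.
have k4 : `|4 / 5 * k| <= K by apply: fK; lra.
pose amp (i : 'I_5) :=
  nth 0 [:: - (k ^+ 2)^-1; k^-1; k^-1; - (k ^+ 2)^-1; (3 / 5 * k * (4 / 5 * k))^-1] i.
exists (\sum_i `|amp i| * K ^+ N); first by apply: sumr_ge0 => i _; rewrite mulr_ge0// exprn_ge0// (le_trans _ K1).
move=> i vs p sz vsE; rewrite (bigD1 i)//= ler_wpDr//.
  by apply: sumr_ge0 => l _; rewrite mulr_ge0// exprn_ge0// (le_trans _ K1).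
apply: (@le_trans _ _ (`|amp i| * K ^+ size vs)); last first.
  by rewrite ler_wpM2l// ler_weXn2l.
apply: iter_derive_trig_wave => //.
  by elim/ord5_ind: i; rewrite inordK.
by elim/ord5_ind: i; rewrite inordK.
Qed.

Lemma perturbed_close (N : nat) (e : R) : 0 < e -> exists2 d : R, 0 < d <= 1 &
  forall s (K : set spacetime), (forall i, 0 <= s i <= d) -> K `<=` U ->
    Cinfty_close K N e Psi (perturbed s).
Proof.
move=> e0; have [A A0 bA] := basis_wave_bound N.
have A1 : 0 < 5 * A + 1 by lra.
have q0 : 0 < e / (5 * A + 1) by rewrite divr_gt0.
(* Each component receives five waves, with derivatives bounded by [A]. *)
exists (Num.min 1 (e / (5 * A + 1))); first by rewrite lt_min ltr01 q0 ge_min lexx.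
move=> s K sd KU vs sz vsE p Kp; have Up := KU p Kp.
apply: component_norm_lt => j.
have cB (x y : plane) : component j (x - y) = component j x - component j y by case: (j).
rewrite cB -(iter_derive_component oU vs j (smooth_perturbed s) Up).
rewrite -(iter_derive_component oU vs j sPsi Up) iter_derive_perturbed// addrAC subrr add0r.
apply: le_lt_trans (ler_norm_sum _ _ _) _.
apply: (@le_lt_trans _ _ (\sum_(i : 'I_5) e / (5 * A + 1) * A)).
  apply: ler_sum => i _; rewrite normrM ler_pM ?bA//.
  have /andP[s0 s1] := sd (j, i); rewrite ger0_norm//.
  by apply: le_trans s1 _; rewrite ge_min lexx orbT.
rewrite sumr_const card_ord.
have -> : (e / (5 * A + 1) * A) *+ 5 = e * (5 * A / (5 * A + 1)) by ring.
by rewrite -[ltRHS]mulr1 ltr_pM2l// ltr_pdivrMr// mul1r ltrDl.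
Qed.

End Perturbation.
End Superposition.

(** * Avoiding degenerate zeros *)

Section Avoidance.
Context {R : realType}.
Local Notation plane := (R * R)%type.
Local Notation spacetime := (R * R * R)%type.

#[local] Opaque derive ex ey et.

Lemma spacetime_norm_le (p : spacetime) (e : R) :
  `|p.1.1| <= e -> `|p.1.2| <= e -> `|p.2| <= e -> `|p| <= e.
Proof. by move=> h1 h2 h3; rewrite !prod_normE /= !ge_max h1 h2 h3. Qed.

Lemma coordinates_norm_le (p : spacetime) :
  [/\ `|p.1.1| <= `|p|, `|p.1.2| <= `|p| & `|p.2| <= `|p|].
Proof. by rewrite !prod_normE /= !le_max !lexx !orbT. Qed.

Section Perturbations.
Variables (k w : R) (U : set spacetime) (p0 : spacetime) (H : bool -> spacetime -> R).
Hypotheses (k0 : k != 0) (oU : open U) (Up0 : U p0) (sH : forall j, smooth_on U (H j)).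
Let M (q : spacetime) i l := jet i (basis_wave k w p0 l) q.

Let perturbed_jet (s : bool * 'I_5 -> R) q (j : bool) i :=
  jet i (H j) q + \sum_l s (j, l) * M q i l.

(** The bound [10^-1] makes the 5 x 5 matrices [M q] fit for [near_identity_matrix],
    since [5 * 10^-1 = 2^-1]. *)
Let uniform_ball : exists r L : R, [/\ 0 < r <= 1, 0 <= L, ball p0 r `<=` U,
  (forall q i l, ball p0 r q -> `|M q i l - (i == l)%:R| <= 10^-1) &
  forall x y, ball p0 r x -> ball p0 r y ->
    (forall j i, `|jet i (H j) y - jet i (H j) x| <= L * `|y - x|) /\
    forall i l, `|M y i l - M x i l| <= L * `|y - x|].
Proof.
have [r1 [L1 [r10 L10 P1]]] := @smooth_lipschitz_family R (bool * 'I_5)%type spacetime U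
  (fun a => jet a.2 (H a.1)) p0 framed_spacetime oU Up0 (fun a => smooth_jet a.2 (sH a.1)).
have [r2 [L2 [r20 L20 P2]]] := @smooth_lipschitz_family R ('I_5 * 'I_5)%type spacetime setT
  (fun a => jet a.1 (basis_wave k w p0 a.2)) p0 framed_spacetime openT I
  (fun a => smooth_jet a.1 (smooth_basis_wave k w p0 a.2 setT)).
have /nbhs_ballP[r3 /= r30 r3U] : nbhs p0 U by apply: open_nbhs_nbhs; split.
have L21 : 0 < 10 * (L2 + 1) by lra.
pose r := Num.min (Num.min r1 r2) (Num.min r3 (Num.min 1 (10 * (L2 + 1))^-1)).
have [lr1 lr2 lr3] : [/\ r <= r1, r <= r2 & r <= r3] by rewrite /r !ge_min !lexx !orbT.
have [lr4 lr5] : r <= 1 /\ r <= (10 * (L2 + 1))^-1 by rewrite /r !ge_min !lexx !orbT.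
have r0 : 0 < r by rewrite /r !lt_min r10 r20 r30 ltr01 invr_gt0.
exists r, (L1 + L2); split.
- by rewrite r0.
- by rewrite addr_ge0.
- by apply: subset_trans r3U; exact: le_ball.
- move=> q i l pq; rewrite -(jet_basis_wave w p0 k0).
  have c0 : ball p0 r2 p0 by exact: ballxx.
  apply: le_trans (P2 (i, l) p0 q c0 (le_ball lr2 pq)) _.
  have nq : `|q - p0| <= (10 * (L2 + 1))^-1.
    by apply: le_trans lr5; rewrite -ball_normE /= distrC in pq; exact: ltW.
  apply: le_trans (ler_wpM2l L20 nq) _.
  by rewrite ler_pdivrMr//; lra.
move=> x y px py; split=> [j i|i l].
  apply: le_trans (P1 (j, i) x y (le_ball lr1 px) (le_ball lr1 py)) _.
  by rewrite ler_wpM2r// lerDl.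
apply: le_trans (P2 (i, l) x y (le_ball lr2 px) (le_ball lr2 py)) _.
by rewrite ler_wpM2r// lerDr.
Qed.

(** A degenerate zero at [q] with parameters [z] gives ten affine equations for the
    ten coefficients [s], with a matrix close to the identity. Hence [s] is a
    Lipschitz function of the nine numbers that make up [q] and [z]. *)
Lemma avoid_degenerate_zero : exists r : R, [/\ 0 < r, ball p0 r `<=` U &
  forall d, 0 < d <= 1 -> exists s : bool * 'I_5 -> R, (forall i, 0 <= s i <= d) /\
    forall q, ball p0 r q -> ~ degenerate_zero (perturbed_jet s q)].
Proof.
have [r [L [/andP[r0 r1] L0 rU nearI lipL]]] := uniform_ball.
exists r; split=> // d /andP[d0 d1].
have c0 : ball p0 r p0 by exact: ballxx.
have near_p0 q : ball p0 r q -> `|q - p0| <= 1.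
  by rewrite -ball_normE /= distrC => /ltW h; exact: le_trans h r1.
(* Bounds the perturbed jets: five coefficients at most 1, matrix entries at most 2. *)
pose X := \sum_(a : bool * 'I_5) `|jet a.2 (H a.1) p0| + L + 10.
have cube1 s (sd : forall i, 0 <= s i <= d) j (l : 'I_5) : `|s (j, l) : R| <= 1.
  by have /andP[s0 s1] := sd (j, l); rewrite ger0_norm//; exact: le_trans s1 d1.
have Mle q i l : ball p0 r q -> `|M q i l| <= 2.
  move=> pq; rewrite -[M q i l](subrK (i == l)%:R); apply: le_trans (ler_normD _ _) _.
  have h := nearI q i l pq; have : `|(i == l)%:R : R| <= 1 by case: (i == l); rewrite ?normr1 ?normr0.
  by move: h; move: `|_| `|_| => x y; lra.
have JX s q j i : (forall i, 0 <= s i <= d) -> ball p0 r q -> `|perturbed_jet s q j i| <= X.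
  move=> sd pq; rewrite /perturbed_jet /X; apply: le_trans (ler_normD _ _) _; rewrite lerD//.
    rewrite -[X in `|X|](subrK (jet i (H j) p0)) addrC; apply: le_trans (ler_normD _ _) _.
    rewrite lerD//; first by rewrite (bigD1 (j, i))//= lerDl sumr_ge0.
    have [h _] := lipL _ _ c0 pq; apply: le_trans (h j i) _.
    by rewrite ler_piMr// near_p0.
  apply: le_trans (ler_norm_sum _ _ _) _.
  apply: (@le_trans _ _ (\sum_(l : 'I_5) 2)); last by rewrite sumr_const card_ord -mulr_natr; lra.
  apply: ler_sum => l _; rewrite normrM -[leRHS]mul1r ler_pM ?Mle//.
  exact: cube1.
have X0 : 0 <= X by rewrite /X !addr_ge0// sumr_ge0.
(* Each of the three coordinates of a point of the ball is at most [`|p0| + 1]. *)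
pose C := `|p0| + `|p0| + `|p0| + 3 + pi + 4 * X.
have C0 : 0 <= C by have := pi_ge0 R; have := normr_ge0 p0; rewrite /C; lra.
pose loc (z : 'I_9 -> R) : spacetime := (z (inord 0), z (inord 1), z (inord 2)).
pose Bad s z := [/\ ball p0 r (loc z), in_box C z &
  forall j i, perturbed_jet s (loc z) j i = fold_jet j i z].
have [LB LB0 LBP] := lip_common (fun a : bool * 'I_5 => fold_jet_lipschitz a.1 a.2 C0).
have [s [sd sgood]] : exists s : bool * 'I_5 -> R, (forall i, 0 <= s i <= d) /\ forall z, ~ Bad s z.
  apply: (@pigeonhole_avoid R _ _ C (2 * (LB + L + 5 * L))) => //.
  - by rewrite card_prod card_bool !card_ord.
  - by rewrite mulr_ge0// !addr_ge0// mulr_ge0.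
  - by move=> s z _ [].
  move=> s z s' z' e sd sd' [pz zC E] [pz' zC' E'] ze [j i].
  have e0 : 0 <= e by apply: le_trans (ze (inord 0)).
  have le_e : `|loc z - loc z'| <= e by apply: spacetime_norm_le; exact: ze.
  rewrite -mulrA; apply: (@near_identity_matrix R _ (M (loc z)) (fun l => s (j, l) - s' (j, l))).
    move=> i' l; rewrite card_ord; have := nearI _ i' l pz.
    by move: `|_| => x; lra.
  move=> {}i.
  (* Both jet equations hold, at two different points; the matrix at the second
     point is moved to the first. *)
  have -> : \sum_l M (loc z) i l * (s (j, l) - s' (j, l)) =
      (fold_jet j i z - fold_jet j i z') - (jet i (H j) (loc z) - jet i (H j) (loc z'))
      - \sum_l s' (j, l) * (M (loc z) i l - M (loc z') i l).
    rewrite -E -E' /perturbed_jet.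
    have -> : \sum_l M (loc z) i l * (s (j, l) - s' (j, l)) =
        \sum_l s (j, l) * M (loc z) i l - \sum_l s' (j, l) * M (loc z) i l.
      by rewrite -sumrB; apply: eq_bigr => l _; ring.
    have -> : \sum_l s' (j, l) * (M (loc z) i l - M (loc z') i l) =
        \sum_l s' (j, l) * M (loc z) i l - \sum_l s' (j, l) * M (loc z') i l.
      by rewrite -sumrB; apply: eq_bigr => l _; ring.
    by ring.
  have [lH lM] := lipL _ _ pz' pz.
  have Lle (x : R) : x <= L * `|loc z - loc z'| -> x <= L * e.
    by move=> h; apply: le_trans h _; rewrite ler_wpM2l.
  rewrite !mulrDl; apply: le_trans (ler_normB _ _) _; rewrite lerD//.
    apply: le_trans (ler_normB _ _) _; rewrite lerD//; last exact: Lle.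
    exact: (LBP (j, i)).
  apply: le_trans (ler_norm_sum _ _ _) _.
  apply: (@le_trans _ _ (\sum_(l : 'I_5) L * e)); last first.
    by rewrite sumr_const card_ord; lra.
  apply: ler_sum => l _; rewrite normrM -[leRHS]mul1r ler_pM//; first exact: cube1.
  exact: Lle.
exists s; split=> // q pq dq.
have [z [[z0 [z1 z2]] zC Ez]] := degenerate_zero_witness q.1.1 q.1.2 q.2
  (fun j i => JX s q j i sd pq) dq.
have locz : loc z = q by rewrite /loc z0 z1 z2; case: (q) => -[].
apply: (sgood z); split; rewrite ?locz//.
move=> j; apply: le_trans (zC j) _; rewrite lerD// lerD//.
have nq : `|q| <= `|p0| + 1.
  by rewrite -[q in `|q|](subrK p0) addrC; apply: le_trans (ler_normD _ _) _; rewrite lerD// near_p0.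
have [q1 q2 q3] := coordinates_norm_le q.
have h1 := le_trans q1 nq; have h2 := le_trans q2 nq; have h3 := le_trans q3 nq.
by apply: le_trans (lerD (lerD h1 h2) h3) _; lra.
Qed.

End Perturbations.
End Avoidance.

Theorem theorem3p4 (R : realType) (k c : R) (k_gt0 : 0 < k) (c_gt0 : 0 < c) :
  generic_helmholtz k c (fun (Psi : R * R * R -> R * R) (p : R * R * R) =>
    Psi p = 0 ->
    radially_equivalent Psi p regular_singularity \/
    radially_equivalent Psi p hyperbolic_singularity).
Proof.
move=> U Psi p0 oU Up0 [sPsi E1 E2].
have sH j := smooth_component oU j sPsi.
have [r [r0 rU avoid]] := avoid_degenerate_zero (c * k) (lt0r_neq0 k_gt0) oU Up0 sH.
have oV : open (ball p0 r) by exact: ball_open.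
have HV : helmholtz_wave k c (ball p0 r) Psi.
  by split=> [|p /rU|p /rU]; [exact: smooth_sub sPsi|exact: E1|exact: E2].
have sV : smooth_on (ball p0 r) Psi by case: HV.
exists (ball p0 r); split=> //; first exact: ballxx.
move=> K N e _ KV e0.
have [d d01 close] := perturbed_close k c p0 oV sV N e0.
have [s [sd good]] := avoid d d01.
have HPhi := perturbed_helmholtz p0 oV sV s HV.
have sPhi := smooth_perturbed k c p0 oV sV s.
exists (perturbed k c Psi p0 s); split; [exact: HPhi|exact: close|].
move=> q Vq Phi0.
have /(helmholtz_wave_components k c oV sPhi) HPhi' := HPhi.
have traceless j : jet (inord 0) (fun p => component j (perturbed k c Psi p0 s p)) q =
    - jet (inord 3) (fun p => component j (perturbed k c Psi p0 s p)) q.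
  have [h _] := HPhi' j q Vq.
  have c0 : component j (perturbed k c Psi p0 s q) = 0 by rewrite Phi0; case: (j).
  rewrite c0 mulr0 in h.
  have [e_0 _ _ e_3 _] := jetE (fun p => component j (perturbed k c Psi p0 s p)).
  rewrite e_0 e_3; apply/eqP; rewrite -addr_eq0 addrC; exact/eqP.
have [//|deg] := zero_trichotomy oV Vq sPhi Phi0 traceless.
case: (good q Vq).
have jE j i : jet i (fun p => component j (perturbed k c Psi p0 s p)) q =
    jet i (fun p => component j (Psi p)) q +
    \sum_l s (j, l) * jet i (basis_wave k (c * k) p0 l) q.
  rewrite jet_iter_derive (iter_derive_perturbed k c p0 oV sV)// -jet_iter_derive.
  by congr (_ + _); apply: eq_bigr => l _; rewrite -jet_iter_derive.
have -> : (fun j i => jet i (fun p => component j (Psi p)) q +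
    \sum_l s (j, l) * jet i (basis_wave k (c * k) p0 l) q) =
  (fun j i => jet i (fun p => component j (perturbed k c Psi p0 s p)) q).
  by apply/funext => j; apply/funext => i.
exact: deg.
Qed.
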